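(* As $R\to\infty$, $$\#\{\gamma\in\mathrm{SL}_2(\mathbb Z[i]):\ \|\gamma\|\le R\}\ \sim\ \frac{3\pi}{C}\,R^4,$$ where $C=\sum_{n=1}^\infty\frac{(-1)^{n-1}}{(2n-1)^2}$ is Catalan's constant and $\|\cdot\|$ is either the 2-norm (largest singular value) or the Frobenius norm.
   Context: $\mathbb Z[i]$ denotes the Gaussian integers; $f(R)\sim g(R)$ means $f(R)/g(R)\to1$. *)

(* Defs.v *)
From HB Require Import structures.
From mathcomp Require Import all_boot all_order all_algebra.
From mathcomp Require Import finmap complex.
From mathcomp Require Import all_classical all_reals all_analysis.

Set Implicit Arguments.
Unset Strict Implicit.
Unset Printing Implicit Defensive.

Import Order.TTheory GRing.Theory Num.Theory numFieldNormedType.Exports.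

Local Open Scope classical_set_scope.
Local Open Scope ring_scope.
Local Open Scope complex_scope.
Local Open Scope sesquilinear_scope.

Definition gaussInt (R : realType) : {pred R[i]} :=
  [pred z | (complex.Re z \is a Num.int) && (complex.Im z \is a Num.int)].

Definition SL2_gaussInt (R : realType) : set 'M[R[i]]_2 :=
  [set g : 'M[R[i]]_2 | (forall i j, g i j \in @gaussInt R) /\ \det g = 1].

Definition singular_value (R : realType) (m n : nat) (A : 'M[R[i]]_(m, n))
    (s : R) : Prop :=
  0 <= s /\ eigenvalue (A ^t* *m A) (s ^+ 2)%:C.

(* A finite set of reals, nonempty when 0 < n, so that the supremum is the
   largest singular value. *)
Definition norm2 (R : realType) (m n : nat) (A : 'M[R[i]]_(m, n)) : R :=
  sup [set s | singular_value A s].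

Definition frobenius_norm (R : realType) (m n : nat) (A : 'M[R[i]]_(m, n)) : R :=
  Num.sqrt (\sum_i \sum_j Normc.normc (A i j) ^+ 2).

(* [fset_set] is the empty set on infinite sets. This convention cannot make an
   asymptotic with nonzero main term hold: the balls increase with [r], so an
   infinite one would force the count to be 0 for all large [r]. *)
Definition SL2_count (R : realType) (N : 'M[R[i]]_2 -> R) (r : R) : nat :=
  #|` fset_set [set g : 'M[R[i]]_2 | SL2_gaussInt g /\ N g <= r] |.

Definition catalan_constant (R : realType) : R :=
  limn (fun N => \sum_(1 <= n < N.+1)
                   (-1) ^+ (n - 1) / (2 * n - 1)%:R ^+ 2 : R).

Definition asymp_equiv (R : realType) (f g : R -> R) : Prop :=
  f x / g x @[x --> +oo] --> (1 : R).

(* Main.v *)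
(* Write N for the norm of Z[i]. A matrix of SL_2(Z[i]) whose largest entry is the
   upper left one is given by that entry [a] and by [b], [c] with N(b), N(c) <= N(a)
   and a | 1 + bc. Then N(d) = N(b) N(c) / N(a) + O(1), so the square of the Frobenius
   norm is N(a) (1 + u) (1 + v) + O(1) with u = N(b) / N(a) and v = N(c) / N(a).

   On average over [a], the solutions (b, c) of bc = -1 modulo [a] are equidistributed
   in (u, v): after smoothing by boxes and a Fourier expansion modulo [a], the error
   terms are Kloosterman sums over Z[i]. An elementary fourth moment (whose energy is
   controlled by the number of (x, y, z) with a | xyz) and dilation invariance bound
   the fifth power of such a sum, which gives o(X^2) in total. In the main term one
   counts coprime pairs: their density is 1 / zeta_{Q(i)}(2) = 6 / (pi^2 C), because
   Jacobi's two-square theorem identifies the Dedekind zeta function of Q(i) at 2 with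
   zeta(2) C. Hence N(a) <= X, u <= s, v <= t has about tau s t X^2 solutions, with
   tau = 3 pi / C.

   Summing over the four positions of the largest entry gives the constant
   4 tau (\int_0^1 du / (1 + u)^2)^2 = tau for the number of matrices with squared
   Frobenius norm at most X = R^2. The largest singular value s of a matrix of
   determinant 1 satisfies s^2 + s^-2 = squared Frobenius norm, so using it instead
   changes X by at most 1. *)
From HB Require Import structures.
Require Import Defs.
From mathcomp Require Import all_boot all_order all_algebra finfield.
From mathcomp Require Import finmap complex.
From mathcomp Require Import all_classical all_reals all_analysis.
From mathcomp Require Import zify ring lra.

Set Implicit Arguments.
Unset Strict Implicit.
Unset Printing Implicit Defensive.

Import Order.TTheory GRing.Theory Num.Theory numFieldNormedType.Exports.

Local Open Scope classical_set_scope.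
Local Open Scope ring_scope.

(** * Gaussian integers *)

(** The trivial bound [N(a)] for a Kloosterman sum modulo [a] gives order X^2 after summation over
    [a], exactly the size of the main term, so any saving on average suffices. The fourth moment
    over all pairs of frequencies is N(a)^2 times the energy, and the energy is N(a)^(2+o(1)) on
    average; by itself this only returns the trivial bound. The gain comes from dilation: a value k
    occurs once for every unit modulo [a], and as k is at most the number of units, k^5 is bounded
    by N(a)^(4+o(1)). Two boxes smooth [b] and one smooths [c]. One box per variable is spent,
    through Parseval, on summing over the frequencies; the second box of [b] supplies decay at large
    frequencies of [b]. The remaining nonzero frequencies of [b] are represented by finitely many
    numbers that do not depend on [a], and there the averaged bound applies. Frequency zero of [b],
    taken with all frequencies of [c], counts the [c] prime to [a] exactly, which is why coprime
    pairs appear in the main term. Counts are monotone in the rational bounds i/k and j/k, so the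
    smoothing is undone by sandwiching on a finer mesh. *)

Record gint := Gint { gre : int; gim : int }.

Definition gint_pair (z : gint) : int * int := (gre z, gim z).
Definition pair_gint (p : int * int) : gint := Gint p.1 p.2.
Lemma gint_pairK : cancel gint_pair pair_gint. Proof. by case. Qed.
HB.instance Definition _ := Countable.copy gint (can_type gint_pairK).

Definition gadd (z w : gint) := Gint (gre z + gre w) (gim z + gim w).
Definition gopp (z : gint) := Gint (- gre z) (- gim z).
Definition gmul (z w : gint) :=
  Gint (gre z * gre w - gim z * gim w) (gre z * gim w + gim z * gre w).

Lemma gintP (z w : gint) : gre z = gre w -> gim z = gim w -> z = w.
Proof. by case: z => a b; case: w => c d /= -> ->. Qed.

Lemma gaddA : associative gadd.
Proof. by move=> x y z; apply: gintP => /=; ring. Qed.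
Lemma gaddC : commutative gadd.
Proof. by move=> x y; apply: gintP => /=; ring. Qed.
Lemma gadd0 : left_id (Gint 0 0) gadd.
Proof. by move=> x; apply: gintP => /=; ring. Qed.
Lemma gaddN : left_inverse (Gint 0 0) gopp gadd.
Proof. by move=> x; apply: gintP => /=; ring. Qed.
HB.instance Definition _ := GRing.isZmodule.Build gint gaddA gaddC gadd0 gaddN.

Lemma gmulA : associative gmul.
Proof. by move=> x y z; apply: gintP => /=; ring. Qed.
Lemma gmulC : commutative gmul.
Proof. by move=> x y; apply: gintP => /=; ring. Qed.
Lemma gmul1 : left_id (Gint 1 0) gmul.
Proof. by move=> x; apply: gintP => /=; ring. Qed.
Lemma gmulDl : left_distributive gmul gadd.
Proof. by move=> x y z; apply: gintP => /=; ring. Qed.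
Lemma gone_neq0 : Gint 1 0 != 0 :> gint. Proof. by []. Qed.
HB.instance Definition _ :=
  GRing.Zmodule_isComNzRing.Build gint gmulA gmulC gmul1 gmulDl gone_neq0.

Lemma greD z w : gre (z + w) = gre z + gre w. Proof. by []. Qed.
Lemma gimD z w : gim (z + w) = gim z + gim w. Proof. by []. Qed.
Lemma greN z : gre (- z) = - gre z. Proof. by []. Qed.
Lemma gimN z : gim (- z) = - gim z. Proof. by []. Qed.
Lemma greM z w : gre (z * w) = gre z * gre w - gim z * gim w. Proof. by []. Qed.
Lemma gimM z w : gim (z * w) = gre z * gim w + gim z * gre w. Proof. by []. Qed.
Lemma gre0 : gre 0 = 0. Proof. by []. Qed.
Lemma gim0 : gim 0 = 0. Proof. by []. Qed.
Lemma gre1 : gre 1 = 1. Proof. by []. Qed.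
Lemma gim1 : gim 1 = 0. Proof. by []. Qed.
Definition gE := (greD, gimD, greN, gimN, greM, gimM, gre0, gim0, gre1, gim1).

Section gaussian_integers.
Implicit Types a b z w t : gint.

Definition gconj z := Gint (gre z) (- gim z).
Definition gI := Gint 0 1.
Definition gofi (m : int) := Gint m 0.

Lemma gconjM z w : gconj (z * w) = gconj z * gconj w.
Proof. by apply: gintP; rewrite !gE /=; ring. Qed.
Lemma gconjB z w : gconj (z - w) = gconj z - gconj w.
Proof. by apply: gintP; rewrite !gE /=; ring. Qed.
Lemma gconjK : involutive gconj.
Proof. by move=> z; apply: gintP; rewrite /= ?opprK. Qed.

Definition nrm z : nat := (absz (gre z) ^ 2 + absz (gim z) ^ 2)%N.

Lemma nrmE z : (nrm z)%:Z = gre z ^+ 2 + gim z ^+ 2.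
Proof. by rewrite /nrm; lia. Qed.

Lemma nrm_inj_int (m n : nat) : m%:Z = n%:Z -> m = n.
Proof. by case. Qed.

Lemma nrmM z w : nrm (z * w) = (nrm z * nrm w)%N.
Proof. by apply: nrm_inj_int; rewrite PoszM !nrmE !gE; ring. Qed.

Lemma nrm_conj z : nrm (gconj z) = nrm z.
Proof. by apply: nrm_inj_int; rewrite !nrmE /=; ring. Qed.

Lemma nrmN z : nrm (- z) = nrm z.
Proof. by apply: nrm_inj_int; rewrite !nrmE !gE; ring. Qed.

Lemma nrm_eq0 z : (nrm z == 0)%N = (z == 0).
Proof.
apply/idP/eqP => [|->//]; rewrite /nrm addn_eq0 !expn_eq0 /= !andbT !absz_eq0.
by case/andP => /eqP h1 /eqP h2; apply: gintP.
Qed.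

Lemma nrm_gt0 z : (0 < nrm z)%N = (z != 0).
Proof. by rewrite lt0n nrm_eq0. Qed.

Lemma mul_conj z : z * gconj z = gofi (nrm z)%:Z.
Proof. by apply: gintP; rewrite !gE /= ?nrmE; ring. Qed.

Lemma gmul_eq0 (z w : gint) : (z * w == 0) = (z == 0) || (w == 0).
Proof. by rewrite -!nrm_eq0 nrmM muln_eq0. Qed.

Lemma gmulfI (a : gint) : a != 0 -> injective ( *%R a).
Proof.
move=> a0 x y /eqP; rewrite -subr_eq0 -mulrBr gmul_eq0 (negPf a0) /= subr_eq0.
by move/eqP.
Qed.

(** Coordinatewise floor commutes with translation by Gaussian integers, so the remainder depends
    only on the class of [z] modulo [a]: it is a canonical representative, and its vanishing decides
    divisibility. *)
Definition grem a z :=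
  z - a * Gint (divz (gre (z * gconj a)) (nrm a)) (divz (gim (z * gconj a)) (nrm a)).

Definition gdvd a z := grem a z == 0.


Lemma gre_mulz (n : int) (t : gint) : gre (gofi n * t) = n * gre t.
Proof. by rewrite !gE /= mul0r subr0. Qed.
Lemma gim_mulz (n : int) (t : gint) : gim (gofi n * t) = n * gim t.
Proof. by rewrite !gE /= mul0r addr0. Qed.

Lemma gremDM a z t : grem a (z + a * t) = grem a z.
Proof.
rewrite /grem.
have [->|a0] := eqVneq a 0; first by ring.
have n0 : (nrm a)%:Z != 0 by rewrite eqz_nat nrm_eq0.
have -> : (z + a * t) * gconj a = z * gconj a + gofi (nrm a)%:Z * t.
  by rewrite -mul_conj; ring.
move: (z * gconj a) => v.
rewrite greD gimD gre_mulz gim_mulz ![(nrm a)%:Z * _]mulrC.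
rewrite !divzDr ?dvdz_mull // !mulzK //.
have -> : forall q q', Gint (q + gre t) (q' + gim t) = Gint q q' + t.
  by move=> q q'; apply: gintP.
by ring.
Qed.

Lemma grem_sub a z : exists t, z = a * t + grem a z.
Proof. by eexists; rewrite /grem addrC; symmetry; apply: subrK. Qed.

Lemma grem0 a : grem a 0 = 0.
Proof. by rewrite /grem mul0r !div0z [Gint 0 0](_ : _ = 0) // mulr0 subr0. Qed.

Lemma gdvdP a z : reflect (exists t, z = a * t) (gdvd a z).
Proof.
apply: (iffP eqP).
  by case: (grem_sub a z) => t h h0; exists t; rewrite h h0 addr0.
by case=> t ->; rewrite -[_ * _]add0r gremDM grem0.
Qed.

Lemma gdvd_eq a z w : gdvd a (z - w) = (grem a z == grem a w).
Proof.
apply/gdvdP/eqP => [[t h]|h].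
  by rewrite -[z](subrK w) h addrC gremDM.
case: (grem_sub a z) => t ->; case: (grem_sub a w) => t' {1}->; rewrite h.
by exists (t - t'); ring.
Qed.

Lemma grem_id a z : grem a (grem a z) = grem a z.
Proof.
by case: (grem_sub a z) => t h; rewrite [in RHS]h [a * t + _]addrC gremDM.
Qed.

Lemma gdvd0 a : gdvd a 0. Proof. by rewrite /gdvd grem0. Qed.
Lemma gdvdD a z w : gdvd a z -> gdvd a w -> gdvd a (z + w).
Proof.
by move=> /gdvdP[t ->] /gdvdP[u ->]; apply/gdvdP; exists (t + u); ring.
Qed.
Lemma gdvdN a z : gdvd a (- z) = gdvd a z.
Proof.
by apply/gdvdP/gdvdP => -[t h]; exists (- t); [rewrite -[z]opprK h|rewrite h]; ring.
Qed.
Lemma gdvdB a z w : gdvd a z -> gdvd a w -> gdvd a (z - w).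
Proof. by move=> h h'; rewrite gdvdD ?gdvdN. Qed.
Lemma gdvd_mulr a z w : gdvd a z -> gdvd a (z * w).
Proof. by move=> /gdvdP[t ->]; apply/gdvdP; exists (t * w); ring. Qed.
Lemma gdvd_mull a z w : gdvd a z -> gdvd a (w * z).
Proof. by rewrite mulrC; apply: gdvd_mulr. Qed.
Lemma gdvd_refl (a : gint) : gdvd a a.
Proof. by apply/gdvdP; exists 1; ring. Qed.

(* Rounding the exact quotient [z * conj a / nrm a] down coordinatewise leaves
   a remainder in the fundamental parallelogram of [a], whose points have norm
   less than [2 * nrm a]. *)
Lemma grem_lt a z : a != 0 -> (nrm (grem a z) < 2 * nrm a)%N.
Proof.
move=> a0; have n0 : (0 < nrm a)%N by rewrite nrm_gt0.
rewrite -(ltn_pmul2r n0) -[X in (nrm _ * X)%N]nrm_conj -nrmM.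
set w := grem a z * gconj a.
have hw : w = Gint (gre (z * gconj a) %% nrm a)%Z (gim (z * gconj a) %% nrm a)%Z.
  rewrite /w /grem mulrBl mulrAC mul_conj; set v := z * _.
  apply: gintP; rewrite ?greD ?gimD ?greN ?gimN ?gre_mulz ?gim_mulz.
    by apply/eqP; rewrite subr_eq addrC mulrC; apply/eqP/divz_eq.
  by apply/eqP; rewrite subr_eq addrC mulrC; apply/eqP/divz_eq.
have m0 : (nrm a)%:Z != 0 by rewrite eqz_nat -lt0n.
have h1 := modz_ge0 (gre (z * gconj a)) m0.
have h2 := modz_ge0 (gim (z * gconj a)) m0.
have h3 := @ltz_pmod (gre (z * gconj a)) (nrm a) n0.
have h4 := @ltz_pmod (gim (z * gconj a)) (nrm a) n0.
rewrite -ltz_nat nrmE hw !PoszM [gre (Gint _ _)]/= [gim (Gint _ _)]/=.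
move: h1 h2 h3 h4; move: (_ %% _)%Z (_ %% _)%Z => y x h1 h2 h3 h4.
have n0' : 0 < (nrm a)%:Z by rewrite ltz_nat.
have : 0 <= y * ((nrm a)%:Z - y) by rewrite mulr_ge0 // subr_ge0 ltW.
have : 0 <= x * ((nrm a)%:Z - x) by rewrite mulr_ge0 // subr_ge0 ltW.
have : 0 < ((nrm a)%:Z - x) * (nrm a)%:Z by rewrite mulr_gt0 // subr_gt0.
have : 0 < ((nrm a)%:Z - y) * (nrm a)%:Z by rewrite mulr_gt0 // subr_gt0.
lra.
Qed.

(** The norm of [grem a z] can exceed [nrm a], so Euclid's algorithm need not descend with it.
    Rounding to the nearest integer, as the floor of [(2 x + n) / (2 n)], leaves coordinate errors
    of at most one half and makes the norm drop. *)
Lemma gdiv_nearest (a z : gint) : a != 0 ->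
  exists q, (2 * nrm (z - a * q)%R <= nrm a)%N.
Proof.
move=> a0; have n0 : (0 < nrm a)%N by rewrite nrm_gt0.
set n := nrm a; set v := z * gconj a.
exists (Gint ((2 * gre v + n) %/ (2 * n)%N)%Z ((2 * gim v + n) %/ (2 * n)%N)%Z).
rewrite -(leq_pmul2r n0) -mulnA -[X in (nrm _ * X)%N]nrm_conj -nrmM.
rewrite mulrBl mulrAC mul_conj -/v -/n.
have h1 := divz_eq (2 * gre v + n) (2 * n)%N.
have h2 := divz_eq (2 * gim v + n) (2 * n)%N.
have m0 : (2 * n)%N%:Z != 0 by apply: lt0r_neq0; rewrite ltz_nat muln_gt0.
have h3 := modz_ge0 (2 * gre v + n) m0.
have h4 := modz_ge0 (2 * gim v + n) m0.
have h5 : ((2 * gre v + n) %% (2 * n)%N)%Z < (2 * n)%N%:Z by apply: ltz_pmod; rewrite ltz_nat muln_gt0.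
have h6 : ((2 * gim v + n) %% (2 * n)%N)%Z < (2 * n)%N%:Z by apply: ltz_pmod; rewrite ltz_nat muln_gt0.
rewrite -lez_nat PoszM nrmE ?greD ?gimD ?greN ?gimN ?gre_mulz ?gim_mulz.
rewrite !PoszM [gre (Gint _ _)]/= [gim (Gint _ _)]/=.
move: h1 h2 h3 h4 h5 h6; rewrite !PoszM.
move: (_ %/ _)%Z (_ %/ _)%Z (_ %% _)%Z (_ %% _)%Z => q q' r r'.
move: (gre v) (gim v) (n%:Z) => x y m h1 h2 h3 h4 h5 h6.
have : 0 <= r' * (2 * m - r') by rewrite mulr_ge0 // subr_ge0 ltW.
have : 0 <= r * (2 * m - r) by rewrite mulr_ge0 // subr_ge0 ltW.
have -> : r' = 2 * x + m - q' * (2 * m) by lra.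
have -> : r = 2 * y + m - q * (2 * m) by lra.
lra.
Qed.

Lemma gbezout (a b : gint) : exists g u v, [/\ g = u * a + v * b, gdvd g a & gdvd g b].
Proof.
have [m] := ubnP (nrm b); elim: m a b => // m IH a b hb.
have [->|b0] := eqVneq b 0.
  by exists a, 1, 0; split; rewrite ?gdvd_refl ?gdvd0 //; ring.
have [q hq] := gdiv_nearest a b0.
have nb : (0 < nrm b)%N by rewrite nrm_gt0.
have lt : (nrm (a - b * q)%R < m)%N by move: hb; rewrite ltnS; apply: leq_trans; lia.
have [g [u [v [hg h1 h2]]]] := IH b _ lt.
exists g, v, (u - v * q); split => //; first by rewrite hg; ring.
by rewrite -(subrK (b * q) a) gdvdD // gdvd_mulr.
Qed.

Definition zrange (X : nat) : seq int :=
  [seq (i%:Z - X%:Z) | i <- iota 0 (2 * X).+1].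

Lemma mem_zrange X (x : int) : (x \in zrange X) = (absz x <= X)%N.
Proof.
apply/mapP/idP => [[k]|h]; first by rewrite mem_iota => /andP[_ h] ->; lia.
by exists (absz (x + X%:Z)); rewrite ?mem_iota; lia.
Qed.

Lemma zrange_uniq X : uniq (zrange X).
Proof. by rewrite map_inj_uniq ?iota_uniq // => i j; lia. Qed.

Definition ball (X : nat) : seq gint :=
  [seq z <- [seq Gint x y | x <- zrange X, y <- zrange X] | (nrm z <= X)%N].

Lemma allpairs_gint_uniq (s t : seq int) : uniq s -> uniq t ->
  uniq [seq Gint x y | x <- s, y <- t].
Proof. by move=> us ut; apply: allpairs_uniq => // -[x y] [x' y'] _ _ /= [-> ->]. Qed.

Lemma ball_uniq X : uniq (ball X).
Proof. by rewrite filter_uniq // allpairs_gint_uniq ?zrange_uniq. Qed.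

Lemma mem_ball X z : (z \in ball X) = (nrm z <= X)%N.
Proof.
rewrite mem_filter; apply: andb_idr => h; apply/allpairsP.
exists (gre z, gim z); rewrite /= !mem_zrange; split; last by case: (z).
  by move: h; rewrite /nrm; nia.
by move: h; rewrite /nrm; nia.
Qed.

Lemma ball_le X Y : (X <= Y)%N -> (size (ball X) <= size (ball Y))%N.
Proof.
move=> h; apply: uniq_leq_size (ball_uniq _) _ => z.
by rewrite !mem_ball => /leq_trans; apply.
Qed.

(* Each class modulo [a] meets the square of side [nrm a], because [nrm a] is a
   multiple of [a]. *)
Definition Rs a : seq gint :=
  undup [seq grem a (Gint i%:Z j%:Z) | i <- iota 0 (nrm a), j <- iota 0 (nrm a)].

Lemma Rs_uniq a : uniq (Rs a). Proof. exact: undup_uniq. Qed.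

Lemma mem_grem a z : a != 0 -> grem a z \in Rs a.
Proof.
move=> a0; rewrite mem_undup; apply/allpairsP.
have n0 : (0 < nrm a)%N by rewrite nrm_gt0.
have m0 : (nrm a)%:Z != 0 by rewrite eqz_nat -lt0n.
exists (absz (gre z %% nrm a)%Z, absz (gim z %% nrm a)%Z) => /=.
have h1 := modz_ge0 (gre z) m0; have h2 := modz_ge0 (gim z) m0.
have h3 := @ltz_pmod (gre z) (nrm a) n0; have h4 := @ltz_pmod (gim z) (nrm a) n0.
split; rewrite ?mem_iota /=; [lia|lia|].
rewrite !gez0_abs //; apply/eqP; rewrite -gdvd_eq; apply/gdvdP.
exists (gconj a * Gint (gre z %/ nrm a)%Z (gim z %/ nrm a)%Z).
rewrite mulrA mul_conj; apply: gintP.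
  rewrite gre_mulz greD greN /=; apply/eqP; rewrite subr_eq mulrC; apply/eqP/divz_eq.
rewrite gim_mulz gimD gimN /=; apply/eqP; rewrite subr_eq mulrC; apply/eqP/divz_eq.
Qed.

Lemma mem_Rs a z : a != 0 -> (z \in Rs a) = (grem a z == z).
Proof.
move=> a0; apply/idP/eqP => [|<-]; last exact: mem_grem.
by rewrite mem_undup => /allpairsP[p [_ _ ->]]; rewrite grem_id.
Qed.

Lemma Rs_inj a x y : a != 0 -> x \in Rs a -> y \in Rs a -> gdvd a (x - y) -> x = y.
Proof.
by move=> a0; rewrite !mem_Rs // gdvd_eq => /eqP hx /eqP hy /eqP; rewrite hx hy.
Qed.

Lemma Rs_ball a x : a != 0 -> x \in Rs a -> (nrm x < 2 * nrm a)%N.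
Proof. by move=> a0; rewrite mem_Rs // => /eqP <-; apply: grem_lt. Qed.

Lemma Rs_perm a (f : gint -> gint) : a != 0 ->
  (forall x y, x \in Rs a -> y \in Rs a -> gdvd a (f x - f y) -> gdvd a (x - y)) ->
  perm_eq [seq grem a (f x) | x <- Rs a] (Rs a).
Proof.
move=> a0 fi; have u : uniq [seq grem a (f x) | x <- Rs a].
  rewrite map_inj_in_uniq ?Rs_uniq // => x y hx hy /eqP; rewrite -gdvd_eq => h.
  exact/(Rs_inj a0 hx hy)/fi.
apply: uniq_perm => //; first exact: Rs_uniq.
apply: (uniq_min_size u _ _).2 => //; last by rewrite size_map.
by move=> _ /mapP[x _ ->]; apply: mem_grem.
Qed.

Lemma Rs_reindex (T : nmodType) a (f : gint -> gint) (F : gint -> T) : a != 0 ->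
  (forall x y, x \in Rs a -> y \in Rs a -> gdvd a (f x - f y) -> gdvd a (x - y)) ->
  (forall x, F (grem a x) = F x) ->
  \sum_(x <- Rs a) F (f x) = \sum_(x <- Rs a) F x.
Proof.
move=> a0 fi Fi; rewrite -[RHS](perm_big _ (Rs_perm a0 fi)) big_map.
by apply: eq_bigr => x _; rewrite Fi.
Qed.

(** Two-digit expansion: [r + a * s], with digits [r] modulo [a] and [s] modulo [b], runs once
    through the classes modulo [a * b]. *)
Lemma size_RsM a b : a != 0 -> b != 0 -> size (Rs (a * b)) = (size (Rs a) * size (Rs b))%N.
Proof.
move=> a0 b0; have ab0 : a * b != 0 by rewrite gmul_eq0 negb_or a0.
rewrite -(size_allpairs (fun r s => grem (a * b) (r + a * s))).
apply: perm_size; apply: uniq_perm; first exact: Rs_uniq.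
  apply: allpairs_uniq; rewrite ?Rs_uniq //.
  move=> p q /allpairsP[[r s]/= [hr hs ->]] /allpairsP[[r' s']/= [hr' hs' ->]].
  move=> /= /eqP; rewrite -gdvd_eq => /gdvdP[t ht] {p q}.
  have e : r = r'.
    apply: (Rs_inj a0 hr hr'); apply/gdvdP; exists (b * t - s + s').
    have aux (x y x' y' : gint) : x - x' = (x + a * y - (x' + a * y')) - a * y + a * y'.
      by ring.
    by rewrite (aux r s r' s') ht; ring.
  rewrite -{r' hr'}e in ht *; congr (_, _); apply: (Rs_inj b0 hs hs').
  by apply/gdvdP; exists t; apply: (gmulfI a0); rewrite mulrA -ht mulrBr opprD addrACA subrr add0r.
move=> z; apply/idP/idP => [|/allpairsP[p [_ _ ->]]]; last exact: mem_grem.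
rewrite mem_Rs // => /eqP hz.
case: (grem_sub a z) => t ht; case: (grem_sub b t) => u hu.
apply/allpairsP; exists (grem a z, grem b t); rewrite !mem_grem //; split=> //=.
rewrite -[LHS]hz -[RHS](gremDM _ _ u); congr (grem _ _).
by rewrite [LHS]ht [in LHS]hu; ring.
Qed.

Lemma gdvd_conj a z : gdvd (gconj a) (gconj z) = gdvd a z.
Proof.
apply/gdvdP/gdvdP => -[t h]; exists (gconj t); last by rewrite h gconjM.
by rewrite -[z]gconjK h gconjM gconjK.
Qed.

Lemma gconj_eq0 z : (gconj z == 0) = (z == 0).
Proof. by rewrite -!nrm_eq0 nrm_conj. Qed.

Lemma size_Rs_conj a : a != 0 -> size (Rs (gconj a)) = size (Rs a).
Proof.
move=> a0; have a0' : gconj a != 0 by rewrite gconj_eq0.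
have half b : b != 0 -> (size (Rs b) <= size (Rs (gconj b)))%N.
  move=> b0; have b0' : gconj b != 0 by rewrite gconj_eq0.
  rewrite -(size_map (fun z => grem (gconj b) (gconj z))).
  apply: uniq_leq_size => [|_ /mapP[z _ ->]]; last exact: mem_grem.
  rewrite map_inj_in_uniq ?Rs_uniq // => x y hx hy /eqP; rewrite -gdvd_eq => h.
  apply: (Rs_inj b0 hx hy); by rewrite -gdvd_conj gconjB.
by apply/eqP; rewrite eqn_leq half // -{2}[a]gconjK half.
Qed.

Lemma size_Rs_nat (n : nat) : (0 < n)%N -> size (Rs (gofi n)) = (n ^ 2)%N.
Proof.
move=> n0; have g0 : gofi n != 0 by rewrite -nrm_eq0 /nrm /=; nia.
rewrite -[in RHS](size_iota 0 n) -mulnn -(size_allpairs (fun i j : nat => Gint i%:Z j%:Z)).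
have memP z : reflect (exists i j : nat, [/\ (i < n)%N, (j < n)%N & z = Gint i%:Z j%:Z])
    (z \in [seq Gint i%:Z j%:Z | i <- iota 0 n, j <- iota 0 n]).
  apply: (iffP allpairsP) => [[[i j]/=]|[i [j [hi hj ->]]]].
    by rewrite !mem_iota => -[hi hj ->]; exists i, j.
  by exists (i, j); rewrite /= !mem_iota.
rewrite -[RHS](size_map (grem (gofi n))).
apply: perm_size; apply: uniq_perm; first exact: Rs_uniq.
  rewrite map_inj_in_uniq; last first.
    move=> _ _ /memP[i [j [hi hj ->]]] /memP[i' [j' [hi' hj' ->]]] /eqP.
    rewrite -gdvd_eq => /gdvdP[t /(congr1 (fun z => (gre z, gim z)))].
    rewrite gre_mulz gim_mulz !greD !gimD !greN !gimN /= => -[h1 h2].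
    have e1 : gre t = 0 by nia.
    have e2 : gim t = 0 by nia.
    by apply: gintP => /=; [move: h1; rewrite e1|move: h2; rewrite e2]; lia.
  apply: allpairs_uniq; rewrite ?iota_uniq // => -[i j] [i' j'] _ _ /=.
  by case=> -> ->.
move=> z; apply/idP/mapP => [|[w _ ->]]; last exact: mem_grem.
rewrite mem_Rs // => /eqP hz.
have m0 : n%:Z != 0 by rewrite eqz_nat -lt0n.
have h1 := modz_ge0 (gre z) m0; have h2 := modz_ge0 (gim z) m0.
have h3 := @ltz_pmod (gre z) n n0; have h4 := @ltz_pmod (gim z) n n0.
exists (Gint (gre z %% n)%Z (gim z %% n)%Z).
  by apply/memP; exists (absz (gre z %% n)%Z), (absz (gim z %% n)%Z);
     split; rewrite ?gez0_abs //; lia.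
rewrite -{1}hz; apply/eqP; rewrite -gdvd_eq; apply/gdvdP.
exists (Gint (gre z %/ n)%Z (gim z %/ n)%Z); apply: gintP.
  by rewrite gre_mulz greD greN /=; apply/eqP; rewrite subr_eq mulrC; apply/eqP/divz_eq.
by rewrite gim_mulz gimD gimN /=; apply/eqP; rewrite subr_eq mulrC; apply/eqP/divz_eq.
Qed.

(** The number of classes is multiplicative, invariant under conjugation, and [n ^ 2] for a rational
    integer [n]; applied to [a * gconj a = nrm a] this determines its square. *)
Lemma size_Rs a : a != 0 -> size (Rs a) = nrm a.
Proof.
move=> a0; apply/eqP; rewrite -(eqn_exp2r _ _ (isT : (0 < 2)%N)).
by rewrite -(@size_Rs_nat (nrm a)) ?nrm_gt0 // -mul_conj size_RsM ?gconj_eq0 // size_Rs_conj.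
Qed.

End gaussian_integers.

(** * Jacobi's two-square theorem *)

Section two_squares.
Implicit Types a b z w t : gint.

Lemma nrm_dvd a z : gdvd a z -> (nrm a %| nrm z)%N.
Proof. by move=> /gdvdP[t ->]; rewrite nrmM dvdn_mulr. Qed.

Lemma nrm1_unit t : nrm t = 1%N -> t * gconj t = 1.
Proof. by move=> h; rewrite mul_conj h. Qed.

Lemma gdvd_trans b a z : gdvd a b -> gdvd b z -> gdvd a z.
Proof. by move=> h /gdvdP[t ->]; apply: gdvd_mulr. Qed.

Lemma gdvd_nrm_eq a z : z != 0 -> gdvd a z -> nrm a = nrm z -> gdvd z a.
Proof.
move=> z0 /gdvdP[t h] e; move: (e); rewrite h nrmM -{1}[nrm a]muln1.
move/eqP; rewrite eqn_mul2l nrm_eq0 => /orP[/eqP a0|/eqP/esym h1].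
  by rewrite h a0 mul0r eqxx in z0.
by apply/gdvdP; exists (gconj t); rewrite -mulrA nrm1_unit // mulr1.
Qed.

Definition sphere (n : nat) := [seq z <- ball n | nrm z == n].
Definition r2 n := size (sphere n).

Lemma mem_sphere n z : (z \in sphere n) = (nrm z == n).
Proof. by rewrite mem_filter mem_ball andb_idr // => /eqP ->. Qed.
Lemma sphere_uniq n : uniq (sphere n). Proof. exact/filter_uniq/ball_uniq. Qed.

Lemma count_sphere_dvd a m : a != 0 ->
  count (gdvd a) (sphere (nrm a * m)) = r2 m.
Proof.
move=> a0; rewrite -size_filter -[RHS](size_map ( *%R a)).
apply: perm_size; apply: uniq_perm; first by rewrite filter_uniq ?sphere_uniq.
  by rewrite map_inj_uniq ?sphere_uniq //; apply: gmulfI.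
have n0 : (0 < nrm a)%N by rewrite nrm_gt0.
move=> z; rewrite mem_filter mem_sphere; apply/andP/mapP => [[/gdvdP[t ->]]|[t]].
  by rewrite nrmM eqn_pmul2l // => h; exists t => //; rewrite mem_sphere.
rewrite mem_sphere => /eqP h ->; rewrite gdvd_mulr ?gdvd_refl //.
by rewrite nrmM h.
Qed.

Lemma gprime_dvd a z w : prime (nrm a) -> gdvd a (z * w) -> gdvd a z || gdvd a w.
Proof.
move=> pa h; case: (gbezout a z) => g [u [v [hg ga gz]]].
have a0 : a != 0 by rewrite -nrm_gt0 prime_gt0.
have := nrm_dvd ga; move/(primeP pa).2 => /orP[] /eqP hn.
  apply/orP; right.
  rewrite -[w]mul1r -(nrm1_unit hn) hg.
  rewrite (_ : _ * w = a * (u * gconj (u * a + v * z) * w)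
     + z * w * (v * gconj (u * a + v * z))); last by ring.
  by apply: gdvdD; apply: gdvd_mulr => //; apply: gdvd_refl.
by apply/orP; left; apply: gdvd_trans gz; apply: gdvd_nrm_eq.
Qed.

Lemma gdvd_nat (n : nat) z : (gdvd (gofi n) z) = (n %| absz (gre z))%N && (n %| absz (gim z))%N.
Proof.
apply/gdvdP/andP => [[t ->]|].
  by rewrite gre_mulz gim_mulz !abszM !dvdn_mulr.
case=> /dvdnP[k hk] /dvdnP[l hl].
exists (Gint (sgz (gre z) * k) (sgz (gim z) * l)); apply: gintP.
  by rewrite gre_mulz /=; have := abszE; lia.
by rewrite gim_mulz /=; lia.
Qed.

Lemma nrm_gofi (n : nat) : nrm (gofi n) = (n ^ 2)%N.
Proof. by rewrite /nrm /= exp0n // addn0. Qed.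

(* Wilson's theorem with the last k factors of (p-1)! folded to their negatives. *)
Lemma sqrtN1_mod (p : nat) : prime p -> (p %% 4 = 1)%N -> exists j, (p %| j ^ 2 + 1)%N.
Proof.
move=> pp p1; exists ((p.-1)./2)`!.
have p0 : (0 < p)%N by exact: prime_gt0.
pose f (n : nat) : 'F_p := n%:R.
have fz n : (f n == 0) = (p %| n)%N.
  by rewrite /f -(dvdn_pcharf (pchar_Fp pp)).
have fold k : (k < p)%N -> f (p.-1)`! = (-1) ^+ k * f k`! * f (p.-1 - k)`!.
  elim: k => [|k IH] h; first by rewrite subn0 /f fact0 expr0 !mul1r.
  rewrite (IH (ltnW h)) (_ : (p.-1 - k)%N = (p.-1 - k.+1).+1); last by lia.
  rewrite !factS /f !natrM exprS.
  have -> : ((p.-1 - k.+1).+1%:R : 'F_p) = - k.+1%:R.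
    apply/eqP; rewrite -subr_eq0 opprK -natrD (_ : (_ + _)%N = p) ?pchar_Fp_0 //; lia.
  by ring.
have w : f (p.-1)`! = -1.
  have : f (p.-1)`!.+1 == 0 by rewrite fz -Wilson ?prime_gt1.
  by rewrite /f -natr1 addr_eq0 => /eqP.
have e2 : (p.-1)./2 = (p %/ 4).*2 by lia.
have lt : ((p.-1)./2 < p)%N by lia.
have := fold _ lt; rewrite w (_ : (p.-1 - (p.-1)./2)%N = (p.-1)./2); last by lia.
rewrite e2 -signr_odd odd_double expr0 mul1r => h.
by rewrite -fz /f natrD -mulnn natrM -/(f _) -h addNr.
Qed.

(** A gcd of [p] and [j + i] has norm dividing [p ^ 2]. Norm 1 would make [p] divide [j - i],
    because [p] divides [(j + i) (j - i)], and norm [p ^ 2] would make it divide [j + i]; both fail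
    in the imaginary part. *)
Lemma two_squares (p : nat) : prime p -> (p %% 4 = 1)%N -> exists a, nrm a = p.
Proof.
move=> pp p1; have [j hj] := sqrtN1_mod pp p1.
case: (gbezout (gofi p) (Gint j 1)) => g [u [v [hg g1 g2]]].
exists g; have := nrm_dvd g1; rewrite nrm_gofi => /(dvdn_pfactor _ _ pp)[k k2 hk].
case: k k2 hk => [|[|[|//]]] _ hk; rewrite ?expn0 ?expn1 in hk => //.
  have : gdvd (gofi p) (Gint j (-1)).
    rewrite -[Gint j (-1)]mul1r -(nrm1_unit hk) hg.
    set c := gconj _.
    rewrite (_ : _ * _ = gofi p * (u * c * Gint j (-1)) + (Gint j 1 * Gint j (-1)) * (v * c)); last by ring.
    apply: gdvdD; apply: gdvd_mulr; first exact: gdvd_refl.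
    rewrite (_ : Gint j 1 * Gint j (-1) = gofi (j ^ 2 + 1)%N%:Z); last by apply: gintP; rewrite !gE /=; lia.
    by rewrite gdvd_nat /= hj dvdn0.
  by rewrite gdvd_nat /= dvdn1 => /andP[_ /eqP p1']; rewrite p1' in pp.
have : gdvd (gofi p) (Gint j 1).
  apply: gdvd_trans g2; apply: gdvd_nrm_eq => //; last by rewrite nrm_gofi.
  by rewrite -nrm_gt0 nrm_gofi expn_gt0 prime_gt0.
by rewrite gdvd_nat /= dvdn1 => /andP[_ /eqP p1']; rewrite p1' in pp.
Qed.

(** If [p] does not divide [y], raising [x ^ 2 = - y ^ 2] to the odd power [(p - 1) / 2] gives
    [1 = -1] in the prime field by Fermat. *)
Lemma inert_dvd (p : nat) z : prime p -> (p %% 4 = 3)%N -> (p %| nrm z)%N -> gdvd (gofi p) z.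
Proof.
move=> pp p3 h.
have key (x y : nat) : (p %| x ^ 2 + y ^ 2)%N -> (p %| y)%N.
  move=> {}h; apply/negPn/negP => ny.
  pose f (n : nat) : 'F_p := n%:R.
  have fz n : (f n == 0) = (p %| n)%N by rewrite /f -(dvdn_pcharf (pchar_Fp pp)).
  have fl n : ~~ (p %| n)%N -> f n ^+ p.-1 = 1.
    rewrite -fz => n0; apply: (mulfI n0); rewrite mulr1 -exprS prednK ?prime_gt0 //.
    by have := expf_card (f n); rewrite card_Fp.
  move: h; rewrite -fz /f natrD !natrX addr_eq0 -/(f x) -/(f y) => /eqP h.
  have nx : ~~ (p %| x)%N.
    by apply: contra ny; rewrite -!fz => /eqP x0; move: h; rewrite x0 expr0n /= => /esym/eqP; rewrite oppr_eq0 expf_eq0.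
  have : (f x ^+ 2) ^+ (p.-1)./2 = (- f y ^+ 2) ^+ (p.-1)./2 by rewrite h.
  have e : (2 * (p.-1)./2)%N = p.-1 by lia.
  rewrite exprNn -!exprM !e !fl // mulr1 -signr_odd.
  rewrite (_ : odd _ = true); last by lia.
  move/eqP; rewrite expr1 -subr_eq0 opprK -(natrD _ 1 1) -/(f 2) fz => /dvdn_leq; lia.
rewrite gdvd_nat; rewrite /nrm in h.
by rewrite (key _ _ h) andbT; rewrite addnC in h; rewrite (key _ _ h).
Qed.

(** The nonprincipal Dirichlet character modulo 4. *)
Definition chi (d : nat) : int :=
  if (d %% 4 == 1)%N then 1 else if (d %% 4 == 3)%N then -1 else 0.

Lemma chiM d e : chi (d * e) = chi d * chi e.
Proof.
rewrite /chi -modnMm.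
have := ltn_pmod d (isT : (0 < 4)%N); have := ltn_pmod e (isT : (0 < 4)%N).
by move: (d %% 4)%N (e %% 4)%N => [|[|[|[|x]]]] [|[|[|[|y]]]].
Qed.

(** Jacobi's theorem follows once [r2] and the divisor sum obey the same recursion at every prime.
    For [p = 1] modulo 4, a point of norm [p m] is divisible by [a] or by [gconj a], and by both
    exactly when [p] divides it; for [p = 2] all points are divisible by [1 + i], and for [p = 3]
    modulo 4 all are divisible by [p]. *)
Lemma r2_hecke (p m : nat) : prime p -> (0 < m)%N ->
  (r2 (p * m))%:Z = (1 + chi p) * (r2 m)%:Z
     - chi p * (if (p %| m)%N then (r2 (m %/ p))%:Z else 0).
Proof.
move=> pp m0; have p0 := prime_gt0 pp.
have cp : count (gdvd (gofi p)) (sphere (p * m)) =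
          if (p %| m)%N then r2 (m %/ p) else 0%N.
  case: ifP => [/dvdnP[k ->]|nd].
    rewrite mulnK // mulnCA mulnn mulnC -nrm_gofi count_sphere_dvd //.
    by rewrite -nrm_gt0 nrm_gofi expn_gt0 p0.
  apply/eqP; rewrite -leqn0 leqNgt -has_count; apply/hasPn => z.
  rewrite mem_sphere => /eqP hz; apply/negP => /nrm_dvd; rewrite hz nrm_gofi -mulnn.
  by rewrite dvdn_pmul2l // nd.
have : (p %% 4)%N \in [:: 1; 2; 3]%N.
  by rewrite !inE; have [->//|op] := even_prime pp; lia.
rewrite !inE /chi => /or3P[] /eqP hp; rewrite hp /=.
- have [a ha] := two_squares pp hp.
  have a0 : a != 0 by rewrite -nrm_gt0 ha.
  have ca0 : gconj a != 0 by rewrite gconj_eq0.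
  have pa : prime (nrm a) by rewrite ha.
  have pca : prime (nrm (gconj a)) by rewrite nrm_conj.
  have hall : all (predU (gdvd a) (gdvd (gconj a))) (sphere (p * m)).
    apply/allP => z; rewrite mem_sphere => /eqP hz /=.
    have : gdvd a (z * gconj z).
      by rewrite mul_conj hz -ha; apply/gdvdP; exists (gconj a * gofi m);
        rewrite mulrA mul_conj; apply: gintP; rewrite !gE /=; lia.
    by move/(gprime_dvd pa); rewrite -[X in _ || X]gdvd_conj gconjK.
  have hI : {in sphere (p * m), predI (gdvd a) (gdvd (gconj a)) =1 gdvd (gofi p)}.
    move=> z _ /=; apply/andP/idP => [[/gdvdP[t ->]]|].
      move=> /(gprime_dvd pca)/orP[|/gdvdP[u ->]]; last first.
        by rewrite mulrA mul_conj ha gdvd_mulr ?gdvd_refl.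
      (* Here [gconj a] divides [a], hence [2 * gre a]; then [p] divides [gre a], which is
         incompatible with [gre a ^ 2 + gim a ^ 2 = p]. *)
      move=> h; exfalso.
      have : gdvd (gconj a) (a + gconj a) by rewrite gdvdD ?gdvd_refl.
      rewrite (_ : a + gconj a = gofi (2 * gre a)); last by apply: gintP; rewrite !gE /=; lia.
      move/nrm_dvd; rewrite nrm_conj ha /nrm /= exp0n // addn0 Euclid_dvdX // andbT abszM.
      rewrite Euclid_dvdM // => /orP[h2|]; first by have := prime_gt1 pp; have := dvdn_leq (isT : (0 < 2)%N) h2; lia.
      have := ha; rewrite /nrm => hs /dvdnP[[|k] hk].
        rewrite hk mul0n exp0n // add0n in hs.
        have : (absz (gim a) %| p)%N by rewrite -hs -mulnn dvdn_mulr.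
        move/(primeP pp).2 => /orP[] /eqP.
          by have := prime_gt1 pp; nia.
        by have := prime_gt1 pp; nia.
      have le : (p <= absz (gre a))%N by rewrite hk mulSn leq_addr.
      have le2 := leq_mul le le.
      have lt : (p * 1 < p * p)%N by rewrite ltn_pmul2l // prime_gt1.
      by move: hs le2 lt; rewrite -mulnn; lia.
    by move=> h; split; apply: gdvd_trans h; rewrite -ha -mul_conj;
       [rewrite gdvd_mulr|rewrite gdvd_mull]; rewrite ?gdvd_refl.
  have := count_predUI (gdvd a) (gdvd (gconj a)) (sphere (p * m)).
  have -> : count (predU (gdvd a) (gdvd (gconj a))) (sphere (p * m)) = r2 (p * m).
    by apply/eqP; rewrite -all_count.
  have -> : count (gdvd a) (sphere (p * m)) = r2 m by rewrite -ha count_sphere_dvd.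
  have -> : count (gdvd (gconj a)) (sphere (p * m)) = r2 m.
    by rewrite -ha -nrm_conj count_sphere_dvd.
  rewrite (eq_in_count hI) cp.
  by case: ifP; lia.
- have p2 : p = 2%N.
    by apply/eqP; case: (even_prime pp) => [->//|]; lia.
  have [n2 a0] : nrm (Gint 1 1) = p /\ Gint 1 1 != 0 by rewrite p2.
  rewrite -(count_sphere_dvd m a0) n2 mul0r subr0 addr0 mul1r; congr Posz.
  rewrite /r2; apply/esym/eqP; rewrite -all_count; apply/allP => z.
  rewrite mem_sphere p2 /nrm => /eqP h; apply/gdvdP.
  (* The quotient [z / (1 + i) = z (1 - i) / 2], integral because the coordinates of [z] have the
     same parity. *)
  exists (Gint ((gre z + gim z) %/ 2)%Z ((gim z - gre z) %/ 2)%Z).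
  have e : (gre z + gim z) = 2 * ((gre z + gim z) %/ 2)%Z by nia.
  have e' : (gim z - gre z) = 2 * ((gim z - gre z) %/ 2)%Z by nia.
  by apply: gintP; rewrite !gE /=; lia.
- rewrite subrr mul0r add0r mulN1r opprK.
  rewrite (_ : (if _ then _ else _) = (count (gdvd (gofi p)) (sphere (p * m)))%:Z); last first.
    by rewrite cp; case: ifP.
  congr Posz.
  apply/esym/eqP; rewrite -all_count; apply/allP => z.
  by rewrite mem_sphere => /eqP h; apply: inert_dvd => //; rewrite h dvdn_mulr.
Qed.

Definition chisum (n : nat) : int := \sum_(d <- divisors n) chi d.

Lemma chisum_hecke (p m : nat) : prime p -> (0 < m)%N ->
  chisum (p * m) = (1 + chi p) * chisum m
     - chi p * (if (p %| m)%N then chisum (m %/ p) else 0).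
Proof.
move=> pp m0; have p0 := prime_gt0 pp.
have mulp n : (0 < n)%N ->
    \sum_(d <- divisors (p * n) | (p %| d)%N) chi d = chi p * chisum n.
  move=> n0; rewrite -big_filter /chisum big_distrr /=.
  under [RHS]eq_bigr do rewrite -chiM.
  rewrite -(big_map (muln p) predT chi); apply: perm_big; apply: uniq_perm.
  - by rewrite filter_uniq // divisors_uniq.
  - by rewrite map_inj_uniq ?divisors_uniq // => x y /eqP; rewrite eqn_pmul2l // => /eqP.
  move=> d; rewrite mem_filter -dvdn_divisors ?muln_gt0 ?p0 //.
  apply/andP/mapP => [[/dvdnP[k ->]]|[k]].
    by rewrite mulnC dvdn_pmul2l // => h; exists k => //; rewrite -dvdn_divisors.
  by rewrite -dvdn_divisors // => h ->; rewrite dvdn_mulr // dvdn_pmul2l.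
have nmulp : \sum_(d <- divisors (p * m) | ~~ (p %| d)%N) chi d
           = \sum_(d <- divisors m | ~~ (p %| d)%N) chi d.
  rewrite -big_filter -[RHS]big_filter; apply: perm_big; apply: uniq_perm.
  - by rewrite filter_uniq // divisors_uniq.
  - by rewrite filter_uniq // divisors_uniq.
  move=> d; rewrite !mem_filter -!dvdn_divisors ?muln_gt0 ?p0 //.
  case pd: (p %| d)%N => //=; apply/idP/idP => [|h]; last exact: dvdn_mull.
  by rewrite Gauss_dvdr // coprime_sym prime_coprime // pd.
have e : chisum m = \sum_(d <- divisors m | (p %| d)%N) chi d +
                    \sum_(d <- divisors m | ~~ (p %| d)%N) chi d.
  by rewrite /chisum (bigID (fun d => p %| d)%N).
rewrite {1}/chisum (bigID (fun d => p %| d)%N) /= mulp // nmulp.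
case: ifP => pm.
  have mp : (0 < m %/ p)%N by rewrite divn_gt0 // dvdn_leq.
  have := mulp _ mp; rewrite (_ : (p * (m %/ p))%N = m); last by rewrite mulnC divnK.
  by move=> h; rewrite h in e; rewrite e; ring.
rewrite [X in _ = X + _](_ : _ = 0) in e; last first.
  apply: big1_seq => d /andP[pd]; rewrite -dvdn_divisors // => dm.
  by rewrite (dvdn_trans pd dm) in pm.
by rewrite e; ring.
Qed.

Lemma r2_1 : r2 1 = 4%N. Proof. by vm_compute. Qed.

Theorem jacobi_two_squares (n : nat) : (0 < n)%N -> (r2 n)%:Z = 4 * chisum n.
Proof.
elim/ltn_ind: n => n IH n0.
have [n1|n1] := leqP n 1.
  have -> : n = 1%N by lia.
  by rewrite r2_1 /chisum (_ : divisors 1 = [:: 1%N]) // big_seq1.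
have pp := pdiv_prime n1; have /dvdnP[m hm] := pdiv_dvd n.
move: (pdiv n) pp hm => p pp hm.
have p1 := prime_gt1 pp.
have m0 : (0 < m)%N by case: m hm n0 => // ->.
rewrite hm mulnC r2_hecke // chisum_hecke // IH //; last by rewrite hm; nia.
case: ifP => pm; last by ring.
have mp : (0 < m %/ p)%N by rewrite divn_gt0 ?prime_gt0 // dvdn_leq.
rewrite IH //; first by ring.
have := leq_div m p; rewrite hm; nia.
Qed.

End two_squares.

(** * Lattice points in discs *)

Lemma cvg_natP (R : realType) (u : nat -> R) (l : R) :
  (u n @[n --> \oo] --> l) <->
  (forall e : R, 0 < e -> exists N, forall n, (N <= n)%N -> `|u n - l| <= e).
Proof.
split=> [/cvgrPdist_le h e e0|h].
  by have [N _ hN] := h e e0; exists N => n Nn; rewrite distrC; apply: hN.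
apply/cvgrPdist_le => e e0; have [N hN] := h e e0.
by exists N => // n /= Nn; rewrite distrC; apply: hN.
Qed.

Lemma size_sum_sphere X : size (ball X) = (\sum_(0 <= n < X.+1) r2 n)%N.
Proof.
elim: X => [|X IH]; first by rewrite big_nat1; vm_compute.
rewrite big_nat_recr //= -IH /r2 -size_cat; apply: perm_size; apply: uniq_perm.
- exact: ball_uniq.
- rewrite cat_uniq ball_uniq sphere_uniq andbT /=; apply/hasPn => z.
  by rewrite mem_sphere => /eqP h; rewrite mem_ball h ltnn.
by move=> z; rewrite mem_cat !mem_ball mem_sphere leq_eqVlt ltnS orbC.
Qed.

Lemma chisumE (n X : nat) : (0 < n <= X)%N ->
  chisum n = \sum_(1 <= d < X.+1) \sum_(1 <= e < X.+1 | (d * e == n)%N) chi d.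
Proof.
case/andP=> n0 nX; rewrite /chisum.
rewrite (perm_big [seq d <- index_iota 1 X.+1 | (d %| n)%N]); last first.
  apply: uniq_perm; rewrite ?divisors_uniq ?filter_uniq ?iota_uniq // => d.
  rewrite mem_filter -dvdn_divisors // mem_index_iota; apply/idP/andP => [h|[]//].
  by split=> //; rewrite ltnS (dvdn_gt0 n0 h) (leq_trans (dvdn_leq n0 h)).
rewrite big_filter big_mkcond; apply: eq_big_nat => d /andP[d0 dX].
case: ifP => [/dvdnP[k hk]|nd]; last first.
  by rewrite big1 // => e /eqP h; rewrite -h dvdn_mulr in nd.
have k0 : (0 < k < X.+1)%N by move: n0 nX; rewrite hk; nia.
rewrite (eq_bigl (fun e => e == k)); last by move=> e; rewrite hk [(k * d)%N]mulnC eqn_pmul2l.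
by rewrite big_nat1_eq k0.
Qed.

Lemma sum_hyperbola (T : nmodType) (F : nat -> nat -> T) X :
  \sum_(1 <= e < X.+1) \sum_(1 <= d < (X %/ e).+1) F d e =
  \sum_(1 <= e < X.+1) \sum_(1 <= d < X.+1 | (d * e <= X)%N) F d e.
Proof.
apply: eq_big_nat => e /andP[e0 _].
rewrite [RHS]big_nat_cond [in RHS](big_cat_nat _ (n := (X %/ e).+1)) ?ltnS ?leq_div //=.
rewrite [X in _ = _ + X]big1_seq ?addr0; last first.
  by move=> d /andP[/andP[_ h]]; rewrite mem_index_iota; have := leq_divRL d X e0; lia.
rewrite big_nat_cond [RHS]big_nat_cond; apply: eq_bigl => d.
have := leq_divRL d X e0; have := leq_div X e; lia.
Qed.

Lemma sum_hyperbolaC (T : nmodType) (F : nat -> nat -> T) X :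
  \sum_(1 <= e < X.+1) \sum_(1 <= d < (X %/ e).+1) F d e =
  \sum_(1 <= d < X.+1) \sum_(1 <= e < (X %/ d).+1) F d e.
Proof.
rewrite sum_hyperbola (sum_hyperbola (fun e d => F d e)).
under eq_bigr do rewrite big_mkcond.
under [RHS]eq_bigr do rewrite big_mkcond.
by rewrite exchange_big /=; do 2!apply: eq_bigr => ? _; rewrite mulnC.
Qed.

Lemma sum_chisum (R : pzRingType) (c : nat -> R) (X : nat) :
  \sum_(1 <= n < X.+1) c n * (chisum n)%:~R =
  \sum_(1 <= e < X.+1) \sum_(1 <= d < (X %/ e).+1) c (d * e)%N * (chi d)%:~R.
Proof.
rewrite sum_hyperbola.
transitivity (\sum_(1 <= n < X.+1) \sum_(1 <= d < X.+1)
   \sum_(1 <= e < X.+1 | (d * e == n)%N) c (d * e)%N * (chi d)%:~R).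
  apply: eq_big_nat => n hn; rewrite (chisumE hn) rmorph_sum big_distrr /=.
  apply: eq_bigr => d _; rewrite rmorph_sum big_distrr /=.
  by apply: eq_bigr => e /eqP <-.
rewrite exchange_big /=; under [RHS]eq_bigr do rewrite big_mkcond.
rewrite [RHS]exchange_big /=; apply: eq_bigr => d _.
under eq_bigr do rewrite big_mkcond.
rewrite exchange_big /=; apply: eq_big_nat => e /andP[e0 eX].
rewrite -big_mkcond /=; under eq_bigl do rewrite eq_sym.
have [->|d0] := posnP d; first by rewrite mul0n /chi /= big1 ?mulr0 ?if_same // => *; rewrite mulr0.
by rewrite big_nat1_eq muln_gt0 d0 e0 ltnS.
Qed.

(** The 1 is the origin. For the other points, Jacobi's formula is summed over factorizations
    [n = d * e], with [e] first. *)
Lemma size_ball_chi (R : pzRingType) X : (size (ball X))%:R =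
  1 + 4 * \sum_(1 <= d < X.+1) (chi d)%:~R * (X %/ d)%:R :> R.
Proof.
rewrite size_sum_sphere big_ltn // [r2 0](_ : _ = 1%N); last by vm_compute.
rewrite natrD; congr (_ + _).
transitivity (4 * \sum_(1 <= n < X.+1) 1 * (chisum n)%:~R : R).
  rewrite natr_sum big_distrr /=; apply: eq_big_nat => n /andP[n0 _].
  by have := congr1 (fun z : int => z%:~R : R) (jacobi_two_squares n0); rewrite mul1r intrM.
congr (_ * _); rewrite sum_chisum sum_hyperbolaC; apply: eq_bigr => d _.
by rewrite mul1r sumr_const_nat subn1 /= mulr_natr.
Qed.

(** * Alternating sums with the character modulo 4 *)

Section alternating.
Variable R : realType.
Implicit Types f : nat -> R.

Local Notation chir d := ((chi d)%:~R : R).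

Lemma chi_odd d : odd d -> chi d.+2 = - chi d /\ chi d * chi d = 1.
Proof.
rewrite /chi => od.
have [h|h] : (d %% 4 = 1)%N \/ (d %% 4 = 3)%N by lia.
  by rewrite (_ : (d.+2 %% 4 = 3)%N) ?h //; lia.
by rewrite (_ : (d.+2 %% 4 = 1)%N) ?h //; lia.
Qed.

Lemma chi_even d : ~~ odd d -> chi d = 0.
Proof. by rewrite /chi => od; do 2 (case: eqP => [h|_]; first by lia). Qed.

Lemma chi_norm_le1 d : `|chir d| <= 1.
Proof.
by rewrite /chi; case: eqP => _; last case: eqP => _; rewrite ?rmorphN /= ?normrN ?normr1 ?normr0.
Qed.

(** The character vanishes at even arguments and alternates at odd ones, so this is the usual
    estimate of an alternating sum by its first term; the induction moves by two. The factor
    [chir m] makes the first term positive. *)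
Lemma chi_sum_odd f m n : (forall i j, (m <= i <= j)%N -> f j <= f i) ->
  (forall i, 0 <= f i) -> odd m ->
  0 <= chir m * \sum_(m <= d < n) chir d * f d <= f m.
Proof.
move=> + f0; have [k] := ubnP (n - m); elim: k m => // k IH m hk fd om.
have [mn|mn] := leqP n m.
  by rewrite big_geq // mulr0 lexx /=.
have [c2 c1] := chi_odd om.
have e1 : chir m * chir m = 1 by rewrite -intrM c1.
rewrite big_ltn // mulrDr mulrA e1 mul1r.
have [mn2|mn2] := leqP n m.+1; first by rewrite big_geq // mulr0 addr0 f0 lexx.
rewrite big_ltn // [chi m.+1]chi_even /= ?om // mul0r add0r.
have -> : chir m = - chir m.+2 by rewrite c2 rmorphN opprK.
have /andP[h1 h2] : 0 <= chir m.+2 * \sum_(m.+2 <= d < n) chir d * f d <= f m.+2.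
  apply: IH; rewrite /= ?om //; first by lia.
  by move=> i j hij; apply: fd; lia.
have h3 : f m.+2 <= f m by apply: fd; lia.
by rewrite mulNr; apply/andP; split; lra.
Qed.

Lemma chi_sum_le f m n : (forall i j, (m <= i <= j)%N -> f j <= f i) ->
  (forall i, 0 <= f i) -> `|\sum_(m <= d < n) chir d * f d| <= f m.
Proof.
move=> fd f0.
have hodd m' : (m <= m')%N -> odd m' -> `|\sum_(m' <= d < n) chir d * f d| <= f m'.
  move=> mm om; have [_ c1] := chi_odd om.
  have e1 : `|chir m'| = 1.
    apply/eqP; rewrite -sqrp_eq1 // -normrX expr2 -intrM c1 normr1 //.
  have /andP[h1 h2] := @chi_sum_odd f m' n (fun i j h => fd i j ltac:(lia)) f0 om.
  have := normrM (chir m') (\sum_(m' <= d < n) chir d * f d).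
  by rewrite e1 mul1r => <-; rewrite ger0_norm.
have [om|om] := boolP (odd m); first exact: hodd.
have [mn|mn] := leqP n m; first by rewrite big_geq // normr0.
rewrite big_ltn // chi_even // mul0r add0r.
by apply: (le_trans (hodd _ (leqnSn _) _)); rewrite /= ?om //; apply: fd; lia.
Qed.

Lemma size_ball_le X : (size (ball X) <= 4 * X + 1)%N.
Proof.
have [->|X0] := posnP X; first by vm_compute.
rewrite -(ler_nat R) size_ball_chi natrD natrM addrC lerD2r ler_wpM2l //.
(* The index [d.-1.+1] is [d] for [d > 0]; at 0 it avoids the convention [X %/ 0 = 0], which would
   break monotonicity. *)
pose f d := (X %/ d.-1.+1)%:R : R.
have -> : \sum_(1 <= d < X.+1) chir d * (X %/ d)%:R = \sum_(1 <= d < X.+1) chir d * f d.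
  by apply: eq_big_nat => -[|d].
apply: le_trans (ler_norm _) _; apply: le_trans (chi_sum_le _ _ _) _ => //.
  by move=> i j hij; rewrite /f ler_nat leq_div2l //; lia.
by rewrite /f divn1.
Qed.

(** Cut at [D]: the alternating tail is at most its first term [X / D], while each of the fewer than
    [D] initial terms changes by at most 1 when the floor is removed. *)
Lemma size_ball_approx X D : (0 < D)%N ->
  `|(size (ball X))%:R - 4 * X%:R * \sum_(1 <= d < D) chir d / d%:R| <=
    1 + 4 * D%:R + 4 * X%:R / D%:R.
Proof.
move=> D0.
pose f d := (X %/ d.-1.+1)%:R : R.
have fe d : (0 < d)%N -> f d = (X %/ d)%:R by case: d.
have hS : \sum_(1 <= d < X.+1) chir d * (X %/ d)%:R = \sum_(1 <= d < X.+1) chir d * f d.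
  by apply: eq_big_nat => d /andP[d0 _]; rewrite fe.
have hS2 : `|\sum_(1 <= d < X.+1) chir d * f d - \sum_(1 <= d < D) chir d * f d| <= X%:R / D%:R.
  have fD : f D <= X%:R / D%:R.
    by rewrite fe // ler_pdivlMr ?ltr0n // -natrM ler_nat leq_divM.
  have [XD|XD] := leqP X.+1 D.
    rewrite [X in _ - X](big_cat_nat _ (n := X.+1)) //= opprD addNKr normrN.
    rewrite [X in `|X|]big1_seq ?normr0 ?divr_ge0 // => d.
    rewrite mem_index_iota => /andP[_ /andP[h _]].
    by rewrite fe ?divn_small ?mulr0 //; lia.
  rewrite (big_cat_nat _ (n := D)) //=; last by lia.
  rewrite addrAC subrr add0r; apply: le_trans (chi_sum_le _ _ _) fD => //.
  by move=> i j hij; rewrite /f ler_nat leq_div2l //; lia.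
have hS3 : `|\sum_(1 <= d < D) chir d * f d - X%:R * \sum_(1 <= d < D) chir d / d%:R| <= D%:R.
  rewrite big_distrr -sumrB /=; apply: le_trans (ler_norm_sum _ _ _) _.
  apply: (@le_trans _ _ (\sum_(1 <= d < D) (1 : R))); last first.
    by rewrite sumr_const_nat ler_nat leq_subr.
  rewrite big_nat_cond [leRHS]big_nat_cond; apply: ler_sum => d /andP[/andP[d0 _] _].
  rewrite fe // mulrCA -mulrBr normrM -[leRHS]mulr1 ler_pM //.
    exact: chi_norm_le1.
  rewrite {2}(divn_eq X d) natrD natrM.
  have dR : 0 < d%:R :> R by rewrite ltr0n.
  rewrite mulrDl mulfK ?gt_eqF // opprD addNKr normrN ger0_norm ?divr_ge0 //.
  by rewrite ler_pdivrMr // mul1r ler_nat ltnW // ltn_pmod.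
rewrite size_ball_chi hS.
move: hS2 hS3; set A := \sum_(1 <= d < X.+1) _; set B := \sum_(1 <= d < D) chir d * f d.
set C := \sum_(1 <= d < D) chir d / d%:R; rewrite -!mulrA.
move: (X%:R / D%:R) (X%:R * C) => x y.
rewrite !ler_norml => /andP[h1 h2] /andP[h3 h4]; apply/andP; split; lra.
Qed.

End alternating.

(** * The series of Leibniz and Catalan *)

Section constants.
Variable R : realType.
Local Notation chir d := ((chi d)%:~R : R).

Lemma le_of_derive_ge0 (f df : R -> R) (a b : R) : a <= b ->
  (forall x : R, is_derive x 1 f (df x)) -> (forall x, a <= x <= b -> 0 <= df x) -> f a <= f b.
Proof.
move=> ab hd h0.
have hc : {within `[a, b], continuous f}.
  apply: derivable_within_continuous => x _.
  by have := hd x; case.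
have [c cab e] := MVT_segment ab (fun x _ => hd x) hc.
by rewrite -subr_ge0 e mulr_ge0 ?subr_ge0 // h0 // -in_itv.
Qed.

Definition atan_poly (K : nat) (x : R) := \sum_(k < K) (-1) ^+ k * (x ^+ k.*2.+1 / k.*2.+1%:R).

Lemma is_derive_pow (n : nat) (x : R) :
  is_derive x 1 (fun y : R => y ^+ n.+1 / n.+1%:R) (x ^+ n).
Proof.
rewrite (_ : (fun _ => _) = n.+1%:R^-1 \*: (id ^+ n.+1 : R -> R)); last first.
  by apply/funext => y; rewrite /= exprfctE mulrC.
rewrite (_ : x ^+ n = n.+1%:R^-1 *: ((n.+1%:R * x ^+ n.+1.-1) *: (1 : R))); last first.
  by rewrite /GRing.scale /= mulr1 mulKf // pnatr_eq0.
apply: is_deriveZ; exact: (@is_deriveX R R id n.+1 x 1 1).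
Qed.

Lemma is_derive_atan_poly K (x : R) :
  is_derive x 1 (atan_poly K) (\sum_(k < K) (- x ^+ 2) ^+ k).
Proof.
elim: K => [|K IH].
  rewrite big_ord0 (_ : atan_poly 0 = cst 0); first exact: is_derive_cst.
  by apply/funext => y; rewrite /atan_poly big_ord0.
rewrite (_ : atan_poly K.+1 = atan_poly K +
  (fun y => (-1) ^+ K * (y ^+ K.*2.+1 / K.*2.+1%:R))); last first.
  by apply/funext => y; rewrite /atan_poly big_ord_recr.
rewrite big_ord_recr /=; apply: is_deriveD.
have -> : (- x ^+ 2) ^+ K = (-1) ^+ K *: x ^+ K.*2.
  by rewrite [LHS]exprNn -exprM mul2n.
exact: (is_deriveZ _ (is_derive_pow _ _)).
Qed.

Lemma geo_neg K (y : R) : 0 <= y ->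
  (1 + y)^-1 - \sum_(k < K) (- y) ^+ k = (- y) ^+ K / (1 + y).
Proof.
move=> y0; have n0 : 1 + y != 0 by apply: lt0r_neq0; lra.
have := subrX1 (- y) K; move: (\sum_(k < K) _) => s h.
by apply: (mulIf n0); rewrite mulrBl !mulVf // divfK //; lra.
Qed.

(** Leibniz's series with remainder: up to sign, [atan - atan_poly K] has derivative
    [x ^ (2 K) / (1 + x ^ 2)], which lies between 0 and [x ^ (2 K)]; comparing derivatives on
    [[0, 1]] replaces integration. *)
Lemma atan1_approx K : `|pi / 4 - \sum_(k < K) (-1) ^+ k / k.*2.+1%:R| <= (K.*2.+1%:R)^-1 :> R.
Proof.
have e1 : atan_poly K 1 = \sum_(k < K) (-1) ^+ k / k.*2.+1%:R.
  by apply: eq_bigr => k _; rewrite expr1n mul1r.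
have e0 : atan_poly K 0 = 0.
  by rewrite /atan_poly big1 // => k _; rewrite expr0n mul0r mulr0.
pose h (x : R) : R := (-1) ^+ K * (atan x - atan_poly K x).
pose dh (x : R) : R := x ^+ K.*2 / (1 + x ^+ 2).
have hh (x : R) : is_derive x 1 h (dh x).
  rewrite /h /dh; have -> : x ^+ K.*2 / (1 + x ^+ 2) =
    (-1) ^+ K *: ((1 + x ^+ 2)^-1 - \sum_(k < K) (- x ^+ 2) ^+ k).
    rewrite geo_neg ?sqr_ge0 // [(- x ^+ 2) ^+ K]exprNn -[x ^+ 2 ^+ K]exprM mul2n /GRing.scale /= !mulrA.
    by rewrite -expr2 sqrr_sign mul1r.
  apply: (@is_deriveZ _ _ _ (fun x => atan x - atan_poly K x)).
  exact: (is_deriveB (is_derive1_atan x) (is_derive_atan_poly K x)).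
pose g (x : R) : R := x ^+ K.*2.+1 / K.*2.+1%:R - h x.
have hg (x : R) : is_derive x 1 g (x ^+ K.*2 - dh x).
  exact: (is_deriveB (is_derive_pow _ _) (hh x)).
have dh0 x : 0 <= dh x.
  rewrite /dh divr_ge0 //; first by rewrite -mul2n exprM exprn_ge0 ?sqr_ge0.
  by rewrite addr_ge0 ?sqr_ge0.
have h01 : h 0 = 0 by rewrite /h atan0 e0 subrr mulr0.
have p1 : 0 <= h 1.
  rewrite -h01; apply: (le_of_derive_ge0 (df := dh)) => // *; exact: dh0.
have p2 : g 0 <= g 1.
  apply: (le_of_derive_ge0 (df := fun x => x ^+ K.*2 - dh x)) => // x _.
  have xk : 0 <= x ^+ K.*2 by rewrite -mul2n exprM exprn_ge0 ?sqr_ge0.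
  have x2 := sqr_ge0 x.
  rewrite /dh subr_ge0 ler_pdivrMr; last by lra.
  by rewrite ler_peMr //; lra.
move: p2; rewrite /g h01 expr0n /= mul0r subr0 expr1n mul1r subr_ge0 => p2.
have eh : `|h 1| = `|atan 1 - atan_poly K 1|.
  by rewrite /h normrM normrX normrN1 expr1n mul1r.
by rewrite -e1 -atan1 -eh ger0_norm.
Qed.

Lemma sum_chi_odd (F : nat -> R) K : \sum_(1 <= d < K.*2.+1) chir d * F d =
  \sum_(k < K) (-1) ^+ k * F k.*2.+1.
Proof.
elim: K => [|K IH]; first by rewrite big_ord0 big_geq.
rewrite big_ord_recr /= -IH doubleS big_nat_recr //= big_nat_recr //=.
rewrite [chi K.*2.+2]chi_even /= ?odd_double // mul0r addr0; congr (_ + _ * _).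
rewrite /chi -signr_odd; case: ifPn => [/eqP h|h1].
  by rewrite (_ : odd K = false) //; lia.
case: ifPn => [/eqP h|h]; last by lia.
by rewrite (_ : odd K = true) //; lia.
Qed.

Lemma cvg_size_ball : (size (ball X))%:R / X%:R @[X --> \oo] --> (pi : R).
Proof.
apply/cvg_natP => e e0.
(* Since [D > K > 16 / e], the tail [4 X / D] and [4 X] times the remainder of Leibniz's series cost
   at most [e X / 4] each; [N] makes [1 + 4 D] at most [e X / 2]. *)
pose K := (Num.trunc (16 / e)).+1.
have hK : 16 / e < K%:R by rewrite truncnS_gt.
pose D := K.*2.+1.
pose N := (Num.trunc (2 * (1 + 4 * D%:R) / e)).+1.
exists N => X NX.
have hN : 2 * (1 + 4 * D%:R) / e < N%:R by rewrite truncnS_gt.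
have X0 : 0 < X%:R :> R by rewrite ltr0n; lia.
have D0 : 0 < D%:R :> R by rewrite ltr0n.
have := @size_ball_approx R X D isT.
rewrite (sum_chi_odd (fun d => d%:R^-1)).
set s := \sum_(k < K) _ => h1.
have h2 := atan1_approx K; rewrite -/s -/D in h2.
have h3 : D%:R^-1 <= e / 16.
  rewrite -[e / 16]invrK lef_pV2 ?posrE ?invr_gt0 ?divr_gt0 //.
  rewrite invf_div (le_trans (ltW hK)) // ler_nat /D; lia.
have h4 : 1 + 4 * D%:R <= e / 2 * X%:R.
  have : N%:R <= X%:R :> R by rewrite ler_nat.
  move=> /(lt_le_trans hN); rewrite ltr_pdivrMr // => /ltW; lra.
rewrite -(ler_pM2r X0) -[X in _ * X <= _]ger0_norm ?(ltW X0) // -normrM mulrBl divfK ?gt_eqF //.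
have h5 : X%:R / D%:R <= e / 16 * X%:R by rewrite mulrC ler_pM2r.
  
have h6 : `|X%:R * (pi / 4 - s)| <= e / 16 * X%:R.
  rewrite normrM ger0_norm ?(ltW X0) // [leRHS]mulrC ler_pM2l //; exact: le_trans h2 h3.
move: h1 h6; rewrite -!mulrA !ler_norml => /andP[a1 a2] /andP[a3 a4].
move: (X%:R / D%:R) h5 a1 a2 a3 a4 => q *; apply/andP; split; lra.
Qed.


Definition catalan_partial (D : nat) : R := \sum_(1 <= d < D) chir d / d%:R ^+ 2.

Lemma chi_sq_tail m n : (0 < m)%N ->
  `|\sum_(m <= d < n) chir d / d%:R ^+ 2| <= (m%:R ^+ 2)^-1.
Proof.
move=> m0; pose f (d : nat) : R := (d.-1.+1%:R ^+ 2)^-1.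
have fe d : (0 < d)%N -> f d = (d%:R ^+ 2)^-1 by case: d.
rewrite -(fe m) // (_ : \sum_(m <= d < n) _ = \sum_(m <= d < n) chir d * f d); last first.
  by apply: eq_big_nat => d /andP[md _]; rewrite fe //; lia.
apply: chi_sum_le => [i j hij|i]; last by rewrite invr_ge0 sqr_ge0.
rewrite lef_pV2 ?posrE ?exprn_gt0 ?ltr0n // lerXn2r ?nnegrE // ler_nat; lia.
Qed.

Lemma catalan_partialB m n : (0 < m <= n)%N ->
  `|catalan_partial n - catalan_partial m| <= (m%:R ^+ 2)^-1.
Proof.
case/andP=> m0 mn; rewrite /catalan_partial (big_cat_nat _ (n := m) (p := n)) //=.
by rewrite addrAC subrr add0r chi_sq_tail.
Qed.

Lemma catalan_partial_odd N :
  \sum_(1 <= n < N.+1) (-1) ^+ (n - 1) / (2 * n - 1)%:R ^+ 2 = catalan_partial N.*2.+1.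
Proof.
rewrite /catalan_partial (sum_chi_odd (fun d => (d%:R ^+ 2)^-1)).
rewrite big_add1 big_mkord; apply: eq_bigr => k _.
by rewrite subn1 mul2n doubleS subn1.
Qed.

Lemma natS_gt (x : R) : exists N, forall n, (N <= n)%N -> x < n%:R.
Proof.
exists (Num.trunc x).+1 => n h; apply: (lt_le_trans (truncnS_gt x)).
by rewrite ler_nat.
Qed.

Lemma inv_sq_le (n : nat) : (0 < n)%N -> (n%:R ^+ 2)^-1 <= n%:R^-1 :> R.
Proof.
move=> n0; rewrite lef_pV2 ?posrE ?exprn_gt0 ?ltr0n //.
by rewrite expr2 ler_peMr // ler1n.
Qed.

(** [catalan_constant] is a [limn], whose value is meaningful only after convergence is established:
    the tail estimate gives the Cauchy criterion and then passes to the limit. *)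
Lemma catalan_approx D : (0 < D)%N ->
  `|catalan_partial D - catalan_constant R| <= (D%:R ^+ 2)^-1.
Proof.
move=> D0.
have cv : catalan_partial N.*2.+1 @[N --> \oo] --> catalan_constant R.
  pose u (d : nat) : R := chir d / d%:R ^+ 2.
  have cs : cvgn (series u).
    apply/cauchy_cvgP/cauchy_seriesP => e e0.
    have [N hN] := natS_gt e^-1.
    exists ([set n | (N.+1 <= n)%N], [set n | (N.+1 <= n)%N]); first by split; exists N.+1.
    move=> [m n] /= [hm hn]; have m0 : (0 < m)%N by lia.
    apply: (le_lt_trans (chi_sq_tail n m0)); apply: (le_lt_trans (inv_sq_le m0)).
    rewrite -[e]invrK ltf_pV2 ?posrE ?invr_gt0 ?ltr0n //; apply: hN; lia.
  have /cvg_ex[l hl] := cs.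
  have pl n : catalan_partial n.+1 = series u n.+1.
    by rewrite /series /= [RHS]big_ltn // {1}/u /chi mul0r add0r.
  have fl : catalan_partial N.*2.+1 @[N --> \oo] --> l.
    apply/cvg_natP => e e0; have [N hN] := (cvg_natP _ _).1 hl e e0.
    by exists N => n Nn; rewrite pl; apply: hN; lia.
  rewrite /catalan_constant (_ : (fun N => _) = (fun N => catalan_partial N.*2.+1)).
    by rewrite (cvg_lim _ fl).
  by apply/funext => N; rewrite catalan_partial_odd.
apply/ler_addgt0Pr => e e0.
have [N hN] := (cvg_natP _ _).1 cv e e0.
pose n := maxn N D.
have h1 := hN n (leq_maxl _ _).
have h2 : `|catalan_partial n.*2.+1 - catalan_partial D| <= (D%:R ^+ 2)^-1.
  by apply: catalan_partialB; rewrite D0 /n; lia.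
rewrite distrC in h2.
rewrite -(subrKA (catalan_partial n.*2.+1)); apply: le_trans (ler_normD _ _) _.
exact: lerD.
Qed.


Definition zeta2_partial (n : nat) : R := \sum_(1 <= e < n.+1) (e%:R ^+ 2)^-1.

(** A truncated product of zeta(2) and L(2, chi). For fixed [e] the sum over [d] misses a tail of at
    most [(e / X) ^ 2]; the weight [1 / e ^ 2] turns this into [1 / X ^ 2], and there are [X] values
    of [e]. *)
Lemma sum_chisum_sq X : (0 < X)%N ->
  `|\sum_(1 <= n < X.+1) (chisum n)%:~R / n%:R ^+ 2 - catalan_constant R * zeta2_partial X|
     <= X%:R^-1.
Proof.
move=> X0; have XR : 0 < X%:R :> R by rewrite ltr0n.
have -> : \sum_(1 <= n < X.+1) (chisum n)%:~R / n%:R ^+ 2 =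
    \sum_(1 <= e < X.+1) (e%:R ^+ 2)^-1 * catalan_partial (X %/ e).+1.
  under eq_bigr do rewrite mulrC.
  rewrite sum_chisum; apply: eq_bigr => e _; rewrite big_distrr /=; apply: eq_bigr => d _.
  by rewrite natrM exprMn invfM mulrAC mulrC (mulrC _ (chi d)%:~R).
rewrite /zeta2_partial big_distrr -sumrB /=.
apply: le_trans (ler_norm_sum _ _ _) _.
have -> : X%:R^-1 = \sum_(1 <= e < X.+1) (X%:R ^+ 2)^-1 :> R.
  rewrite sumr_const_nat subn1 /= -[RHS]mulr_natl; field; exact: lt0r_neq0.
rewrite big_nat_cond [leRHS]big_nat_cond; apply: ler_sum => e /andP[/andP[e0 eX] _].
rewrite mulrC -mulrBl normrM [X in _ * X]ger0_norm ?invr_ge0 ?sqr_ge0 //.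
have eR : 0 < e%:R :> R by rewrite ltr0n.
rewrite ler_pdivrMr ?exprn_gt0 //; apply: le_trans (catalan_approx _) _ => //.
rewrite [leRHS]mulrC ler_pdivlMr ?exprn_gt0 // mulrC ler_pdivrMr ?exprn_gt0 ?ltr0n //.
rewrite -exprMn lerXn2r ?nnegrE // -natrM ler_nat.
by rewrite mulnC ltnW // ltn_ceil.
Qed.

End constants.

(** * The value of zeta(2) *)

Section basel.
Variable R : realType.

Lemma sin_le_id (x : R) : 0 <= x -> sin x <= x.
Proof.
move=> x0; rewrite -subr_ge0; have -> : 0 = 0 - sin 0 :> R by rewrite sin0 subrr.
apply: (@le_of_derive_ge0 _ (fun y => y - sin y) (fun y => 1 - cos y)) => // y.
Qed.

Lemma mul_cos_le_sin (x : R) : 0 <= x <= pi -> x * cos x <= sin x.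
Proof.
case/andP=> x0 xpi; rewrite -subr_ge0.
have -> : 0 = sin 0 - 0 * cos 0 :> R by rewrite sin0 mul0r subrr.
apply: (@le_of_derive_ge0 _ (fun y => sin y - y * cos y) (fun y => y * sin y)) => // y.
  have -> : y * sin y = cos y - (y *: - sin y + cos y *: (1 : R)).
    by rewrite /GRing.scale /=; ring.
  exact: (is_deriveB (is_derive_sin _)).
case/andP=> y0 yx; rewrite mulr_ge0 // sin_ge0_pi // y0 /=; exact: le_trans xpi.
Qed.

Lemma sum_fold (T : nmodType) (F : nat -> T) N :
  \sum_(0 <= k < N.*2) F k = \sum_(0 <= k < N) (F k + F (N.*2.-1 - k)%N).
Proof.
rewrite (big_cat_nat _ (n := N)) //=; last by lia.
rewrite big_split /=; congr (_ + _).
rewrite -{1}[N]add0n big_addn (_ : (N.*2 - N)%N = N); last by lia.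
rewrite big_nat_rev /=; apply: eq_big_nat => k /andP[_ kN]; congr F; lia.
Qed.

Definition csc2 (x : R) := (sin x ^+ 2)^-1.

Lemma csc2_double (x : R) : 0 < x < pi / 2 -> csc2 x + csc2 (pi / 2 - x) = 4 * csc2 (x *+ 2).
Proof.
move=> /andP[x0 xpi].
have s0 : 0 < sin x by rewrite sin_gt0_pihalf // x0.
have c0 : 0 < cos x by rewrite cos_gt0_pihalf // xpi andbT; have := pi_gt0 R; lra.
rewrite /csc2.
have -> : sin (pi / 2 - x) = cos x by rewrite sinB sin_pihalf cos_pihalf; ring.
rewrite sin_mulr2n.
have s1 := lt0r_neq0 s0; have c1 := lt0r_neq0 c0.
transitivity ((cos x ^+ 2 + sin x ^+ 2) / (cos x ^+ 2 * sin x ^+ 2)).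
  by field; rewrite c1 s1.
by rewrite cos2Dsin2; field; rewrite c1 s1.
Qed.

(** The nodes are the odd multiples of [pi / 2 ^ (n + 2)] in the interval from 0 to [pi / 2]. *)
Definition cscsum (n : nat) : R :=
  \sum_(0 <= k < 2 ^ n) csc2 (k.*2.+1%:R * pi / (2 ^ n.+2)%:R).

(** Pairing the nodes [x] and [pi / 2 - x] by [csc2_double] doubles the angle, so the sum at level
    [n + 1] is four times the one at level [n]. *)
Lemma cscsumE n : cscsum n = 2 * (4 ^ n)%:R.
Proof.
elim: n => [|n IH].
  rewrite /cscsum big_nat1 mul1r mulr1.
  have p0 := pi_gt0 R.
  have := @csc2_double (pi / 4) ltac:(apply/andP; split; lra).
  have -> : pi / 2 - pi / 4 = pi / 4 :> R by field.
  have -> : pi / 4 *+ 2 = pi / 2 :> R by field.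
  rewrite {3}/csc2 sin_pihalf expr1n invr1 (_ : (2 ^ 2)%N = 4%N) //; lra.
rewrite expnS natrM mulrCA -IH /cscsum expnS mul2n sum_fold big_distrr /=.
apply: eq_big_nat => k /andP[_ kn].
have P0 : 0 < (2 ^ n.+3)%:R :> R by rewrite ltr0n expn_gt0.
have p0 := pi_gt0 R.
set x := k.*2.+1%:R * pi / (2 ^ n.+3)%:R.
have Pe : (2 ^ n.+3)%:R = 8 * (2 ^ n)%:R :> R by rewrite -natrM !expnS !mulnA.
have Pe2 : (2 ^ n.+2)%:R = 4 * (2 ^ n)%:R :> R by rewrite -natrM !expnS !mulnA.
have Q0 : (2 ^ n)%:R != 0 :> R by rewrite pnatr_eq0 -lt0n expn_gt0.
have -> : k.*2.+1%:R * pi / (2 ^ n.+2)%:R = x *+ 2.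
  by rewrite /x Pe Pe2; field.
rewrite -csc2_double.
  congr (_ + csc2 _); rewrite /x Pe.
  rewrite (_ : ((2 ^ n).*2.-1 - k).*2.+1 = (4 * 2 ^ n - k.*2.+1)%N); last by lia.
  rewrite natrB ?natrM; last by lia.
  by field.
apply/andP; split; first by rewrite /x divr_gt0 // mulr_gt0 // ltr0n.
rewrite /x ltr_pdivrMr // Pe mulrC.
have : k.*2.+1%:R < 4 * (2 ^ n)%:R :> R by rewrite -natrM ltr_nat; lia.
by rewrite -(ltr_pM2l p0); move: (k.*2.+1%:R) ((2 ^ n)%:R) (pi) => c d P; lra.
Qed.

Definition oddsum (n : nat) : R := \sum_(0 <= k < n) (k.*2.+1%:R ^+ 2)^-1.

(** From [sin x <= x <= tan x] and the identity [csc ^ 2 = 1 + cot ^ 2]. *)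
Lemma csc2_bounds (x : R) : 0 < x < pi / 2 -> (x ^+ 2)^-1 <= csc2 x <= 1 + (x ^+ 2)^-1.
Proof.
move=> /andP[x0 xpi]; have p0 := pi_gt0 R.
have s0 : 0 < sin x by rewrite sin_gt0_pihalf // x0.
have c0 : 0 < cos x by rewrite cos_gt0_pihalf // xpi andbT; lra.
have h1 := sin_le_id (ltW x0).
have h2 : x * cos x <= sin x by apply: mul_cos_le_sin; rewrite (ltW x0) /=; lra.
have e1 := cos2Dsin2 x.
apply/andP; split.
  by rewrite lef_pV2 ?posrE ?exprn_gt0 // lerXn2r ?nnegrE ?(ltW x0) ?(ltW s0).
rewrite /csc2 -lerBlDl.
have -> : (sin x ^+ 2)^-1 - 1 = (cos x / sin x) ^+ 2.
  rewrite expr_div_n -[cos x ^+ 2](addrK (sin x ^+ 2)) e1 mulrBl divff ?mul1r //.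
  by rewrite expf_neq0 // lt0r_neq0.
rewrite -exprVn lerXn2r ?nnegrE ?invr_ge0 ?(ltW x0) ?divr_ge0 ?(ltW c0) ?(ltW s0) //.
by rewrite ler_pdivrMr // ler_pdivlMl.
Qed.

(** [csc2_bounds] is summed over the [N = 2 ^ n] nodes [y k], where [1 / y ^ 2] is
    [16 N ^ 2 / pi ^ 2] times [1 / (2 k + 1) ^ 2], and compared with the exact value [2 N ^ 2]. *)
Lemma oddsum_bounds n :
  pi ^+ 2 / 8 - pi ^+ 2 / 16 / (2 ^ n)%:R <= oddsum (2 ^ n) <= pi ^+ 2 / 8.
Proof.
have p0 := pi_gt0 R; have p20 : 0 < pi ^+ 2 :> R by rewrite exprn_gt0.
set N := (2 ^ n)%N.
have N0 : 0 < N%:R :> R by rewrite ltr0n expn_gt0.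
pose y (k : nat) : R := k.*2.+1%:R * pi / (2 ^ n.+2)%:R.
have Pe2 : (2 ^ n.+2)%:R = 4 * N%:R :> R by rewrite -natrM !expnS !mulnA.
have ye k : (y k ^+ 2)^-1 = 16 * N%:R ^+ 2 / pi ^+ 2 * (k.*2.+1%:R ^+ 2)^-1.
  have p1 := lt0r_neq0 p0; have n1 := lt0r_neq0 N0.
  have k1 : k.*2.+1%:R != 0 :> R by rewrite pnatr_eq0.
  rewrite /y Pe2; move: (k.*2.+1%:R) (N%:R) (pi) k1 n1 p1 => c d P c1 d1 P1; field.
  by rewrite c1 d1 P1.
have yb k : (0 <= k < N)%N -> 0 < y k < pi / 2.
  move=> kN; rewrite /y Pe2; apply/andP; split.
    by apply: divr_gt0; apply: mulr_gt0.
  rewrite ltr_pdivrMr ?mulr_gt0 // mulrC.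
  have h : k.*2.+1%:R < 2 * N%:R :> R by rewrite -natrM ltr_nat; lia.
  by move: h; rewrite -(ltr_pM2l p0); move: (k.*2.+1%:R) (N%:R) (pi) => c d P; lra.
have hS := cscsumE n.
have e4 : (4 ^ n)%:R = N%:R ^+ 2 :> R by rewrite -natrX /N -expnM mulnC expnM.
have hl : 16 * N%:R ^+ 2 / pi ^+ 2 * oddsum N <= cscsum n.
  rewrite /oddsum big_distrr /= /cscsum.
  apply: ler_sum_nat => k hk; rewrite -ye.
  by case/andP: (csc2_bounds (yb k hk)).
have hu : cscsum n <= N%:R + 16 * N%:R ^+ 2 / pi ^+ 2 * oddsum N.
  have eN : N%:R = \sum_(0 <= k < N) (1 : R) by rewrite sumr_const_nat subn0.
  rewrite [X in _ <= X + _]eN /oddsum big_distrr /= -big_split /= /cscsum.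
  apply: ler_sum_nat => k hk; rewrite -ye.
  by case/andP: (csc2_bounds (yb k hk)).
rewrite hS e4 in hl hu.
have c0 : 0 < 16 * N%:R ^+ 2 / pi ^+ 2 :> R.
  by apply: divr_gt0 => //; apply: mulr_gt0 => //; apply: exprn_gt0.
have P1 := lt0r_neq0 p0; have N1 := lt0r_neq0 N0.
apply/andP; split; rewrite -(ler_pM2l c0).
  rewrite (_ : _ * (_ - _) = 2 * N%:R ^+ 2 - N%:R); first by lra.
  by move: (pi) (N%:R) P1 N1 => P d P1 d1; field; rewrite P1 d1.
rewrite (_ : _ * (pi ^+ 2 / 8) = 2 * N%:R ^+ 2) //.
by move: (pi) (N%:R) P1 N1 => P d P1 d1; field; rewrite P1.
Qed.

Lemma zeta2_partial_double N : zeta2_partial R N.*2 = oddsum N + zeta2_partial R N / 4.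
Proof.
elim: N => [|N IH]; first by rewrite /zeta2_partial /oddsum !big_geq // mul0r addr0.
rewrite /oddsum big_nat_recr //= -/(oddsum N).
rewrite /zeta2_partial doubleS big_nat_recr //= big_nat_recr //= [in RHS]big_nat_recr //=.
rewrite -/(zeta2_partial R N.*2) -/(zeta2_partial R N) IH.
have -> : N.*2.+2%:R = 2 * N.+1%:R :> R by rewrite -natrM mul2n doubleS.
have n1 : N.+1%:R != 0 :> R by rewrite pnatr_eq0.
by move: (N.+1%:R) (N.*2.+1%:R ^- 2) n1 => c d c1; field.
Qed.

Lemma zeta2_partial_mono m n : (m <= n)%N -> zeta2_partial R m <= zeta2_partial R n.
Proof.
move=> mn; rewrite /zeta2_partial (big_cat_nat _ (n := m.+1) (p := n.+1)) //=.
by rewrite lerDl sumr_ge0 // => i _; rewrite invr_ge0 sqr_ge0.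
Qed.

(** The recursion of [zeta2_partial_double] has fixed point [pi ^ 2 / 6]. The bound reproduces
    itself: at most [1 / N] from [oddsum] and a quarter of [4 / N] add up to [4 / (2 N)]. *)
Lemma zeta2_partial_pow2 n : `|zeta2_partial R (2 ^ n) - pi ^+ 2 / 6| <= 4 / (2 ^ n)%:R.
Proof.
have p2 := pi_ge2 R; have p4 : pi <= 4 :> R by have := pihalf_lt2 R; lra.
have hp1 : 4 <= pi ^+ 2 :> R by have := ler_pM (ltW _) (ltW _) p2 p2; rewrite expr2; nra.
have hp2 : pi ^+ 2 <= 16 :> R by rewrite expr2; nra.
elim: n => [|n IH].
  rewrite expn0 /zeta2_partial big_nat1 expr1n invr1 mulr1 ler_norml; apply/andP; split; lra.
have N0 : 0 < (2 ^ n)%:R :> R by rewrite ltr0n expn_gt0.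
have := oddsum_bounds n; have := IH.
rewrite [in X in _ -> _ -> X]expnS mul2n zeta2_partial_double -mul2n natrM invfM.
set u := (2 ^ n)%:R^-1; have u0 : 0 < u by rewrite invr_gt0.
rewrite !ler_norml => /andP[h1 h2] /andP[h3 h4].
have h5 : pi ^+ 2 * u <= 16 * u by rewrite ler_pM2r.
apply/andP; split; lra.
Qed.

Lemma cvg_zeta2 : zeta2_partial R X @[X --> \oo] --> pi ^+ 2 / 6.
Proof.
apply/cvg_natP => e e0; have [N hN] := natS_gt (4 / e).
have pw n : (N <= n)%N -> 4 / (2 ^ n)%:R <= e.
  move=> Nn; rewrite ler_pdivrMr ?ltr0n ?expn_gt0 // mulrC -ler_pdivrMr //.
  by apply/ltW/hN; rewrite (leq_trans Nn) // ltnW // ltn_expl.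
exists (2 ^ N)%N => n Nn.
have h1 := le_trans (zeta2_partial_pow2 N) (pw _ (leqnn _)).
have nn : (N <= n)%N by rewrite (leq_trans _ Nn) // ltnW // ltn_expl.
have h2 := le_trans (zeta2_partial_pow2 n) (pw _ nn).
have h3 := zeta2_partial_mono Nn.
have h4 := zeta2_partial_mono (ltnW (ltn_expl n (isT : (1 < 2)%N))).
move: h1 h2; rewrite !ler_norml => /andP[? ?] /andP[? ?]; apply/andP; split; lra.
Qed.

Lemma cvg_sum_chisum_sq : \sum_(1 <= n < X.+1) (chisum n)%:~R / n%:R ^+ 2 @[X --> \oo]
  --> catalan_constant R * (pi ^+ 2 / 6).
Proof.
have c1 : catalan_constant R * zeta2_partial R X @[X --> \oo] --> catalan_constant R * (pi ^+ 2 / 6).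
  exact: cvgMr cvg_zeta2.
apply/cvg_natP => e e0; have e2 : 0 < e / 2 by lra.
have [N hN] := (cvg_natP _ _).1 c1 _ e2; have [M hM] := natS_gt (2 / e).
exists (maxn N M).+1 => X hX; have X0 : (0 < X)%N by lia.
have h1 := @sum_chisum_sq R X X0; have h2 := hN X ltac:(lia).
have h3 : X%:R^-1 <= e / 2.
  rewrite -[e / 2]invrK lef_pV2 ?posrE ?invr_gt0 ?ltr0n // invf_div; apply/ltW/hM; lia.
by rewrite -(subrKA (catalan_constant R * zeta2_partial R X)) (le_trans (ler_normD _ _)) //; lra.
Qed.

End basel.

(** * Coprime pairs *)

Section coprimality.
Implicit Types a b c d g t u v w z : gint.

(** A boolean form of coprimality for [a != 0]. The sign is that of the relation [a | b c + 1], so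
    that a witness [y] is directly a partner of [c]. *)
Definition cop a c := has (fun y => gdvd a (c * y + 1)) (Rs a).

Lemma copP a c : a != 0 -> reflect (exists u v, u * a + v * c = 1) (cop a c).
Proof.
move=> a0; apply: (iffP hasP) => [[y _ /gdvdP[t ht]]|[u [v h]]].
  by exists t, (- y); apply/eqP; rewrite -subr_eq0; apply/eqP; move: ht => /(canRL (addKr _)) ->; ring.
exists (grem a (- v)); first exact: mem_grem.
case: (grem_sub a (- v)) => t ht; apply/gdvdP; exists (u - c * t).
have -> : grem a (- v) = - v - a * t by rewrite {2}ht; ring.
by rewrite -h; ring.
Qed.

Lemma gcd_decomp a c : a != 0 ->
  exists d a' c', [/\ d != 0, a = d * a', c = d * c' & cop a' c'].
Proof.
move=> a0; case: (gbezout a c) => d [u [v [hd /gdvdP[a' ha] /gdvdP[c' hc]]]].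
have [d0 a'0] : d != 0 /\ a' != 0.
  by move: a0; rewrite ha gmul_eq0 negb_or => /andP.
exists d, a', c'; split => //; apply/copP => //; exists u, v.
apply: (gmulfI d0); rewrite mulr1 [RHS]hd [in RHS]ha [in RHS]hc; ring.
Qed.

Lemma cop_assoc d d' a c a' c' : d != 0 -> a != 0 -> a' != 0 -> cop a c -> cop a' c' ->
  d * a = d' * a' -> d * c = d' * c' -> gdvd d d'.
Proof.
move=> d0 a0 a'0 /(copP _ a0)[u [v h]] /(copP _ a'0)[u' [v' h']] ea ec.
rewrite -[d']mulr1 -h' (_ : _ * _ = d * (u' * a + v' * c)); first by rewrite gdvd_mulr ?gdvd_refl.
rewrite mulrDr [d' * (u' * a')]mulrCA -ea [d' * (v' * c')]mulrCA -ec; ring.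
Qed.

Definition nzball X := [seq a <- ball X | a != 0].

Lemma mem_nzball X a : (a \in nzball X) = (0 < nrm a <= X)%N.
Proof. by rewrite mem_filter mem_ball nrm_gt0. Qed.

Lemma nzball_uniq X : uniq (nzball X).
Proof. by rewrite filter_uniq ?ball_uniq. Qed.

(** The bound on [N(c) / N(a)] is a rational [j / k], which keeps the counting in the natural
    numbers and fits the later subdivision into cells. *)
Definition pairs (j k X : nat) : seq (gint * gint) :=
  [seq (a, c) | a <- nzball X, c <- ball (j * nrm a %/ k)].

Lemma mem_pairs j k X p : (0 < k)%N ->
  (p \in pairs j k X) = (0 < nrm p.1 <= X)%N && (k * nrm p.2 <= j * nrm p.1)%N.
Proof.
move=> k0; case: p => a c; apply/allpairsPdep/andP => /= [[a' [c' [ha hc [-> ->]]]]|[ha hc]].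
  by rewrite -mem_nzball mulnC -leq_divRL // -mem_ball.
by exists a, c; rewrite mem_nzball mem_ball leq_divRL // mulnC.
Qed.

Lemma pairs_uniq j k X : uniq (pairs j k X).
Proof.
apply: allpairs_uniq_dep => [|a _|]; rewrite ?nzball_uniq ?ball_uniq //.
by move=> [a c] [a' c'] _ _ /= [-> ->].
Qed.

Definition copc (p : gint * gint) := cop p.1 p.2.
Definition coppairs j k X := [seq p <- pairs j k X | copc p].

Lemma size_fiber (S T : eqType) (f : S -> T) (s : seq S) (t : seq T) :
  uniq t -> {in s, forall x, f x \in t} ->
  size s = (\sum_(y <- t) count (fun x => f x == y) s)%N.
Proof.
move=> ut; elim: s => [|x s IH] h; first by rewrite big1.
rewrite /= big_split /= -IH; last by move=> y ys; apply: h; rewrite inE ys orbT.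
rewrite -addn1 addnC; congr (_ + _)%N.
have fx : f x \in t by apply: h; rewrite inE eqxx.
rewrite (big_rem _ fx) /= eqxx big1_seq ?addn0 // => y /andP[_].
by rewrite (rem_filter _ ut) mem_filter eq_sym => /andP[/= /negPf ->].
Qed.

(** A pair is a gcd times a coprime pair, and the gcd is determined up to the four units, whence the
    4. The condition [k N(c) <= j N(a)] is homogeneous and passes to the coprime pair. *)
Lemma pairs_gcd j k X : (0 < k)%N ->
  (4 * size (pairs j k X) = \sum_(g <- nzball X) size (coppairs j k (X %/ nrm g)))%N.
Proof.
move=> k0.
pose L := [seq (g, p) | g <- nzball X, p <- coppairs j k (X %/ nrm g)].
pose f (t : gint * (gint * gint)) := (t.1 * t.2.1, t.1 * t.2.2).
have memL g p : ((g, p) \in L) = [&& g \in nzball X, p \in pairs j k (X %/ nrm g) & copc p].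
  apply/allpairsPdep/and3P => [[g' [p' [hg]]]|[h1 h2 h3]].
    by rewrite mem_filter => /andP[h1 h2] [-> ->].
  by exists g, p; split => //; rewrite mem_filter; apply/andP.
have uL : uniq L.
  apply: allpairs_uniq_dep => [|g _|]; rewrite ?nzball_uniq ?filter_uniq ?pairs_uniq //.
  by move=> [g p] [g' p'] _ _ /= [-> ->].
transitivity (size L); last by rewrite size_allpairs_dep sumnE big_map.
rewrite (size_fiber (pairs_uniq j k X) (f := f)); last first.
  move=> [g [a c]]; rewrite memL mem_nzball !mem_pairs //= => /and3P[/andP[g0 gX] /andP[/andP[a0 aX] h] _].
  rewrite !nrmM muln_gt0 g0 a0 mulnCA [(j * _)%N]mulnCA leq_pmul2l // h andbT /=.
  by rewrite mulnC -leq_divRL.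
rewrite mulnC -sum1_size big_distrl /=; apply: eq_big_seq => -[a c].
rewrite mul1n mem_pairs //= => /andP[/andP[na aX] hac].
have a0 : a != 0 by rewrite -nrm_gt0.
have [d [a' [c' [d0 ha hc cp]]]] := gcd_decomp c a0.
have a'0 : a' != 0 by move: a0; rewrite ha gmul_eq0 negb_or => /andP[].
(* The fibre over [(a, c)] arises from one decomposition by moving a unit [u] from the coprime pair
   to the gcd; [sphere 1] is the group of units. *)
rewrite -size_filter -r2_1 /r2 -(size_map (fun u => (d * u, (gconj u * a', gconj u * c')))).
have u1 u : u \in sphere 1 -> u * gconj u = 1 by rewrite mem_sphere => /eqP/nrm1_unit.
apply: perm_size; apply: uniq_perm.
- rewrite map_inj_uniq ?sphere_uniq // => u u' /(congr1 fst) /= e; exact: gmulfI e.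
- by rewrite filter_uniq.
move=> [g [x y]]; rewrite mem_filter memL mem_nzball mem_pairs // [(x, y).1]/= [(x, y).2]/=.
apply/mapP/andP => [[u hu [-> -> ->]]|[/eqP[ex ey] /and3P[/andP[g0 gX] /andP[/andP[x0 xX] h] cxy]]].
  have nu : nrm u = 1%N by move: hu; rewrite mem_sphere => /eqP.
  rewrite /f /=; split; first by rewrite !mulrA -[d * u * _]mulrA u1 // mulr1 -ha -hc.
  rewrite !nrmM nrm_conj nu !mul1n muln1 !nrm_gt0 d0 a'0 /=.
  move: na aX hac; rewrite ha hc !nrmM muln_gt0 => /andP[nd na'] aX hac.
  rewrite leq_divRL // (mulnC (nrm a')) aX (leq_trans _ aX) ?leq_pmulr //=.
  rewrite -(leq_pmul2l nd) mulnCA [X in (_ <= X)%N]mulnCA hac /=.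
  apply/copP; first by rewrite gmul_eq0 negb_or a'0 andbT -nrm_gt0 nrm_conj nu.
  have /copP := cp => /(_ a'0)[p [q hpq]]; exists (p * u), (q * u).
  rewrite [(_, _).1]/= [(_, _).2]/=.
  by rewrite -hpq -[in RHS](mulr1 p) -[in RHS](mulr1 q) -(u1 u hu); ring.
have g0' : g != 0 by rewrite -nrm_gt0.
have x0' : x != 0 by rewrite -nrm_gt0.
rewrite /f /= in ex ey.
have /gdvdP[u hu] : gdvd d g.
  by apply: (@cop_assoc d g a' c' x y) => //; rewrite -?ha -?hc.
have /gdvdP[u' hu'] : gdvd g d.
  by apply: (@cop_assoc g d x y a' c') => //; rewrite -?ha -?hc.
have uu : u * u' = 1 by apply: (gmulfI d0); rewrite mulr1 {2}hu' hu mulrA.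
have nu : nrm u = 1%N.
  have := congr1 nrm uu; rewrite nrmM => /eqP; rewrite (_ : nrm 1 = 1%N) // muln_eq1.
  by case/andP => /eqP.
exists u; first by rewrite mem_sphere nu.
have uc := nrm1_unit nu.
have cc : forall s s' : gint, d * u * s = d * s' -> s = gconj u * s'.
  move=> s s'; rewrite -mulrA => /(gmulfI d0) <-; rewrite mulrA [gconj u * u]mulrC uc; ring.
by rewrite hu; congr (_, (_, _)); apply: cc; rewrite -hu ?ex ?ey.
Qed.

End coprimality.

(** * Averages over Gaussian integers ordered by norm *)

Section asymptotics.
Implicit Types a b c d g t u v w z : gint.
Variable R : realType.

Lemma cvg_eq_pos (f g : nat -> R) (l : R) : (forall n, (0 < n)%N -> f n = g n) ->
  g n @[n --> \oo] --> l -> f n @[n --> \oo] --> l.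
Proof.
move=> fg /cvg_natP cg; apply/cvg_natP => e /cg[N hN].
by exists N.+1 => n Nn; rewrite fg; [apply: hN; lia|lia].
Qed.

Lemma le_div_sub (x c l e : R) : 0 < c ->
  (`|x / c - l| <= e) = (`|x - l * c| <= e * c).
Proof.
move=> c0; rewrite -(ler_pM2r c0) -[X in _ * X <= _](gtr0_norm c0) -normrM mulrBl.
by rewrite divfK ?gt_eqF.
Qed.

Lemma sum_ball_norm (h : nat -> R) X :
  \sum_(g <- ball X) h (nrm g) = \sum_(0 <= n < X.+1) (r2 n)%:R * h n.
Proof.
elim: X => [|X IH]; first by rewrite big_nat1 /r2 /sphere /= !big_cons big_nil mul1r addr0.
rewrite big_nat_recr //= -IH (perm_big (ball X ++ sphere X.+1)); last first.
  apply: uniq_perm; rewrite ?ball_uniq //.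
    rewrite cat_uniq ball_uniq sphere_uniq andbT /=; apply/hasPn => z.
    by rewrite mem_sphere => /eqP hz; rewrite mem_ball hz ltnn.
  by move=> z; rewrite mem_cat !mem_ball mem_sphere leq_eqVlt ltnS orbC.
rewrite big_cat /=; congr (_ + _).
rewrite big_seq (eq_bigr (fun=> h X.+1)) => [|z]; last by rewrite mem_sphere => /eqP ->.
by rewrite -big_seq big_const_seq count_predT iter_addr_0 mulr_natl.
Qed.

Lemma sum_nzball_norm (h : nat -> R) X :
  \sum_(g <- nzball X) h (nrm g) = \sum_(1 <= n < X.+1) (r2 n)%:R * h n.
Proof.
have := @sum_ball_norm (fun n => if n == 0%N then 0 else h n) X.
rewrite big_ltn // eqxx mulr0 add0r => e.
rewrite big_filter big_mkcond /=; transitivity (\sum_(1 <= n < X.+1) (r2 n)%:R * (if n == 0%N then 0 else h n)).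
  by rewrite -e; apply: eq_bigr => g _; rewrite nrm_eq0; case: eqP.
by apply: eq_big_nat => -[].
Qed.

Lemma nzball_split (F : gint -> R) n X : (n <= X)%N ->
  \sum_(a <- nzball X) F a = \sum_(a <- nzball n) F a + \sum_(a <- nzball X | (n < nrm a)%N) F a.
Proof.
move=> nX; rewrite (bigID (fun a => nrm a <= n)%N) /=; congr (_ + _).
  rewrite -big_filter; apply: perm_big; apply: uniq_perm; first by rewrite filter_uniq ?nzball_uniq.
    exact: nzball_uniq.
  move=> a; rewrite mem_filter !mem_nzball; apply/andP/andP => -[]; last by move=> -> h; split=> //; apply: leq_trans nX.
  by move=> -> /andP[-> _].
by apply: eq_bigl => a; rewrite ltnNge.
Qed.

Lemma cvg_const_div2 (C : R) : C / X%:R ^+ 2 @[X --> \oo] --> (0 : R).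
Proof.
apply/cvg_natP => e e0; have [N hN] := natS_gt (`|C| / e).
exists N.+1 => n Nn; have n0 : 0 < n%:R :> R by rewrite ltr0n; lia.
rewrite subr0 normrM [X in _ * X]ger0_norm ?invr_ge0 ?sqr_ge0 //.
rewrite ler_pdivrMr ?exprn_gt0 // mulrC -ler_pdivrMr //.
apply: (le_trans (ltW (hN n (ltnW Nn)))).
by rewrite expr2 ler_peMr ?(ltW n0) // ler1n; lia.
Qed.

(** A weight that depends on the norm and tends to [l] may be replaced by [l]: elements of small
    norm contribute a constant, which [X ^ 2] absorbs, and on the others the relative error is
    small. *)
Lemma weighted_sum (y : gint -> R) (h : nat -> R) (s l : R) :
  (forall a, 0 <= y a) ->
  (\sum_(a <- nzball X) y a) / X%:R ^+ 2 @[X --> \oo] --> s ->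
  h n @[n --> \oo] --> l ->
  (\sum_(a <- nzball X) h (nrm a) * y a) / X%:R ^+ 2 @[X --> \oo] --> l * s.
Proof.
move=> y0 cs ch.
have c0 : (\sum_(a <- nzball X) (h (nrm a) - l) * y a) / X%:R ^+ 2 @[X --> \oo] --> (0 : R).
  apply/cvg_natP => e e0.
  have s1 : 0 < `|s| + 1 by rewrite ltr_pwDr.
  have e2 : 0 < e / 2 / (`|s| + 1) by rewrite !divr_gt0.
  have [n hn] := (cvg_natP _ _).1 ch _ e2.
  have [N1 hN1] := (cvg_natP _ _).1 cs 1 ltr01.
  have e3 : 0 < e / 2 by lra.
  pose C := \sum_(a <- nzball n) `|h (nrm a) - l| * y a.
  have [N2 hN2] := (cvg_natP _ _).1 (cvg_const_div2 C) _ e3.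
  exists (maxn n (maxn N1 N2)).+1 => X hX; rewrite subr0.
  have X0 : 0 < X%:R ^+ 2 :> R by rewrite exprn_gt0 // ltr0n; lia.
  rewrite normrM [X in _ * X]ger0_norm ?invr_ge0 ?(ltW X0) //.
  have h1 : `|\sum_(a <- nzball X) (h (nrm a) - l) * y a| <=
     C + e / 2 / (`|s| + 1) * \sum_(a <- nzball X) y a.
    apply: le_trans (ler_norm_sum _ _ _) _.
    rewrite [leLHS](@nzball_split _ n); last by lia.
    apply: lerD; first by apply: ler_sum => a _; rewrite normrM (ger0_norm (y0 a)).
    rewrite big_distrr /= [leRHS](bigID (fun a => n < nrm a)%N) /=.
    rewrite -[leLHS]addr0 lerD //; last by apply: sumr_ge0 => a _; rewrite mulr_ge0 // ltW.
    apply: ler_sum => a na; rewrite normrM (ger0_norm (y0 a)) ler_wpM2r //.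
    by apply: hn; apply: ltnW.
  have h2 := hN1 X ltac:(lia); have h3 := hN2 X ltac:(lia); rewrite subr0 in h3.
  have h4 : (\sum_(a <- nzball X) y a) / X%:R ^+ 2 <= `|s| + 1.
    by move: h2; rewrite ler_norml => /andP[_]; have := ler_norm s; lra.
  have h5 : C / X%:R ^+ 2 <= e / 2 by exact: le_trans (ler_norm _) h3.
  apply: (@le_trans _ _ ((C + e / 2 / (`|s| + 1) * \sum_(a <- nzball X) y a) / X%:R ^+ 2)).
    by rewrite ler_wpM2r // invr_ge0 ltW.
  rewrite mulrDl -mulrA; have := ler_wpM2l (ltW e2) h4.
  by rewrite divfK ?gt_eqF //; lra.
have cD : (\sum_(a <- nzball X) (h (nrm a) - l) * y a) / X%:R ^+ 2 +
    l * ((\sum_(a <- nzball X) y a) / X%:R ^+ 2) @[X --> \oo] --> 0 + l * s.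
  exact: (cvgD c0 (cvgMr cs)).
rewrite add0r in cD; apply: cvg_eq_pos cD => X _.
rewrite mulrA -mulrDl; congr (_ / _).
by rewrite big_distrr -big_split /=; apply: eq_bigr => a _; rewrite mulrBl subrK.
Qed.

Lemma cesaro (B : nat -> R) (l : R) : B n / n%:R @[n --> \oo] --> l ->
  (\sum_(0 <= n < X) B n) / X%:R ^+ 2 @[X --> \oo] --> l / 2.
Proof.
move=> cB; apply/cvg_natP => e e0; have e4 : 0 < e / 4 by lra.
have [N hN] := (cvg_natP _ _).1 cB _ e4.
pose C := \sum_(0 <= n < N.+1) `|B n - l * n%:R|.
have [N2 hN2] := (cvg_natP _ _).1 (cvg_const_div2 C) _ e4.
have [N3 hN3] := natS_gt (2 * `|l| / e).
exists (maxn N (maxn N2 N3)).+1 => X hX.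
have X0 : 0 < X%:R :> R by rewrite ltr0n; lia.
have sumn : \sum_(0 <= n < X) n%:R = X%:R * (X%:R - 1) / 2 :> R.
  elim: (X) => [|m IH]; first by rewrite big_geq // !mul0r.
  by rewrite big_nat_recr //= IH -natr1; field.
have h1 : `|\sum_(0 <= n < X) B n - l * (X%:R * (X%:R - 1) / 2)| <= C + e / 4 * X%:R ^+ 2.
  rewrite -sumn big_distrr -sumrB /=; apply: le_trans (ler_norm_sum _ _ _) _.
  rewrite (big_cat_nat _ (n := N.+1)) //=; last by lia.
  apply: lerD => //.
  apply: (@le_trans _ _ (\sum_(N.+1 <= n < X) e / 4 * X%:R)).
    apply: ler_sum_nat => n /andP[Nn nX].
    have n0 : 0 < n%:R :> R by rewrite ltr0n; lia.
    have := hN n (ltnW Nn); rewrite le_div_sub // => h; apply: le_trans h _.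
    by rewrite ler_wpM2l ?(ltW e4) // ler_nat ltnW.
  rewrite sumr_const_nat -[leLHS]mulr_natl expr2 mulrCA ler_wpM2l ?(ltW e4) //.
  by rewrite ler_wpM2r ?(ltW X0) // ler_nat leq_subr.
have h2 := hN2 X ltac:(lia); rewrite subr0 in h2.
have {}h2 := le_trans (ler_norm _) h2.
rewrite ler_pdivrMr ?exprn_gt0 // in h2.
have h3 : `|l| / 2 * X%:R <= e / 4 * X%:R ^+ 2.
  rewrite expr2 mulrA ler_pM2r //.
  have := hN3 X ltac:(lia); rewrite ltr_pdivrMr // => /ltW; lra.
rewrite le_div_sub ?exprn_gt0 //.
have -> : \sum_(0 <= n < X) B n - l / 2 * X%:R ^+ 2 =
  (\sum_(0 <= n < X) B n - l * (X%:R * (X%:R - 1) / 2)) - l / 2 * X%:R by field.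
apply: le_trans (ler_normB _ _) _.
have -> : `|l / 2 * X%:R| = `|l| / 2 * X%:R.
  by rewrite !normrM (ger0_norm (ltW X0)) (@ger0_norm _ 2^-1).
have : 0 < e * X%:R ^+ 2 by rewrite mulr_gt0 // exprn_gt0.
by lra.
Qed.

(** Abel summation: the sum is [X] times the number of points in the disc minus the sum of the
    smaller counts, hence [pi - pi / 2]. *)
Lemma cvg_sum_nrm : (\sum_(a <- nzball X) (nrm a)%:R) / X%:R ^+ 2 @[X --> \oo] --> (pi / 2 : R).
Proof.
have cB := @cvg_size_ball R; have cC := cesaro cB.
have -> : pi / 2 = pi - pi / 2 :> R by lra.
have cD : (size (ball X))%:R / X%:R - (\sum_(0 <= n < X) (size (ball n))%:R) / X%:R ^+ 2
    @[X --> \oo] --> (pi - pi / 2 : R) by exact: cvgB.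
apply: cvg_eq_pos cD => X X0.
have X1 : X%:R != 0 :> R by rewrite pnatr_eq0 -lt0n.
have -> : \sum_(a <- nzball X) (nrm a)%:R = X%:R * (size (ball X))%:R - \sum_(0 <= n < X) (size (ball n))%:R :> R.
  rewrite (sum_nzball_norm (fun n => n%:R)).
  elim: (X) => [|m IH]; first by rewrite !big_geq // mul0r subrr.
  rewrite big_nat_recr //= IH [in RHS]big_nat_recr //=.
  rewrite [in RHS]size_sum_sphere big_nat_recr //= -size_sum_sphere natrD -natr1; ring.
by field.
Qed.

End asymptotics.

(** * Inversion of the convolution over gcds *)

Section coprime_pairs.
Implicit Types a b c d g t u v w z : gint.
Variable R : realType.

(** With [r] midway between [q] and 1 and [eta = (r - q) D], an eventual bound [D] improves to
    [r D]; iteration from the global bound gives geometric decay. *)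
Lemma cvg_0_of_contraction (e : nat -> R) (q B : R) : 0 <= q < 1 ->
  (forall X, 0 <= e X <= B) ->
  (forall D : R, 0 <= D -> (exists Y, forall X, (Y <= X)%N -> e X <= D) ->
     forall eta : R, 0 < eta -> exists Y, forall X, (Y <= X)%N -> e X <= q * D + eta) ->
  e X @[X --> \oo] --> (0 : R).
Proof.
move=> /andP[q0 q1] eB step.
pose r := (q + 1) / 2; have r1 : r < 1 by rewrite /r; lra.
have r0 : 0 < r by rewrite /r; lra.
have qr : q < r by rewrite /r; lra.
pose B1 := `|B| + 1; have B10 : 0 < B1 by rewrite ltr_pwDr.
have it m : exists Y, forall X, (Y <= X)%N -> e X <= B1 * r ^+ m.
  elim: m => [|m IH].
    exists 0%N => X _; rewrite expr0 mulr1 /B1; have := ler_norm B.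
    by case/andP: (eB X) => _; lra.
  have D0 : 0 < B1 * r ^+ m by rewrite mulr_gt0 // exprn_gt0.
  have [Y hY] := step _ (ltW D0) IH ((r - q) * (B1 * r ^+ m)) ltac:(rewrite mulr_gt0 // subr_gt0 //).
  exists Y => X /hY h; apply: le_trans h _.
  by rewrite exprS -mulrDl addrC subrK mulrCA.
apply/cvg_natP => eps eps0.
have cr : r ^+ m @[m --> \oo] --> (0 : R) by apply: cvg_expr; rewrite gtr0_norm.
have [m hm] := (cvg_natP _ _).1 cr (eps / B1) ltac:(rewrite divr_gt0 //).
have {}hm := hm m (leqnn _); rewrite subr0 ger0_norm in hm; last by rewrite exprn_ge0 // ltW.
have [Y hY] := it m; exists Y => X /hY h.
rewrite subr0 ger0_norm; last by case/andP: (eB X).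
by apply: le_trans h _; rewrite mulrC -ler_pdivlMr.
Qed.

Lemma floor_div_err (p L D : R) (X n : nat) : (0 < n)%N -> (0 < X)%N ->
  `|p - L| <= D ->
  `|p * ((X %/ n)%N%:R / X%:R) ^+ 2 - L / n%:R ^+ 2| <= D / n%:R ^+ 2 + 2 * `|L| / X%:R.
Proof.
move=> n0 Xp pD; set m := (X %/ n)%N.
have nR : 0 < n%:R :> R by rewrite ltr0n.
have X0 : 0 < X%:R :> R by rewrite ltr0n.
have h1 : m%:R / X%:R <= n%:R^-1 :> R.
  by rewrite ler_pdivrMr // ler_pdivlMl // -natrM ler_nat mulnC leq_divM.
have h2 : n%:R^-1 <= m%:R / X%:R + X%:R^-1 :> R.
  rewrite -[X in _ <= _ + X]mul1r -mulrDl ler_pdivlMr // ler_pdivrMl // natr1 -natrM ler_nat.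
  by rewrite mulnC ltnW // ltn_ceil.
set x := m%:R / X%:R in h1 h2 *; rewrite -exprVn; set y := n%:R^-1 in h1 h2 *.
have x0 : 0 <= x by rewrite divr_ge0.
have y1 : y <= 1 by rewrite invf_le1 // ler1n.
have z0 : 0 < X%:R^-1 :> R by rewrite invr_gt0.
have xy : 0 <= y - x by rewrite subr_ge0.
have xy2 : x ^+ 2 <= y ^+ 2 by rewrite lerXn2r ?nnegrE // (le_trans x0).
rewrite (_ : _ - _ = (p - L) * x ^+ 2 - L * (y ^+ 2 - x ^+ 2)); last by ring.
apply: le_trans (ler_normB _ _) _; apply: lerD.
  by rewrite normrM (ger0_norm (sqr_ge0 x)) ler_pM ?sqr_ge0.
rewrite normrM (_ : 2 * _ / _ = `|L| * (X%:R^-1 * 2)); last by ring.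
rewrite ler_wpM2l // ger0_norm ?subr_ge0 // subr_sqr ler_pM //.
- by rewrite addr_ge0 // (le_trans x0).
- lra.
- lra.
Qed.

(* The inversion of [t X = \sum_n rho n * P (X %/ n)] without Moebius functions:
   as [Z < 2], moving all terms but [n = 1] to the left makes the deviation of
   [P X / X ^ 2] from its limit a contraction with factor [Z - 1]. *)
Lemma convolution_inversion (P t rho : nat -> R) (Z L B : R) :
  (forall n, 0 <= rho n) -> rho 1%N = 1 ->
  (forall X, t X = \sum_(1 <= n < X.+1) rho n * P (X %/ n)%N) ->
  (forall X, 0 <= P X <= B * X%:R ^+ 2) ->
  t X / X%:R ^+ 2 @[X --> \oo] --> Z * L ->
  \sum_(1 <= n < X.+1) rho n / n%:R ^+ 2 @[X --> \oo] --> Z -> Z < 2 ->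
  P X / X%:R ^+ 2 @[X --> \oo] --> L.
Proof.
move=> rho0 rho1 tE PB ct cZ Z2.
pose S K := \sum_(1 <= n < K.+1) rho n / n%:R ^+ 2.
have Smono m n : (m <= n)%N -> S m <= S n.
  move=> mn; rewrite /S (big_cat_nat _ (n := m.+1) (p := n.+1)) //=.
  by rewrite lerDl sumr_ge0 // => i _; rewrite divr_ge0 ?sqr_ge0.
have SZ K : S K <= Z.
  apply/ler_addgt0Pr => e e0; have [N hN] := (cvg_natP _ _).1 cZ e e0.
  have := hN (maxn N K) (leq_maxl _ _); have := Smono K (maxn N K) (leq_maxr _ _).
  by rewrite -/(S _) ler_norml => h /andP[_]; lra.
have S1 : S 1%N = 1 by rewrite /S big_nat1 rho1 expr1n divr1.
have Z1 : 1 <= Z by rewrite -S1.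
have B0 : 0 <= B by have /andP[h1 h2] := PB 1%N; move: h2; rewrite expr1n mulr1; exact: le_trans.
pose p X := P X / X%:R ^+ 2.
have pB X : 0 <= p X <= B.
  have /andP[h1 h2] := PB X; rewrite /p divr_ge0 ?sqr_ge0 //=.
  have [->|X0] := posnP X; first by rewrite expr0n invr0 mulr0.
  by rewrite ler_pdivrMr // exprn_gt0 // ltr0n.
pose e X := `|p X - L|.
suff ce : e X @[X --> \oo] --> (0 : R).
  apply/cvg_natP => eps /((cvg_natP _ _).1 ce)[N hN]; exists N => n /hN.
  by rewrite subr0 normr_id.
apply: (@cvg_0_of_contraction e (Z - 1) (B + `|L|)).
- apply/andP; split; lra.
- move=> X; rewrite normr_ge0 /=; apply: le_trans (ler_normB _ _) _.
  by rewrite lerD2r; case/andP: (pB X) => h1 h2; rewrite ger0_norm.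
move=> D D0 [Y hY] eta eta0.
have e4 : 0 < eta / 4 by lra.
have BL : 0 < B + `|L| + 1 by rewrite ltr_pwDr // addr_ge0.
have [K0 hK0] := (cvg_natP _ _).1 cZ (eta / 4 / (B + `|L| + 1)) ltac:(rewrite divr_gt0 //).
(* Terms with [n > K] are small by the bound [B] on [P]. For [n <= K] the size required of [X] below
   makes [X %/ n] exceed [Y], so that the assumed deviation [D] applies. *)
pose K := K0.+1.
have tl : Z - S K <= eta / 4 / (B + `|L| + 1).
  have := hK0 K (leqnSn _); rewrite -/(S K) distrC.
  by have := SZ K; rewrite -subr_ge0 => h; rewrite ger0_norm.
pose W := 2 * `|L| * \sum_(1 <= n < K.+1) rho n.
have W0 : 0 <= W by rewrite mulr_ge0 ?mulr_ge0 ?sumr_ge0.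
have [N1 hN1] := (cvg_natP _ _).1 ct _ e4.
have [N2 hN2] := natS_gt (W / (eta / 4)).
exists (K * Y.+1 + N1 + N2 + K).+1%N => X hX.
have [Xp XN1 XN2 XK XY] : [/\ 0 < X, N1 <= X, N2 <= X, K < X & K * Y.+1 <= X]%N.
  by move: hX; clear; clearbody K; move: (K * Y.+1)%N => KY; split; lia.
have X0 : 0 < X%:R :> R by rewrite ltr0n.
have X20 : 0 < X%:R ^+ 2 :> R by rewrite exprn_gt0.
pose err n := P (X %/ n)%N / X%:R ^+ 2 - L / n%:R ^+ 2.
have errE n : (0 < n <= K)%N -> `|err n| <= D / n%:R ^+ 2 + 2 * `|L| / X%:R.
  case/andP=> n0 nK; have nY : (n * Y.+1 <= X)%N by rewrite (leq_trans _ XY) // leq_mul2r nK orbT.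
  have mY : (Y < X %/ n)%N by rewrite leq_divRL // mulnC.
  have mR : (X %/ n)%:R != 0 :> R by rewrite pnatr_eq0 -lt0n (leq_ltn_trans _ mY).
  have := floor_div_err n0 Xp (hY _ (ltnW mY)).
  rewrite (_ : p (X %/ n)%N * _ = P (X %/ n)%N / X%:R ^+ 2) //.
  by rewrite /p expr_div_n mulrA divfK // expf_neq0.
have SK : S K = 1 + \sum_(2 <= n < K.+1) rho n / n%:R ^+ 2.
  by rewrite /S big_ltn // rho1 expr1n divr1.
have main : p X - L = (t X / X%:R ^+ 2 - Z * L) - \sum_(2 <= n < K.+1) rho n * err n
    - \sum_(K.+1 <= n < X.+1) rho n * P (X %/ n)%N / X%:R ^+ 2 + (Z - S K) * L.
  rewrite tE (big_ltn (n := X.+1)) // rho1 mul1r divn1 (big_cat_nat _ (n := K.+1) (m := 2)) //=; last exact: leqW.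
  rewrite SK.
  have -> : \sum_(2 <= n < K.+1) rho n * err n =
     (\sum_(2 <= n < K.+1) rho n * P (X %/ n)%N) / X%:R ^+ 2 -
     (\sum_(2 <= n < K.+1) rho n / n%:R ^+ 2) * L.
    rewrite !big_distrl -sumrB /=; apply: eq_bigr => n _; rewrite /err.
    by rewrite mulrBr !mulrA; congr (_ - _); rewrite mulrAC.
  rewrite -big_distrl /= /p; move: (\sum_(_ <= _ < _) _) (\sum_(_ <= _ < _) _) => A1 A2.
  by move: (\sum_(_ <= _ < _) _) => A3; ring.
have b2 : `|\sum_(2 <= n < K.+1) rho n * err n| <= (Z - 1) * D + eta / 4.
  apply: (@le_trans _ _ (\sum_(2 <= n < K.+1) (rho n / n%:R ^+ 2 * D + 2 * `|L| / X%:R * rho n))).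
    apply: le_trans (ler_norm_sum _ _ _) _; apply: ler_sum_nat => n /andP[n2 nK].
    rewrite normrM (ger0_norm (rho0 n)); apply: le_trans (ler_wpM2l (rho0 n) (errE n _)) _; first by rewrite (ltnW n2) -ltnS.
    by rewrite mulrDr [_ / _ * rho n]mulrC mulrA [rho n / _ * D]mulrAC.
  rewrite big_split -!big_distrr -!big_distrl /=; apply: lerD.
    by rewrite ler_wpM2r // lerBrDl -SK.
  have h : W / X%:R <= eta / 4.
    rewrite ler_pdivrMr // mulrC -ler_pdivrMr //; exact/ltW/hN2.
  apply: le_trans h; rewrite /W [leRHS]mulrAC ler_wpM2l ?divr_ge0 ?mulr_ge0 //.
  by rewrite [leRHS](big_ltn (n := K.+1)) // lerDr.
have b3 : `|\sum_(K.+1 <= n < X.+1) rho n * P (X %/ n)%N / X%:R ^+ 2| <= B * (Z - S K).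
  apply: (@le_trans _ _ (\sum_(K.+1 <= n < X.+1) B * (rho n / n%:R ^+ 2))); last first.
    rewrite -big_distrr /= ler_wpM2l // lerBrDl; apply: le_trans (SZ X).
    by rewrite /S [leRHS](big_cat_nat _ (n := K.+1)) //= ltnS ltnW.
  apply: le_trans (ler_norm_sum _ _ _) _; apply: ler_sum_nat => n /andP[Kn nX].
  have /andP[P0 P1] := PB (X %/ n)%N.
  have n0 : 0 < n%:R :> R by rewrite ltr0n (leq_trans _ Kn).
  rewrite ger0_norm ?divr_ge0 ?mulr_ge0 ?sqr_ge0 // mulrCA -mulrA ler_wpM2l //.
  rewrite ler_pdivrMr //; apply: le_trans P1 _; rewrite -mulrA ler_wpM2l //.
  rewrite mulrC ler_pdivlMr ?exprn_gt0 // -exprMn lerXn2r ?nnegrE // -natrM ler_nat.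
  by rewrite leq_divM.
have b1 := hN1 X XN1.
have b4 : `|(Z - S K) * L| <= (Z - S K) * `|L| by rewrite normrM ger0_norm // subr_ge0.
have tl2 : (Z - S K) * (B + `|L| + 1) <= eta / 4 by rewrite -ler_pdivlMr.
have tl3 : 0 <= Z - S K by rewrite subr_ge0.
rewrite /e main; apply: le_trans (ler_normD _ _) _; apply: le_trans (lerD (ler_normB _ _) b4) _.
have := ler_normB (t X / X%:R ^+ 2 - Z * L) (\sum_(2 <= n < K.+1) rho n * err n).
by lra.
Qed.

End coprime_pairs.

(** * Density of coprime pairs *)

Section coprime_pairs.
Implicit Types a b c d g t u v w z : gint.
Variable R : realType.
Local Notation C := (catalan_constant R).

Lemma cvg_size_ball_scaled (j k : nat) : (0 < k)%N ->
  (size (ball (j * n %/ k)))%:R / n%:R @[n --> \oo] --> (pi * (j%:R / k%:R) : R).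
Proof.
move=> k0; have kR : 0 < k%:R :> R by rewrite ltr0n.
apply/cvg_natP => e e0; have jk0 : 0 <= j%:R / k%:R :> R by rewrite divr_ge0.
have e2 : 0 < e / 2 / (j%:R / k%:R + 1) by rewrite !divr_gt0 // ltr_pwDr.
have [N hN] := (cvg_natP _ _).1 (@cvg_size_ball R) _ e2.
pose M := \sum_(0 <= m < N.+1) `|(size (ball m))%:R - pi * m%:R| : R.
have M0 : 0 <= M by apply: sumr_ge0.
have bm m : `|(size (ball m))%:R - pi * m%:R| <= e / 2 / (j%:R / k%:R + 1) * m%:R + M.
  have [mN|mN] := leqP m N.
    apply: (@le_trans _ _ M); last by rewrite lerDr mulr_ge0 // ltW.
    by rewrite /M (bigD1_seq m) ?iota_uniq ?mem_index_iota //= lerDl sumr_ge0.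
  have m0 : 0 < m%:R :> R by rewrite ltr0n; lia.
  have := hN m (ltnW mN); rewrite le_div_sub // => h; apply: le_trans h _.
  by rewrite lerDl.
have [N2 hN2] := natS_gt ((M + pi) / (e / 2)).
exists N2.+1 => n nN; have n0 : 0 < n%:R :> R by rewrite ltr0n; lia.
set m := (j * n %/ k)%N.
have m1 : m%:R <= j%:R / k%:R * n%:R :> R.
  by rewrite mulrAC ler_pdivlMr // -!natrM ler_nat leq_divM.
have m2 : j%:R / k%:R * n%:R <= m%:R + 1 :> R.
  by rewrite mulrAC ler_pdivrMr // natr1 -!natrM ler_nat ltnW // ltn_ceil.
rewrite le_div_sub //.
have h1 := bm m.
have h2 : e / 2 / (j%:R / k%:R + 1) * m%:R <= e / 2 * n%:R.
  have q0 : 0 < j%:R / k%:R + 1 :> R by rewrite ltr_pwDr.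
  have mq : m%:R <= (j%:R / k%:R + 1) * n%:R :> R.
    by apply: le_trans m1 _; rewrite ler_wpM2r // lerDl.
  by have := ler_wpM2l (ltW e2) mq; rewrite mulrA divfK // gt_eqF.
have h3 : M + pi <= e / 2 * n%:R.
  by have := hN2 n (ltnW nN); rewrite ltr_pdivrMr ?divr_gt0 // mulrC => /ltW.
have p0 := pi_ge0 R.
have h4 := ler_wpM2l p0 m1; have h5 := ler_wpM2l p0 m2.
move: h1; rewrite !ler_norml => /andP[h6 h7].
rewrite -mulrA mulrA mulrA in h4 *.
by apply/andP; split; lra.
Qed.

(** Together with [pi_sq_le] this yields [C * pi ^ 2 / 6 < 2], the contraction condition of
    [convolution_inversion]; the lower bound also gives the positivity of [C]. *)
Lemma catalan_bounds : 8 / 10 <= C <= 93 / 100.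
Proof.
have := @catalan_approx R 5 isT; rewrite /catalan_partial.
do 4 (rewrite big_ltn //); rewrite big_geq // /chi /=.
by rewrite ler_norml => /andP[h1 h2]; apply/andP; split; lra.
Qed.

Lemma pi_sq_le : pi ^+ 2 <= 1186 / 100 :> R.
Proof.
have /andP[h _] := @oddsum_bounds R 1.
have e : oddsum R (2 ^ 1) = 10 / 9.
  rewrite /oddsum expn1 big_ltn // big_ltn // big_geq //.
  by rewrite (_ : 0.*2.+1 = 1%N) // (_ : 1.*2.+1 = 3%N) //; field.
by move: h; rewrite e expn1; move: (pi ^+ 2) => P; lra.
Qed.

Lemma size_nzball_le X : (size (nzball X) <= 5 * X)%N.
Proof.
have [->|X0] := posnP X; first by vm_compute.
have := @size_ball_le R X; rewrite /nzball size_filter.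
by move=> h; apply: leq_trans (count_size _ _) (leq_trans h _); lia.
Qed.

Lemma size_pairs j k X : size (pairs j k X) = (\sum_(a <- nzball X) size (ball (j * nrm a %/ k)))%N.
Proof. by rewrite size_allpairs_dep sumnE big_map. Qed.

Lemma size_pairs_le j k X : (0 < k)%N -> (size (pairs j k X) <= 5 * (4 * j + 1) * X ^ 2)%N.
Proof.
move=> k0; rewrite size_pairs.
apply: (@leq_trans (\sum_(a <- nzball X) (4 * j + 1) * X)).
  rewrite big_seq [leqRHS]big_seq; apply: leq_sum => a; rewrite mem_nzball => /andP[a0 aX].
  apply: leq_trans (@size_ball_le R _) _.
  have : (j * nrm a %/ k <= j * nrm a)%N by exact: leq_div.
  have : (j * nrm a <= j * X)%N by rewrite leq_mul2l aX orbT.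
  nia.
rewrite big_const_seq count_predT iter_addn_0.
apply: (@leq_trans ((4 * j + 1) * X * (5 * X))); last by rewrite -mulnn; lia.
by rewrite leq_mul2l size_nzball_le orbT.
Qed.

Lemma cvg_size_pairs j k : (0 < k)%N ->
  (size (pairs j k X))%:R / X%:R ^+ 2 @[X --> \oo] --> (pi * (j%:R / k%:R) * (pi / 2) : R).
Proof.
move=> k0; have h := weighted_sum _ (@cvg_sum_nrm R) (@cvg_size_ball_scaled j k k0).
apply: cvg_eq_pos (h _) => [X _|a]; last by rewrite ler0n.
rewrite size_pairs natr_sum big_seq [in RHS]big_seq; congr (_ / _).
apply: eq_bigr => a; rewrite mem_nzball => /andP[a0 _].
by rewrite divfK // pnatr_eq0 -lt0n.
Qed.

(** [pairs_gcd] divided by 4 is a convolution with [chisum], since [r2 n = 4 chisum n]; the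
    Dirichlet series of [chisum] at 2 is [Z = C pi ^ 2 / 6]. All pairs have density
    [pi ^ 2 / 2 * j / k], and division by [Z] leaves [3 / C * j / k]. *)
Lemma cvg_size_coppairs j k : (0 < k)%N ->
  (size (coppairs j k X))%:R / X%:R ^+ 2 @[X --> \oo] --> (3 / C * (j%:R / k%:R) : R).
Proof.
move=> k0; have /andP[C1 C2] := catalan_bounds.
have pi0 := pi_gt0 R; have pi2 := pi_sq_le.
have Cn0 : C != 0 by apply: lt0r_neq0; lra.
have kR : k%:R != 0 :> R by rewrite pnatr_eq0 -lt0n.
have chi0 n : 0 <= (chisum n)%:~R :> R.
  have [->|n0] := posnP n; first by rewrite /chisum (_ : divisors 0 = [:: 1%N]) // big_seq1.
  have := jacobi_two_squares n0 => e; rewrite ler0z; lia.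
apply: (@convolution_inversion R _ (fun X => (size (pairs j k X))%:R)
   (fun n => (chisum n)%:~R) (C * (pi ^+ 2 / 6)) _ (5 * (4 * j + 1))%:R) => //.
- by rewrite /chisum (_ : divisors 1 = [:: 1%N]) // big_seq1.
- move=> X; apply: (@mulfI _ 4); first by rewrite pnatr_eq0.
  rewrite -natrM pairs_gcd // natr_sum (sum_nzball_norm (fun n => (size (coppairs j k (X %/ n)))%:R)).
  rewrite big_distrr /=; apply: eq_big_nat => n /andP[n0 _].
  have -> : (r2 n)%:R = 4 * (chisum n)%:~R :> R.
    by have := congr1 (fun z : int => z%:~R : R) (jacobi_two_squares n0); rewrite intrM.
  by rewrite mulrA.
- move=> X; rewrite ler0n /= -natrX -natrM ler_nat.
  by apply: leq_trans (size_pairs_le j X k0); rewrite size_filter count_size.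
- rewrite (_ : _ * _ = pi * (j%:R / k%:R) * (pi / 2)); first exact: cvg_size_pairs.
  by move: (pi) (C) (k%:R) (j%:R) Cn0 kR => p c x y c0 x0; field; rewrite x0 c0.
- exact: cvg_sum_chisum_sq.
have h : C * (pi ^+ 2 / 6) <= 93 / 100 * (1186 / 100 / 6).
  by rewrite ler_pM //; [lra|move: (pi ^+ 2) (sqr_ge0 (pi : R)) => *; lra|move: (pi ^+ 2) pi2 => *; lra].
by apply: le_lt_trans h _; lra.
Qed.

End coprime_pairs.

(** * Kloosterman sums *)

Section divisor_triples.
Implicit Types a b c d g t u v w z : gint.

Lemma gauss_dvd a u v : a != 0 -> cop a u -> gdvd a (u * v) -> gdvd a v.
Proof.
move=> a0 /(copP _ a0)[p [q h]] hd.
rewrite -[v]mul1r -h (_ : _ * v = a * (p * v) + u * v * q); last by ring.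
by apply: gdvdD; apply: gdvd_mulr => //; apply: gdvd_refl.
Qed.

(** A divisor [g] with its cofactor [h]. The value [h = 0] occurs because the factors in [energy_le]
    may vanish. *)
Definition divpairs (Y : nat) : seq (gint * gint) :=
  [seq (g, h) | g <- nzball Y, h <- ball (Y %/ nrm g)].

Lemma mem_divpairs Y p : (p \in divpairs Y) = (p.1 != 0) && (nrm p.1 <= Y)%N && (nrm p.1 * nrm p.2 <= Y)%N.
Proof.
case: p => g h; apply/allpairsPdep/idP => /= [[g' [h' [hg hh [-> ->]]]]|/andP[/andP[g0 gY] hY]].
  move: hg; rewrite mem_nzball => /andP[g0 gY]; move: hh; rewrite mem_ball leq_divRL // mulnC => ->.
  by rewrite gY !andbT -nrm_gt0.
rewrite -nrm_gt0 in g0; exists g, h; rewrite mem_nzball mem_ball g0 gY.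
by rewrite leq_divRL // mulnC.
Qed.

Definition dvd_triples (Y : nat) a : seq (gint * gint * gint) :=
  [seq t <- [seq (p, w) | p <- [seq (u, v) | u <- ball Y, v <- ball Y], w <- ball Y]
     | gdvd a (t.1.1 * t.1.2 * t.2)].

Lemma mem_dvd_triples Y a (t : gint * gint * gint) : (t \in dvd_triples Y a) =
  [&& gdvd a (t.1.1 * t.1.2 * t.2), (nrm t.1.1 <= Y)%N, (nrm t.1.2 <= Y)%N & (nrm t.2 <= Y)%N].
Proof.
rewrite mem_filter; congr (_ && _); case: t => [[u v] w] /=.
apply/allpairsP/and3P => /= [[[p w'] /= [/allpairsP[[u' v'] /= [hu hv ->]] hw [-> -> ->]]]|[hu hv hw]].
  by rewrite -!mem_ball.
exists ((u, v), w); split; rewrite ?mem_ball //=.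
by apply/allpairsP; exists (u, v); rewrite !mem_ball.
Qed.

Lemma dvd_triples_uniq Y a : uniq (dvd_triples Y a).
Proof.
apply: filter_uniq; apply: allpairs_uniq; rewrite ?ball_uniq //.
  by apply: allpairs_uniq; rewrite ?ball_uniq // => -[x y] [x' y'] _ _ /= [-> ->].
by move=> [x y] [x' y'] _ _ /= [-> ->].
Qed.

(* A divisor [a] of [u * v * w] splits as [g1 * g2 * g3] with [g1 | u], [g2 | v], [g3 | w]. *)
Lemma dvd_triples_le (X Y : nat) : (X <= Y)%N ->
  (\sum_(a <- nzball X) size (dvd_triples Y a) <= size (divpairs Y) ^ 3)%N.
Proof.
move=> XY.
pose L := [seq (a, q) | a <- nzball X, q <- dvd_triples Y a].
have uL : uniq L.
  apply: allpairs_uniq_dep => [|a _|]; rewrite ?nzball_uniq ?dvd_triples_uniq //.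
  by move=> [a t] [a' t'] _ _ /= [-> ->].
rewrite (_ : (\sum_(a <- _) _)%N = size L); last by rewrite size_allpairs_dep sumnE big_map.
pose M := [seq (p, q) | p <- [seq (p, q) | p <- divpairs Y, q <- divpairs Y], q <- divpairs Y].
pose f (x : (gint * gint) * (gint * gint) * (gint * gint)) :=
  (x.1.1.1 * x.1.2.1 * x.2.1, (x.1.1.1 * x.1.1.2, x.1.2.1 * x.1.2.2, x.2.1 * x.2.2)).
have <- : size (map f M) = (size (divpairs Y) ^ 3)%N.
  by rewrite size_map !size_allpairs; move: (size _) => s; rewrite !expnS expn0 muln1 mulnA.
apply: uniq_leq_size => // -[a [[u v] w]] /allpairsPdep[a' [t [ha ht [-> ?]]]]; subst t.
move: ha ht; rewrite mem_nzball mem_dvd_triples /= => /andP[a0 aX] /and4P[hd hu hv hw].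
rewrite nrm_gt0 in a0.
have [g1 [a1 [h1 [g10 ea eu c1]]]] := gcd_decomp u a0.
have a10 : a1 != 0 by move: a0; rewrite ea gmul_eq0 negb_or => /andP[].
have d1 : gdvd a1 (v * w).
  apply: (@gauss_dvd _ h1) => //; move/gdvdP: hd => [s]; rewrite ea eu => hs.
  by apply/gdvdP; exists s; apply: (gmulfI g10); rewrite [RHS]mulrA -hs; ring.
have [g2 [a2 [h2 [g20 ea1 ev c2]]]] := gcd_decomp v a10.
have a20 : a2 != 0 by move: a10; rewrite ea1 gmul_eq0 negb_or => /andP[].
have /gdvdP[h3 ew] : gdvd a2 w.
  apply: (@gauss_dvd _ h2) => //; move/gdvdP: d1 => [s]; rewrite ea1 ev => hs.
  by apply/gdvdP; exists s; apply: (gmulfI g20); rewrite [RHS]mulrA -hs; ring.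
have n1 : (0 < nrm g1)%N by rewrite nrm_gt0.
have n2 : (0 < nrm g2)%N by rewrite nrm_gt0.
have n3 : (0 < nrm a2)%N by rewrite nrm_gt0.
have na : (nrm g1 * (nrm g2 * nrm a2) <= Y)%N by rewrite -!nrmM -ea1 -ea (leq_trans aX).
apply/mapP; exists ((g1, h1), (g2, h2), (a2, h3)); last first.
  by rewrite /f /= -eu -ev -ew ea ea1 mulrA.
apply/allpairsP; exists ((g1, h1), (g2, h2), (a2, h3)); split => //=.
  apply/allpairsP; exists ((g1, h1), (g2, h2)); split => //=.
    rewrite mem_divpairs /= g10 -nrmM -eu hu andbT /=.
    by apply: leq_trans na; rewrite leq_pmulr // muln_gt0 n2.
  rewrite mem_divpairs /= g20 -nrmM -ev hv andbT /=.
  by apply: leq_trans na; rewrite mulnCA leq_pmulr // muln_gt0 n1.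
rewrite mem_divpairs /= a20 -nrmM -ew hw andbT /=.
by apply: leq_trans na; rewrite mulnA leq_pmull // muln_gt0 n1.
Qed.

Section divisor_sum.
Variable R : realType.

(** Dyadic blocks: at most [4 * 2 ^ (K + 1) + 1 <= 9 * 2 ^ K] elements have norm between [2 ^ K] and
    [2 ^ (K + 1)], so each block contributes at most 9. *)
Lemma sum_inv_nrm K : \sum_(g <- nzball (2 ^ K)) ((nrm g)%:R)^-1 <= 9 * (K.+1)%:R :> R.
Proof.
elim: K => [|K IH].
  rewrite expn0 mulr1; apply: (@le_trans _ _ (\sum_(g <- nzball 1) (1 : R))).
    rewrite big_seq [leRHS]big_seq; apply: ler_sum => g; rewrite mem_nzball => /andP[g0 _].
    by rewrite invf_le1 ?ler1n ?ltr0n.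
  rewrite big_const_seq count_predT iter_addr_0 ler_nat.
  by apply: leq_trans (size_nzball_le R 1) _.
have -> : 9 * K.+2%:R = 9 * K.+1%:R + 9 :> R by rewrite -[K.+2%:R]natr1; ring.
rewrite (@nzball_split R _ (2 ^ K)) ?leq_exp2l // lerD //.
apply: (@le_trans _ _ (\sum_(g <- nzball (2 ^ K.+1)) ((2 ^ K)%:R)^-1)).
  rewrite [leRHS](bigID (fun g => (2 ^ K < nrm g)%N)) /= -[leLHS]addr0 lerD //; last first.
    by apply: sumr_ge0 => *; rewrite invr_ge0.
  apply: ler_sum => g h; rewrite lef_pV2 ?posrE ?ltr0n ?expn_gt0 ?(leq_ltn_trans _ h) //.
  by rewrite ler_nat ltnW.
rewrite big_const_seq count_predT iter_addr_0 -[leLHS]mulr_natl ler_pdivrMr ?ltr0n ?expn_gt0 //.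
rewrite -natrM ler_nat; rewrite size_filter; apply: leq_trans (count_size _ _) _.
apply: leq_trans (@size_ball_le R _) _; rewrite expnS.
have : (0 < 2 ^ K)%N by rewrite expn_gt0.
lia.
Qed.

Lemma size_divpairs_le Y : (size (divpairs Y) <= 45 * Y * (trunc_log 2 Y + 2))%N.
Proof.
have [->|Y0] := posnP Y; first by vm_compute.
have YK : (Y <= 2 ^ (trunc_log 2 Y).+1)%N by rewrite ltnW // trunc_log_ltn.
rewrite size_allpairs_dep sumnE big_map -(ler_nat R) natr_sum.
apply: (@le_trans _ _ (\sum_(g <- nzball Y) 5 * Y%:R * ((nrm g)%:R)^-1)).
  rewrite big_seq [leRHS]big_seq; apply: ler_sum => g; rewrite mem_nzball => /andP[g0 gY].
  rewrite ler_pdivlMr ?ltr0n // -!natrM ler_nat.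
  apply: (@leq_trans ((4 * (Y %/ nrm g) + 1) * nrm g)); first by rewrite leq_mul2r (@size_ball_le R) orbT.
  have := leq_divM Y (nrm g); nia.
rewrite -big_distrr /= !natrM.
have h := @sum_inv_nrm (trunc_log 2 Y).+1.
apply: (@le_trans _ _ (5 * Y%:R * (9 * (trunc_log 2 Y).+2%:R))).
  rewrite ler_wpM2l ?mulr_ge0 //; apply: le_trans h.
  by rewrite [leRHS](@nzball_split R _ Y) // lerDl sumr_ge0 // => *; rewrite invr_ge0.
by rewrite addn2; lra.
Qed.

Lemma pow4_le_exp2 n : (16 <= n)%N -> (n ^ 4 <= 2 ^ n)%N.
Proof.
elim: n => // n IH; rewrite leq_eqVlt => /predU1P[<-|]; first by rewrite -[X in (X ^ 4)%N]/(2 ^ 4)%N -expnM.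
rewrite ltnS => n16; rewrite [leqRHS]expnS.
apply: (@leq_trans (2 * n ^ 4)); last by rewrite leq_mul2l IH.
have : ((6 * n.+1) ^ 4 <= (7 * n) ^ 4)%N by rewrite leq_exp2r //; lia.
rewrite !expnMn; move: (n.+1 ^ 4)%N (n ^ 4)%N => x y.
by rewrite (_ : 6 ^ 4 = 1296)%N // (_ : 7 ^ 4 = 2401)%N //; lia.
Qed.

(** With [K] about [log X], the divisor bound gives [O(X ^ 3 K ^ 3)], and [K ^ 4 <= 2 ^ K <= 32 X]
    turns this into [O(X ^ 4 / K)]. The radius [8 * X] is the one required by [energy_le]. *)
Lemma dvd_triples_small (e : R) : 0 < e -> exists N, forall X, (N <= X)%N ->
  (\sum_(a <- nzball X) size (dvd_triples (8 * X) a))%:R <= e * X%:R ^+ 4.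
Proof.
move=> e0; pose C : R := 45 ^+ 3 * 8 ^+ 3 * 32.
have C0 : 0 < C by rewrite /C !mulr_gt0 ?exprn_gt0.
have [M hM] := natS_gt (C / e).
pose K0 := maxn M 16; exists (2 ^ K0)%N => X hX.
have X0 : (0 < X)%N by apply: leq_trans hX; rewrite expn_gt0.
set K := (trunc_log 2 (8 * X) + 2)%N.
have X80 : (0 < 8 * X)%N by rewrite muln_gt0.
have KX : (2 ^ K <= 32 * X)%N.
  rewrite /K expnD; have := trunc_logP (isT : (1 < 2)%N) X80; lia.
have KM : (K0 <= K)%N.
  rewrite /K; apply: (@leq_trans (trunc_log 2 (8 * X))); last exact: leq_addr.
  by apply: trunc_log_max => //; apply: leq_trans hX _; rewrite leq_pmull.
have K16 : (16 <= K)%N by apply: leq_trans KM; rewrite leq_maxr.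
have h1 : (\sum_(a <- nzball X) size (dvd_triples (8 * X) a) <= (45 * (8 * X) * K) ^ 3)%N.
  by apply: leq_trans (dvd_triples_le (leq_pmull X _)) _; rewrite ?leq_exp2r ?size_divpairs_le.
have h2 : (K ^ 3 * K <= 32 * X)%N by rewrite -expnSr (leq_trans (pow4_le_exp2 K16)).
have XR : 0 < X%:R :> R by rewrite ltr0n.
have KR : 0 < K%:R :> R by rewrite ltr0n; apply: leq_trans K16.
have h3 : K%:R ^+ 3 * K%:R <= 32 * X%:R :> R by rewrite -natrX -!natrM ler_nat.
have h4 : C <= e * K%:R.
  by rewrite mulrC -ler_pdivrMr //; apply/ltW/hM; apply: leq_trans KM; rewrite leq_maxl.
have := h1; rewrite -(ler_nat R) => /le_trans; apply.
rewrite natrX !natrM -(ler_pM2r KR).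
have -> : (45 * (8 * X%:R) * K%:R) ^+ 3 * K%:R = 45 ^+ 3 * 8 ^+ 3 * X%:R ^+ 3 * (K%:R ^+ 3 * K%:R) :> R by ring.
have c3 : 0 <= 45 ^+ 3 * 8 ^+ 3 * X%:R ^+ 3 :> R by rewrite !mulr_ge0 ?exprn_ge0.
apply: le_trans (ler_wpM2l c3 h3) _.
have -> : 45 ^+ 3 * 8 ^+ 3 * X%:R ^+ 3 * (32 * X%:R) = C * X%:R ^+ 4 :> R by rewrite /C; ring.
by rewrite [leRHS]mulrAC ler_wpM2r // exprn_ge0.
Qed.

End divisor_sum.

End divisor_triples.

(** * Additive characters modulo a *)

Section characters.
Local Open Scope complex_scope.
Implicit Types a b c d g h t u v w z : gint.
Variable R : realType.
Local Notation nm := (@Normc.normc R).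

Lemma normc_sqrE (x : R[i]) : (nm x ^+ 2)%:C = x * x^*.
Proof. by rewrite rmorphXn /= -sqr_normc normc_def; case: x. Qed.

Lemma normc_ge0 (x : R[i]) : 0 <= nm x.
Proof. by case: x => p q /=; rewrite sqrtr_ge0. Qed.

Lemma normc_sum (I : Type) (r : seq I) (F : I -> R[i]) :
  nm (\sum_(i <- r) F i) <= \sum_(i <- r) nm (F i).
Proof.
elim: r => [|i r IH]; first by rewrite !big_nil Normc.normc0.
by rewrite !big_cons; apply: le_trans (le_normcD _ _) _; rewrite lerD2l.
Qed.

Definition expi (t : R) : R[i] := cos (2 * pi * t) +i* sin (2 * pi * t).

Lemma expiD (s t : R) : expi (s + t) = expi s * expi t.
Proof. by rewrite /expi mulrDr cosD sinD; simpc; congr (_ +i* _); ring. Qed.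

Lemma expi0 : expi 0 = 1.
Proof. by rewrite /expi mulr0 cos0 sin0. Qed.

Lemma expiN (t : R) : expi (- t) = (expi t)^*.
Proof. by rewrite /expi mulrN cosN sinN. Qed.

Lemma normc_expi (t : R) : nm (expi t) = 1.
Proof. by rewrite /expi /= cos2Dsin2 sqrtr1. Qed.

Lemma expi_nat (n : nat) : expi n%:R = 1.
Proof.
elim: n => [|n IH]; first exact: expi0.
rewrite -natr1 expiD IH mul1r /expi mulr1 (_ : 2 * pi = pi *+ 2); last by rewrite mulr_natl.
by rewrite cos2pi sin2pi.
Qed.

Lemma expi_int (m : int) : expi m%:~R = 1.
Proof.
case: m => n; first exact: expi_nat.
by rewrite NegzE rmorphN /= expiN expi_nat conjc1.
Qed.

(** Up to [pi / 4] one has [cos y >= 1 / 2] and [y cos y <= sin y]; beyond it [sin y >= 1 / 2],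
    while [y / 4 < 1 / 2] because [pi / 2 < 2]. *)
Lemma sin_ge_quarter (y : R) : 0 <= y <= pi / 2 -> y / 4 <= sin y.
Proof.
case/andP=> y0 y2; have p0 := pi_gt0 R; have p4 := pihalf_lt2 R.
have h4 : cos (pi / 4) = sin (pi / 4) :> R.
  rewrite (_ : cos (pi / 4) = sin (pi / 2 - pi / 4)); first by congr sin; lra.
  by rewrite sinB sin_pihalf cos_pihalf; ring.
have h5 : 1 / 2 <= sin (pi / 4) :> R.
  have s0 : 0 <= sin (pi / 4) :> R by apply: sin_ge0_pi; apply/andP; split; lra.
  have := cos2Dsin2 (pi / 4 : R); rewrite h4 => e.
  rewrite leNgt; apply/negP => h; have : sin (pi / 4) ^+ 2 <= (1 / 2) ^+ 2 :> R.
    by rewrite lerXn2r ?nnegrE // ltW.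
  by move: (sin (pi / 4)) e => s; lra.
have mono (s t : R) : 0 <= s -> s <= t -> t <= pi / 2 -> sin s <= sin t.
  move=> s0 st t2; rewrite le_eqVlt in st; case/predU1P: st => [->//|st].
  by apply/ltW; rewrite ltr_sin // in_itv /=; apply/andP; split; lra.
have [yq|yq] := leP y (pi / 4).
  have c1 : 1 / 2 <= cos y.
    rewrite (_ : cos y = sin (pi / 2 - y)).
      by apply: le_trans h5 _; apply: mono; lra.
    by rewrite sinB sin_pihalf cos_pihalf; ring.
  have := @mul_cos_le_sin R y; rewrite y0 /= => /(_ ltac:(lra)).
  have := ler_wpM2l y0 c1; lra.
apply: (@le_trans _ _ (1 / 2)); first by lra.
by apply: le_trans h5 _; apply: mono; lra.
Qed.

Lemma normc_1sub_expi (t : R) : `|t| <= 1 / 2 -> t ^+ 2 <= nm (1 - expi t) ^+ 2.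
Proof.
move=> th.
have -> : nm (1 - expi t) ^+ 2 = 4 * sin (pi * t) ^+ 2.
  rewrite /expi /=; rewrite sqr_sqrtr ?addr_ge0 ?sqr_ge0 // -mulrA.
  rewrite (_ : 2 * (pi * t) = (pi * t) *+ 2); last by rewrite mulr_natl.
  rewrite cos_mulr2n sin_mulr2n sub0r sqrrN cos2sin2.
  have := cos2Dsin2 (pi * t); move: (cos _) (sin _) => x y e.
  have -> : (x * y *+ 2) ^+ 2 = 4 * x ^+ 2 * y ^+ 2 by ring.
  have -> : x ^+ 2 = 1 - y ^+ 2 by lra.
  ring.
have -> : t ^+ 2 = `|t| ^+ 2 by rewrite real_normK ?num_real.
have -> : sin (pi * t) ^+ 2 = sin (pi * `|t|) ^+ 2.
  by case: (ger0P t) => // _; rewrite mulrN sinN sqrrN.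
have t0 := normr_ge0 t; move: `|t| t0 th => s s0 sh.
have p2 := pi_ge2 R; have p0 := pi_gt0 R.
have h1 : s / 2 <= sin (pi * s).
  apply: (@le_trans _ _ (pi * s / 4)); first by have := ler_wpM2r s0 p2; lra.
  apply: sin_ge_quarter; rewrite mulr_ge0 ?(ltW p0) //=.
  by have := ler_wpM2l (ltW p0) sh; lra.
have h2 : (s / 2) ^+ 2 <= sin (pi * s) ^+ 2.
  by rewrite lerXn2r ?nnegrE ?divr_ge0 // (le_trans _ h1) // divr_ge0.
lra.
Qed.

(** The character e(Re(z / a)) of the additive group modulo [a]. It sees only a real part, so
    nondegeneracy is tested at [z] and at [z * gI] together. *)
Definition psi a z : R[i] := expi ((gre (z * gconj a))%:~R / (nrm a)%:R).

Lemma psiD a z w : psi a (z + w) = psi a z * psi a w.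
Proof. by rewrite /psi mulrDl greD intrD mulrDl expiD. Qed.

Lemma psi0 a : psi a 0 = 1.
Proof. by rewrite /psi mul0r mul0r expi0. Qed.

Lemma psiN a z : psi a (- z) = (psi a z)^*.
Proof. by rewrite /psi mulNr greN intrN mulNr expiN. Qed.

Lemma normc_psi a z : nm (psi a z) = 1.
Proof. exact: normc_expi. Qed.

Lemma psi_dvd a z : a != 0 -> gdvd a z -> psi a z = 1.
Proof.
move=> a0 /gdvdP[t ->]; rewrite /psi mulrAC mul_conj gre_mulz intrM mulrAC.
by rewrite -pmulrn divff ?mul1r ?expi_int // pnatr_eq0 nrm_eq0.
Qed.

Lemma psi_eqm a z w : a != 0 -> gdvd a (z - w) -> psi a z = psi a w.
Proof. by move=> a0 h; rewrite -[z](subrK w) psiD (psi_dvd a0 h) mul1r. Qed.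

Lemma expi_nearest (t : R) : exists q : int, (t - q%:~R) ^+ 2 <= nm (1 - expi t) ^+ 2.
Proof.
exists (Num.floor (t + 1 / 2)); set q := Num.floor _.
have h1 : q%:~R <= t + 1 / 2 by exact: floor_le_tmp.
have h2 : t + 1 / 2 < (q + 1)%:~R by exact: floorD1_gt.
have -> : expi t = expi (t - q%:~R) by rewrite expiD -rmorphN expi_int mulr1.
apply: normc_1sub_expi; rewrite intrD in h2.
by rewrite ler_norml; apply/andP; split; lra.
Qed.

(** [psi] at [m] and at [m * gI] controls the distance of the real and imaginary parts of [m / a] to
    the nearest integers; subtracting [a] times the nearest Gaussian integer leaves [m0]. *)
Lemma psi_small a m (T : R) : a != 0 ->
  nm (1 - psi a m) ^+ 2 * (nrm a)%:R <= T -> nm (1 - psi a (m * gI)) ^+ 2 * (nrm a)%:R <= T ->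
  exists2 m0, gdvd a (m - m0) & (nrm m0)%:R <= 2 * T.
Proof.
move=> a0 h1 h2; have n0 : 0 < (nrm a)%:R :> R by rewrite ltr0n nrm_gt0.
set n := (nrm a)%:R in n0 h1 h2 *.
have [q hq] := expi_nearest ((gre (m * gconj a))%:~R / n).
have [q' hq'] := expi_nearest ((gre (m * gI * gconj a))%:~R / n).
(* The sign of [q'] comes from Re(i m / a) = - Im(m / a). *)
exists (m - a * Gint q (- q')); first by rewrite opprB addrC subrK gdvd_mulr ?gdvd_refl.
have e1 : gre (m * gI * gconj a) = - gim (m * gconj a) by rewrite mulrAC !gE /=; ring.
rewrite e1 in hq'.
set m0 := m - _.
have em : m0 * gconj a = m * gconj a - gofi (nrm a)%:Z * Gint q (- q').
  by rewrite /m0 mulrBl mulrAC mul_conj.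
have eN : (nrm m0)%:R * n = ((gre (m * gconj a))%:~R - n * q%:~R) ^+ 2 +
     ((- gim (m * gconj a))%:~R - n * q'%:~R) ^+ 2.
  rewrite /n -natrM -[in LHS](nrm_conj a) -nrmM -[LHS]/((nrm _)%:Z%:~R) nrmE em.
  rewrite greD gimD greN gimN gre_mulz gim_mulz /= intrD !rmorphXn /= !intrD !intrN !intrM.
  by rewrite intrN; ring.
have s1 : ((gre (m * gconj a))%:~R - n * q%:~R) ^+ 2 <= n * T.
  have -> : (gre (m * gconj a))%:~R - n * q%:~R = n * ((gre (m * gconj a))%:~R / n - q%:~R) :> R.
    by rewrite mulrBr [n * (_ / n)]mulrC divfK ?gt_eqF.
  rewrite exprMn expr2 -mulrA ler_pM2l // mulrC.
  by apply: le_trans h1; rewrite ler_pM2r.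
have s2 : ((- gim (m * gconj a))%:~R - n * q'%:~R) ^+ 2 <= n * T.
  have -> : (- gim (m * gconj a))%:~R - n * q'%:~R = n * ((- gim (m * gconj a))%:~R / n - q'%:~R) :> R.
    by rewrite mulrBr [n * (_ / n)]mulrC divfK ?gt_eqF.
  rewrite exprMn expr2 -mulrA ler_pM2l // mulrC.
  by apply: le_trans h2; rewrite ler_pM2r // /psi e1.
by rewrite -(ler_pM2r n0) eN; lra.
Qed.

Lemma psi_eq1_dvd a z : a != 0 -> psi a z = 1 -> psi a (z * gI) = 1 -> gdvd a z.
Proof.
move=> a0 h1 h2.
have [||m0 hm] := @psi_small a z 0 a0; rewrite ?h1 ?h2 ?subrr ?Normc.normc0 ?expr0n ?mul0r //.
rewrite mulr0 lern0 nrm_eq0 => /eqP m00.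
by rewrite m00 subr0 in hm.
Qed.

(** Translating the summation variable by [s] multiplies the sum by [psi a (s * z)]; if [a] does not
    divide [z], then [s = 1] or [s = gI] makes this factor different from 1. *)
Lemma sum_psi a z : a != 0 ->
  \sum_(m <- Rs a) psi a (m * z) = if gdvd a z then (nrm a)%:R else 0.
Proof.
move=> a0; case: ifPn => hz.
  rewrite (eq_bigr (fun=> 1)) => [|m _]; last by rewrite psi_dvd // gdvd_mull.
  by rewrite big_const_seq count_predT iter_addr_0 size_Rs.
have shift s : (psi a (s * z) - 1) * \sum_(m <- Rs a) psi a (m * z) = 0.
  rewrite mulrBl mul1r big_distrr /=; apply/eqP; rewrite subr_eq0; apply/eqP.
  rewrite -[RHS](@Rs_reindex _ a (fun m => s + m)) //.
  - by apply: eq_bigr => m _; rewrite mulrDl psiD.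
  - by move=> x y _ _; rewrite opprD addrACA subrr add0r.
  move=> x; apply: psi_eqm => //; rewrite -mulrBl gdvd_mulr // gdvd_eq grem_id //.
have nz : exists s, psi a (s * z) - 1 != 0.
  case: (eqVneq (psi a z) 1) => h1; last by exists 1; rewrite mul1r subr_eq0.
  exists gI; rewrite mulrC subr_eq0; apply: contraNneq hz => h2; exact: psi_eq1_dvd.
by have [s hs] := nz; apply: (mulfI hs); rewrite shift mulr0.
Qed.

End characters.

(** * The modular hyperbola and its additive energy *)

Section hyperbola.
Local Open Scope complex_scope.
Implicit Types a b c d g m p t u v w z : gint.

Lemma sum_fiber (S T : eqType) (V : nmodType) (f : S -> T) (F : T -> V) (s : seq S) (t : seq T) :
  uniq t -> {in s, forall x, f x \in t} ->
  \sum_(x <- s) F (f x) = \sum_(y <- t) F y *+ count (fun x => f x == y) s.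
Proof.
move=> ut; elim: s => [|x s IH] h; first by rewrite big_nil big1 // => y _; rewrite mulr0n.
rewrite big_cons IH; last by move=> y ys; apply: h; rewrite inE ys orbT.
under [RHS]eq_bigr do rewrite /= mulrnDr.
rewrite big_split /=; congr (_ + _).
have fx : f x \in t by apply: h; rewrite inE eqxx.
rewrite (bigD1_seq (f x)) //= eqxx mulr1n big1 ?addr0 // => y /negPf h'.
by rewrite eq_sym h' mulr0n.
Qed.

(* The sign is the one of [a * d - b * c = 1]. *)
Definition hyp a : seq (gint * gint) :=
  [seq h <- [seq (x, y) | x <- Rs a, y <- Rs a] | gdvd a (h.1 * h.2 + 1)].

Lemma mem_hypP a (h : gint * gint) :
  reflect [/\ h.1 \in Rs a, h.2 \in Rs a & gdvd a (h.1 * h.2 + 1)] (h \in hyp a).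
Proof.
rewrite mem_filter; apply: (iffP andP) => [[hd /allpairsP[[x y] /= [hx hy e]]]|[hx hy hd]].
  by move: hd; rewrite e.
by split => //; apply/allpairsP; exists h; split => //; case: (h).
Qed.

Lemma hyp_uniq a : uniq (hyp a).
Proof.
apply: filter_uniq; apply: allpairs_uniq; rewrite ?Rs_uniq //.
by move=> [x y] [x' y'] _ _ /= [-> ->].
Qed.

Lemma unit_cancel a x y z : gdvd a (x * y + 1) -> gdvd a (x * z) -> gdvd a z.
Proof.
move=> h1 h2; rewrite (_ : z = (x * y + 1) * z - x * z * y); last by ring.
by rewrite gdvdB // gdvd_mulr.
Qed.

Lemma hyp_fst_inj a (h h' : gint * gint) : a != 0 -> h \in hyp a -> h' \in hyp a ->
  h.1 = h'.1 -> h = h'.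
Proof.
move=> a0 /mem_hypP[hx hy hd] /mem_hypP[hx' hy' hd'] e.
case: h h' hx hy hd hx' hy' hd' e => x y [x' y'] /= hx hy hd hx' hy' hd' e.
rewrite -{x' hx'}e in hd' *; congr (_, _); apply: (Rs_inj a0 hy hy').
apply: (unit_cancel hd); rewrite (_ : _ * _ = (x * y + 1) - (x * y' + 1)); last by ring.
exact: gdvdB.
Qed.

Lemma hyp_snd_inj a (h h' : gint * gint) : a != 0 -> h \in hyp a -> h' \in hyp a ->
  h.2 = h'.2 -> h = h'.
Proof.
move=> a0 /mem_hypP[hx hy hd] /mem_hypP[hx' hy' hd'] e.
case: h h' hx hy hd hx' hy' hd' e => x y [x' y'] /= hx hy hd hx' hy' hd' e.
rewrite -{y' hy'}e in hd' *; congr (_, _); apply: (Rs_inj a0 hx hx').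
rewrite mulrC in hd; rewrite mulrC in hd'.
apply: (unit_cancel hd); rewrite (_ : _ * _ = (y * x + 1) - (y * x' + 1)); last by ring.
exact: gdvdB.
Qed.

Lemma size_hyp_le a : a != 0 -> (size (hyp a) <= nrm a)%N.
Proof.
move=> a0; rewrite -size_Rs // -(size_map fst); apply: uniq_leq_size.
  rewrite map_inj_in_uniq ?hyp_uniq // => h h' hh hh'; exact: hyp_fst_inj a0 hh hh'.
by move=> _ /mapP[h /mem_hypP[hx _ _] ->].
Qed.

Lemma nrmD_le z w : (nrm (z + w)%R <= 2 * (nrm z + nrm w))%N.
Proof.
rewrite -lez_nat PoszM PoszD !nrmE greD gimD.
have := sqr_ge0 (gre z - gre w); have := sqr_ge0 (gim z - gim w); lra.
Qed.

Section kloosterman.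
Variable R : realType.
Local Notation nm := (@Normc.normc R).

(** A Kloosterman sum, with [h.2] minus the inverse of [h.1] modulo [a]; in the usual normalization
    the second frequency is [- m']. *)
Definition kl a m m' : R[i] := \sum_(h <- hyp a) psi R a (m * h.1 + m' * h.2).

Lemma kl_le a m m' : nm (kl a m m') <= (size (hyp a))%:R.
Proof.
apply: le_trans (normc_sum _ _) _; under eq_bigr do rewrite normc_psi.
by rewrite big_const_seq count_predT iter_addr_0.
Qed.

Lemma kl_eqm a m m' p p' : a != 0 -> gdvd a (m - p) -> gdvd a (m' - p') ->
  kl a m m' = kl a p p'.
Proof.
move=> a0 h1 h2; apply: eq_bigr => h _; apply: psi_eqm => //.
rewrite (_ : _ - _ = (m - p) * h.1 + (m' - p') * h.2); last by ring.
by apply: gdvdD; apply: gdvd_mulr.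
Qed.

(** If [u v = -1], then [(x, y)] to [(u x, - v y)] preserves the relation [x y = -1] modulo [a] and
    permutes the hyperbola. *)
Lemma kl_dilate a m m' (k : gint * gint) : a != 0 -> k \in hyp a ->
  kl a (m * k.1) (- (m' * k.2)) = kl a m m'.
Proof.
move=> a0 /mem_hypP[_ _]; case: k => u v /= uv.
pose f (h : gint * gint) := (grem a (u * h.1), grem a (- (v * h.2))).
have fh h : h \in hyp a -> f h \in hyp a.
  move=> /mem_hypP[_ _ hd]; apply/mem_hypP; split; rewrite ?mem_grem //=.
  case: (grem_sub a (u * h.1)) => s; case: (grem_sub a (- (v * h.2))) => s'.
  move: (grem a (u * h.1)) (grem a (- (v * h.2))) => x y e2 e1.
  have -> : x * y + 1 = (u * h.1) * (- (v * h.2)) + 1 - a * (s * (- (v * h.2)) + s' * x).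
    by rewrite {1}e1 {1 2}e2; ring.
  rewrite gdvdB ?gdvd_mulr ?gdvd_refl //.
  rewrite (_ : _ + 1 = (h.1 * h.2 + 1) - (u * v + 1) * (h.1 * h.2)); last by ring.
  by rewrite gdvdB // gdvd_mulr.
have pf : perm_eq [seq f h | h <- hyp a] (hyp a).
  have uf : uniq [seq f h | h <- hyp a].
    rewrite map_inj_in_uniq ?hyp_uniq // => h h' hh hh' /(congr1 fst) /= /eqP.
    rewrite -gdvd_eq -mulrBr => /(unit_cancel uv) e.
    apply: (hyp_fst_inj a0 hh hh'); apply: (Rs_inj a0) => //.
      by case/mem_hypP: hh.
    by case/mem_hypP: hh'.
  apply: uniq_perm => //; first exact: hyp_uniq.
  apply: (uniq_min_size uf _ _).2 => //; last by rewrite size_map.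
  by move=> _ /mapP[h hh ->]; apply: fh.
rewrite /kl -[RHS](perm_big _ pf) big_map; apply: eq_bigr => h _ /=.
apply: psi_eqm => //.
case: (grem_sub a (u * h.1)) => s e1; case: (grem_sub a (- (v * h.2))) => s' e2.
apply/gdvdP; exists (m * s + m' * s').
rewrite (_ : _ - _ = m * (u * h.1 - grem a (u * h.1)) + m' * (- (v * h.2) - grem a (- (v * h.2)))); last by ring.
by rewrite {1}e1 {1}e2; ring.
Qed.

Definition gquo a z :=
  Gint (divz (gre (z * gconj a)) (nrm a)) (divz (gim (z * gconj a)) (nrm a)).

Lemma gquoE a z : z = a * gquo a z + grem a z.
Proof. by rewrite /grem addrC subrK. Qed.

(** Write [m x = a q + p]. Solutions whose quotients [q] agree modulo [m] are congruent modulo [a],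
    so the solutions inject into the [nrm m] classes modulo [m]. *)
Lemma count_dilate_le a m p : a != 0 -> m != 0 ->
  (count (fun h : gint * gint => grem a (m * h.1)%R == p) (hyp a) <= nrm m)%N.
Proof.
move=> a0 m0; rewrite -size_filter -(size_Rs m0) -(size_map (fun h => grem m (gquo a (m * h.1)))).
apply: uniq_leq_size => [|_ /mapP[h _ ->]]; last exact: mem_grem.
rewrite map_inj_in_uniq => [|h h']; first exact/filter_uniq/hyp_uniq.
rewrite mem_filter => /andP[/eqP e1 hh]; rewrite mem_filter => /andP[/eqP e2 hh'] /eqP.
rewrite -gdvd_eq.
move=> /gdvdP[s hs]; apply: (hyp_fst_inj a0 hh hh'); apply: (Rs_inj a0).
- by case/mem_hypP: hh.
- by case/mem_hypP: hh'.
apply/gdvdP; exists s; apply: (gmulfI m0).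
rewrite mulrBr {1}(gquoE a (m * h.1)) {1}(gquoE a (m * h'.1)) e1 e2.
by rewrite mulrCA -hs; ring.
Qed.

Definition quads a := [seq (h, k) | h <- [seq (h, k) | h <- hyp a, k <- hyp a],
                                    k <- [seq (h, k) | h <- hyp a, k <- hyp a]].
Definition same_sum a (q : (gint * gint) * (gint * gint) * ((gint * gint) * (gint * gint))) :=
  gdvd a (q.1.1.1 + q.1.2.1 - (q.2.1.1 + q.2.2.1)) &&
  gdvd a (q.1.1.2 + q.1.2.2 - (q.2.1.2 + q.2.2.2)).
(** The additive energy of the hyperbola as a set of points modulo [a]. *)
Definition energy a : nat := count (same_sum a) (quads a).

Lemma kl_pow4 a m m' : ((nm (kl a m m')) ^+ 4)%:C =
  \sum_(q <- quads a) psi R a (m * (q.1.1.1 + q.1.2.1 - (q.2.1.1 + q.2.2.1)))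
                    * psi R a (m' * (q.1.1.2 + q.1.2.2 - (q.2.1.2 + q.2.2.2))).
Proof.
have -> : (nm (kl a m m') ^+ 4)%:C = (kl a m m' * kl a m m') * (kl a m m' * kl a m m')^*.
  by rewrite (exprM _ 2 2) rmorphXn /= normc_sqrE rmorphM /=; ring.
have -> : kl a m m' * kl a m m' = \sum_(p <- [seq (h, k) | h <- hyp a, k <- hyp a])
    psi R a (m * (p.1.1 + p.2.1) + m' * (p.1.2 + p.2.2)).
  rewrite big_allpairs /= big_distrlr /=; apply: eq_bigr => h _; apply: eq_bigr => k _.
  by rewrite -psiD; congr psi; ring.
rewrite rmorph_sum /= big_distrlr /= [RHS]big_allpairs /=.
apply: eq_bigr => p _; apply: eq_bigr => p' _.
transitivity (psi R a (m * (p.1.1 + p.2.1) + m' * (p.1.2 + p.2.2)) *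
  psi R a (- (m * (p'.1.1 + p'.2.1) + m' * (p'.1.2 + p'.2.2)))).
  by congr (_ * _); symmetry; exact: psiN.
by rewrite -!psiD; congr psi; ring.
Qed.

Lemma sum_kl_pow4 a : a != 0 ->
  \sum_(p <- Rs a) \sum_(p' <- Rs a) nm (kl a p p') ^+ 4 = (nrm a)%:R ^+ 2 * (energy a)%:R.
Proof.
move=> a0; apply: complexI.
rewrite rmorph_sum /=.
transitivity (\sum_(q <- quads a)
   (\sum_(p <- Rs a) psi R a (p * (q.1.1.1 + q.1.2.1 - (q.2.1.1 + q.2.2.1)))) *
   (\sum_(p <- Rs a) psi R a (p * (q.1.1.2 + q.1.2.2 - (q.2.1.2 + q.2.2.2))))).
  under eq_bigr do rewrite rmorph_sum /=; under eq_bigr do under eq_bigr do rewrite kl_pow4.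
  under eq_bigr do rewrite exchange_big /=; rewrite exchange_big /=; apply: eq_bigr => q _.
  by rewrite big_distrlr.
under eq_bigr do rewrite !sum_psi //.
rewrite rmorphM rmorphXn !rmorph_nat /energy -sum1_count natr_sum big_distrr /=.
rewrite [RHS]big_mkcond /=; apply: eq_bigr => q _; rewrite /same_sum.
by case: ifP => _; case: ifP => _; rewrite ?mulr0 ?mul0r ?mulr1 ?expr2.
Qed.

(* From [x1 + x2 = x3 + x4] and the same for the inverses one gets
   [(x1 + x2) * (x3 - x1) * (x3 - x2) = 0] modulo [a]. *)
Lemma energy_le a Y : a != 0 -> (8 * nrm a <= Y)%N -> (energy a <= size (dvd_triples Y a))%N.
Proof.
move=> a0 aY; rewrite /energy -size_filter.
set s := [seq q <- quads a | same_sum a q].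
pose f (q : (gint * gint) * (gint * gint) * ((gint * gint) * (gint * gint))) :=
  (q.1.1.1 + q.1.2.1, q.2.1.1 - q.1.1.1, q.2.1.1 - q.1.2.1).
have sP q : q \in s -> [/\ q.1.1 \in hyp a, q.1.2 \in hyp a, q.2.1 \in hyp a, q.2.2 \in hyp a
     & same_sum a q].
  rewrite mem_filter => /andP[d /allpairsP[[p p'] /= [hp hp' e]]].
  move: d; rewrite e => d.
  by case/allpairsP: hp d => -[? ?] /= [? ? ->]; case/allpairsP: hp' => -[? ?] /= [? ? ->].
have us : uniq s.
  apply: filter_uniq; apply: allpairs_uniq.
  - by apply: allpairs_uniq; rewrite ?hyp_uniq // => -[x y] [x' y'] _ _ /= [-> ->].
  - by apply: allpairs_uniq; rewrite ?hyp_uniq // => -[x y] [x' y'] _ _ /= [-> ->].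
  by move=> [x y] [x' y'] _ _ /= [-> ->].
rewrite -(size_map f); apply: uniq_leq_size.
  rewrite map_inj_in_uniq // => q q' /sP[a1 a2 a3 a4 /andP[d1 d2]] /sP[b1 b2 b3 b4 /andP[e1 e2]] ef.
  have f1 : q.1.1.1 + q.1.2.1 = q'.1.1.1 + q'.1.2.1 := congr1 (fun x => x.1.1) ef.
  have f2 : q.2.1.1 - q.1.1.1 = q'.2.1.1 - q'.1.1.1 := congr1 (fun x => x.1.2) ef.
  have f3 : q.2.1.1 - q.1.2.1 = q'.2.1.1 - q'.1.2.1 := congr1 snd ef.
  have two (x y : gint) : x + x = y + y -> x = y.
    move=> e; apply: (@gmulfI (1 + 1)) => //; rewrite !mulrDl !mul1r; exact: e.
  have x3 : q.2.1.1 = q'.2.1.1.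
    have aux (p1 p2 p3 : gint) : p1 + p2 + (p3 - p1 + (p3 - p2)) = p3 + p3 by ring.
    apply: two; rewrite -(aux q.1.1.1 q.1.2.1 q.2.1.1) -(aux q'.1.1.1 q'.1.2.1 q'.2.1.1).
    by rewrite f1 f2 f3.
  have x1 : q.1.1.1 = q'.1.1.1.
    by apply/eqP; rewrite -subr_eq0; move: f2; rewrite x3 => /addrI /oppr_inj ->; rewrite subrr.
  have x2 : q.1.2.1 = q'.1.2.1.
    by apply/eqP; rewrite -subr_eq0; move: f3; rewrite x3 => /addrI /oppr_inj ->; rewrite subrr.
  have x4 : q.2.2.1 = q'.2.2.1.
    apply: (Rs_inj a0); [by case/mem_hypP: a4|by case/mem_hypP: b4|].
    move: d1; rewrite x1 x2 x3 => d1.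
    rewrite (_ : _ - _ = (q'.1.1.1 + q'.1.2.1 - (q'.2.1.1 + q'.2.2.1)) -
       (q'.1.1.1 + q'.1.2.1 - (q'.2.1.1 + q.2.2.1))); last by ring.
    exact: gdvdB.
  have i1 := hyp_fst_inj a0 a1 b1 x1; have i2 := hyp_fst_inj a0 a2 b2 x2.
  have i3 := hyp_fst_inj a0 a3 b3 x3; have i4 := hyp_fst_inj a0 a4 b4 x4.
  by case: q q' i1 i2 i3 i4 {a1 a2 a3 a4 d1 d2 b1 b2 b3 b4 e1 e2 ef f1 f2 f3 x1 x2 x3 x4}
    => [[? ?] [? ?]] [[? ?] [? ?]] /= -> -> -> ->.
move=> _ /mapP[[[h1 h2] [h3 h4]] /sP /= [a1 a2 a3 a4 /andP[/= d1 d2]] ->].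
have nle (x y : gint) : x \in Rs a -> y \in Rs a -> (nrm (x + y)%R <= Y)%N.
  move=> /(Rs_ball a0) hx /(Rs_ball a0) hy; apply: leq_trans (nrmD_le x y) _.
  by apply: leq_trans aY; lia.
have nle2 (x y : gint) : x \in Rs a -> y \in Rs a -> (nrm (x - y)%R <= Y)%N.
  move=> /(Rs_ball a0) hx /(Rs_ball a0) hy; apply: leq_trans (nrmD_le x (- y)) _.
  by rewrite nrmN; apply: leq_trans aY; lia.
case/mem_hypP: a1 => r1 s1 g1; case/mem_hypP: a2 => r2' s2 g2.
case/mem_hypP: a3 => r3 s3 g3; case/mem_hypP: a4 => r4 s4 g4.
rewrite mem_dvd_triples /f /= nle // !nle2 // !andbT.
case: h1 h2 h3 h4 {r1 s1 r2' s2 r3 s3 r4 s4} g1 g2 g3 g4 d1 d2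
  => x1 y1 [x2 y2] [x3 y3] [x4 y4] /= g1 g2 g3 g4 d1 d2.
(* Modulo [a] the [y] are minus the inverses of the [x], so equal sums of both kinds force
   [(x1 + x2) * W = 0]; and [x1 + x2 = x3 + x4] turns [(x3 - x1) * (x3 - x2)] into [W]. *)
set W := x1 * x2 - x3 * x4.
have dW : gdvd a (W * (y1 + y2)).
  have -> : W * (y1 + y2) = (x1 * y1 + 1) * x2 + (x2 * y2 + 1) * x1 - (x3 * y3 + 1) * x4
     - (x4 * y4 + 1) * x3 - (x1 + x2 - (x3 + x4)) - (y1 + y2 - (y3 + y4)) * (x3 * x4).
    by rewrite /W; ring.
  apply: (gdvdB _ (gdvd_mulr _ d2)); apply: (gdvdB _ d1).
  apply: (gdvdB _ (gdvd_mulr _ g4)); apply: (gdvdB _ (gdvd_mulr _ g3)).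
  exact: (gdvdD (gdvd_mulr _ g1) (gdvd_mulr _ g2)).
have dsW : gdvd a ((x1 + x2) * W).
  have -> : (x1 + x2) * W = (x1 * y1 + 1) * (x2 * W) + (x2 * y2 + 1) * (x1 * W)
     - W * (y1 + y2) * (x1 * x2) by rewrite /W; ring.
  exact: (gdvdB (gdvdD (gdvd_mulr _ g1) (gdvd_mulr _ g2)) (gdvd_mulr _ dW)).
rewrite (_ : _ * _ = (x1 + x2) * W - (x1 + x2 - (x3 + x4)) * ((x1 + x2) * x3)); last by rewrite /W; ring.
exact: (gdvdB dsW (gdvd_mulr _ d1)).
Qed.

End kloosterman.

End hyperbola.

Section kloosterman_bound.
Local Open Scope complex_scope.
Implicit Types a b c d g m p t u v w z : gint.
Variable R : realType.
Local Notation nm := (@Normc.normc R).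

(* By [kl_dilate], the value [kl a m m'] occurs [size (hyp a)] times among the
   sums [kl a (m * h.1) _], and [m * h.1] takes each residue at most [nrm m] times. *)
Lemma kl_pow5 a m m' : a != 0 -> m != 0 ->
  nm (kl R a m m') ^+ 5 <= (nrm m)%:R * ((nrm a)%:R ^+ 2 * (energy a)%:R).
Proof.
move=> a0 m0; set k := nm _; have k0 : 0 <= k by apply: normc_ge0.
pose G w := \sum_(q <- Rs a) nm (kl R a w q) ^+ 4.
have G0 w : 0 <= G w by apply: sumr_ge0 => q _; rewrite exprn_ge0 ?normc_ge0.
have Gr w : G (grem a w) = G w.
  apply: eq_bigr => q _; congr (nm _ ^+ 4); apply: kl_eqm => //.
    by rewrite gdvd_eq grem_id.
  by rewrite subrr gdvd0.
have kG w q : nm (kl R a w q) ^+ 4 <= G w.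
  have -> : kl R a w q = kl R a w (grem a q).
    apply: kl_eqm => //; first by rewrite subrr gdvd0.
    by rewrite gdvd_eq grem_id.
  rewrite /G (bigD1_seq (grem a q)) ?Rs_uniq ?mem_grem //= lerDl.
  by apply: sumr_ge0 => ? _; rewrite exprn_ge0 ?normc_ge0.
apply: (@le_trans _ _ ((size (hyp a))%:R * k ^+ 4)).
  by rewrite exprS ler_wpM2r ?exprn_ge0 // kl_le.
apply: (@le_trans _ _ (\sum_(h <- hyp a) G (grem a (m * h.1)))).
  have -> : (size (hyp a))%:R * k ^+ 4 = \sum_(h <- hyp a) k ^+ 4.
    by rewrite big_const_seq count_predT iter_addr_0 mulr_natl.
  rewrite big_seq [leRHS]big_seq; apply: ler_sum => h hh.
  by rewrite Gr /k -(kl_dilate R m m' a0 hh); apply: kG.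
rewrite (sum_fiber G (Rs_uniq a)) => [|h _]; last exact: mem_grem.
rewrite -sum_kl_pow4 // big_distrr /=; apply: ler_sum => p _.
rewrite -[leLHS]mulr_natl ler_wpM2r // ler_nat; exact: count_dilate_le.
Qed.

(** For each [a] the value [k] is at most [eta X] or at most [k ^ 5 / (eta X) ^ 4]. The first bound
    sums to [e X ^ 2 / 2], as there are at most [5 X] moduli and [eta = e / 10]; the second is
    controlled by [kl_pow5] and [dvd_triples_small]. The bound is uniform in [m']. *)
Lemma kl_sum_small m (e : R) : m != 0 -> 0 < e ->
  exists N, forall X, (N <= X)%N -> exists bnd : gint -> R,
    [/\ forall a, 0 <= bnd a,
        forall a m', a \in nzball X -> nm (kl R a m m') <= bnd a &
        \sum_(a <- nzball X) bnd a <= e * X%:R ^+ 2].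
Proof.
move=> m0 e0; pose eta := e / 10; have eta0 : 0 < eta by rewrite divr_gt0.
have nm0 : 0 < (nrm m)%:R :> R by rewrite ltr0n nrm_gt0.
have e1 : 0 < e / 2 * eta ^+ 4 / (nrm m)%:R.
  by rewrite divr_gt0 // mulr_gt0 ?exprn_gt0 // divr_gt0.
have [N hN] := dvd_triples_small e1.
exists N.+1 => X hX; have X0 : 0 < X%:R :> R by rewrite ltr0n; lia.
have eX : 0 < eta * X%:R by rewrite mulr_gt0.
pose F a : R := (nrm m)%:R * (X%:R ^+ 2 * (size (dvd_triples (8 * X) a))%:R).
have F0 a : 0 <= F a by rewrite !mulr_ge0 ?exprn_ge0.
exists (fun a => eta * X%:R + F a / (eta * X%:R) ^+ 4); split.
- by move=> a; rewrite addr_ge0 ?(ltW eX) // divr_ge0 // exprn_ge0 // ltW.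
- move=> a m'; rewrite mem_nzball nrm_gt0 => /andP[a0 aX].
  have := kl_pow5 m' a0 m0; set k := nm _ => h5.
  have k0 : 0 <= k by apply: normc_ge0.
  have [ke|ke] := leP k (eta * X%:R).
    by rewrite (le_trans ke) // lerDl divr_ge0 // exprn_ge0 // ltW.
  apply: (@le_trans _ _ (F a / (eta * X%:R) ^+ 4)); last by rewrite lerDr ltW.
  rewrite ler_pdivlMr ?exprn_gt0 //.
  apply: (@le_trans _ _ (k ^+ 5)).
    rewrite [k ^+ 5]exprS ler_wpM2l // lerXn2r ?nnegrE ?(ltW eX) //; exact: ltW.
  apply: le_trans h5 _; rewrite /F ler_wpM2l // ler_pM ?exprn_ge0 //.
    by rewrite lerXn2r ?nnegrE // ler_nat.
  by rewrite ler_nat energy_le // leq_mul2l aX orbT.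
rewrite big_split /=.
have -> : e * X%:R ^+ 2 = e / 2 * X%:R ^+ 2 + e / 2 * X%:R ^+ 2 by field.
apply: lerD.
  rewrite big_const_seq count_predT iter_addr_0 -[_ *+ size _]mulr_natl.
  have h : (size (nzball X))%:R <= 5 * X%:R :> R by rewrite -natrM ler_nat; exact: (size_nzball_le R).
  apply: le_trans (ler_wpM2r (ltW eX) h) _; rewrite /eta; lra.
rewrite -big_distrl /= -big_distrr -big_distrr /= -natr_sum.
rewrite ler_pdivrMr ?exprn_gt0 //.
have := hN X (ltnW hX); rewrite -(ler_pM2l (mulr_gt0 nm0 (exprn_gt0 2 X0))) => h.
rewrite mulrA; apply: le_trans h _; rewrite le_eqVlt; apply/orP; left; apply/eqP.
by move: (lt0r_neq0 nm0); move: ((nrm m)%:R : R) => y y0; field.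
Qed.

End kloosterman_bound.

(** * Equidistribution of the solutions of [a | b c + 1] *)

Section fourier_analysis.
Local Open Scope complex_scope.
Implicit Types (a m p t u v w z : gint) (A B S : seq gint).

(** Repetitions are kept: the list represents a convolution, whose transform is the product of the
    transforms. *)
Definition sumseq A B := [seq z + w | z <- A, w <- B].
Definition box (L : nat) := [seq Gint (Posz x) (Posz y) | x <- iota 0 L, y <- iota 0 L].
Definition incid a S S' : nat := (\sum_(z <- S) count (fun w => gdvd a (z * w + 1)%R) S')%N.

Lemma size_sumseq A B : size (sumseq A B) = (size A * size B)%N.
Proof. exact: size_allpairs. Qed.

Lemma size_box L : size (box L) = (L * L)%N.
Proof. by rewrite size_allpairs size_iota. Qed.

Lemma box_uniq L : uniq (box L).
Proof.
by apply: allpairs_uniq; rewrite ?iota_uniq // => -[x y] [x' y'] _ _ /= [-> ->].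
Qed.

Lemma nrm_box L z : z \in box L -> (nrm z <= 2 * L ^ 2)%N.
Proof.
move=> /allpairsP[[x y] /= [hx hy ->]]; rewrite /nrm /=.
move: hx hy; rewrite !mem_iota; nia.
Qed.

Lemma count_hyp a z w : a != 0 ->
  count (fun h : gint * gint => gdvd a (z - h.1) && gdvd a (w - h.2)) (hyp a)
    = gdvd a (z * w + 1).
Proof.
move=> a0; set h0 := (grem a z, grem a w).
have e x y : gdvd a (z - x) -> gdvd a (w - y) -> gdvd a (x * y + 1) = gdvd a (z * w + 1).
  move=> hx hy; rewrite !gdvd_eq in hx hy *.
  have : gdvd a (z * w + 1 - (x * y + 1)).
    rewrite -!gdvd_eq in hx hy.
    rewrite (_ : _ - _ = (z - x) * w + (w - y) * x); last by ring.
    exact: (gdvdD (gdvd_mulr _ hx) (gdvd_mulr _ hy)).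
  move=> hd; rewrite -[LHS]/(gdvd a (x * y + 1)) -[RHS]/(gdvd a (z * w + 1)).
  apply/idP/idP => h.
    rewrite -[z * w + 1](subrK (x * y + 1)); exact: (gdvdD hd h).
  rewrite (_ : x * y + 1 = (z * w + 1) - (z * w + 1 - (x * y + 1))); last by ring.
  exact: (gdvdB h hd).
have hh h : h \in hyp a -> (gdvd a (z - h.1) && gdvd a (w - h.2)) = (h == h0).
  case/mem_hypP => hx hy _; rewrite !gdvd_eq.
  move: hx hy; rewrite !mem_Rs // => /eqP hx /eqP hy.
  by rewrite hx hy [RHS](_ : _ = ((h.1 == grem a z) && (h.2 == grem a w))) ?[_ == h.1]eq_sym ?[_ == h.2]eq_sym //; case: (h).
rewrite (eq_in_count hh) count_uniq_mem ?hyp_uniq //; congr (nat_of_bool _).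
have gz x : gdvd a (x - grem a x) by rewrite gdvd_eq grem_id.
rewrite -(e _ _ (gz z) (gz w)).
by apply/mem_hypP/idP => [[]|] //; split => //; apply: mem_grem.
Qed.

Lemma count_hyp_snd a w : a != 0 ->
  count (fun h : gint * gint => gdvd a (w - h.2)) (hyp a) = cop a w.
Proof.
move=> a0; rewrite /cop; have gw : gdvd a (w - grem a w) by rewrite gdvd_eq grem_id.
case: (boolP (has _ _)) => [/hasP[x hx hd]|/hasPn nx].
  have hin : (x, grem a w) \in hyp a.
    apply/mem_hypP; split; rewrite /= ?mem_grem //.
    rewrite (_ : _ + 1 = (w * x + 1) - (w - grem a w) * x); last by ring.
    exact: (gdvdB hd (gdvd_mulr _ gw)).
  rewrite (@eq_in_count _ _ (pred1 (x, grem a w))) ?count_uniq_mem ?hyp_uniq ?hin //.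
  move=> h hh /=; apply/idP/eqP => [hd2|-> //].
  apply: (hyp_snd_inj a0 hh hin); apply: (Rs_inj a0).
  - by case/mem_hypP: hh.
  - exact: mem_grem.
  - rewrite /= (_ : _ - _ = (w - grem a w) - (w - h.2)); last by ring.
    exact: (gdvdB gw hd2).
rewrite (@eq_in_count _ _ pred0) ?count_pred0 // => h hh /=; apply/negP => hd.
case/mem_hypP: hh => hx _ h1; apply: (negP (nx _ hx)).
rewrite (_ : _ + 1 = (h.1 * h.2 + 1) + (w - h.2) * h.1); last by ring.
exact: (gdvdD h1 (gdvd_mulr _ hd)).
Qed.

Section fourier.
Variable R : realType.
Local Notation nm := (@Normc.normc R).

Definition hat a S m : R[i] := \sum_(z <- S) psi R a (m * z).

Lemma hat_sumseq a A B m : hat a (sumseq A B) m = hat a A m * hat a B m.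
Proof.
rewrite /hat big_allpairs_dep big_distrl /=; apply: eq_bigr => z _.
by rewrite big_distrr /=; apply: eq_bigr => w _; rewrite mulrDr psiD.
Qed.

Lemma hat_le a S m : nm (hat a S m) <= (size S)%:R.
Proof.
apply: le_trans (normc_sum _ _) _; under eq_bigr do rewrite normc_psi.
by rewrite big_const_seq count_predT iter_addr_0.
Qed.

Lemma hat0 a S : hat a S 0 = (size S)%:R.
Proof.
rewrite /hat (eq_bigr (fun=> 1)) => [|z _]; last by rewrite mul0r psi0.
by rewrite big_const_seq count_predT iter_addr_0.
Qed.

Lemma psi_expn a m (x : nat) : psi R a (m * x%:R) = psi R a m ^+ x.
Proof.
elim: x => [|x IH]; first by rewrite mulr0 psi0.
by rewrite -natr1 mulrDr mulr1 psiD IH exprSr.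
Qed.

Lemma gint_nat (x y : nat) : Gint (Posz x) (Posz y) = x%:R + gI * y%:R.
Proof.
have e : forall k : nat, k%:R = Gint (Posz k) 0.
  by elim=> [|k IH] //; rewrite -natr1 IH; apply: gintP; rewrite !gE //= -PoszD addn1.
by rewrite !e; apply: gintP; rewrite !gE /=; ring.
Qed.

Lemma hat_box a m L : hat a (box L) m =
  (\sum_(0 <= x < L) psi R a m ^+ x) * (\sum_(0 <= y < L) psi R a (m * gI) ^+ y).
Proof.
rewrite /hat big_allpairs_dep /= /index_iota subn0 big_distrl /=; apply: eq_bigr => x _.
rewrite big_distrr /=; apply: eq_bigr => y _.
by rewrite gint_nat mulrDr psiD psi_expn mulrA psi_expn.
Qed.

Lemma nm_geom (t : R[i]) L : nm t = 1 ->
  nm (\sum_(0 <= x < L) t ^+ x) <= L%:R /\ nm (1 - t) * nm (\sum_(0 <= x < L) t ^+ x) <= 2.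
Proof.
move=> t1; have tx x : nm (t ^+ x) = 1.
  by elim: x => [|x IH]; [rewrite expr0 Normc.normc1|rewrite exprS Normc.normcM t1 IH mulr1].
split.
  apply: le_trans (normc_sum _ _) _; under eq_bigr do rewrite tx.
  by rewrite big_const_nat subn0 iter_addr_0.
rewrite -Normc.normcM big_mkord.
have -> : (1 - t) * (\sum_(i < L) t ^+ i) = 1 - t ^+ L.
  by rewrite -opprB mulNr -subrX1 opprB.
apply: le_trans (le_normcD _ _) _.
by rewrite normcN Normc.normc1 tx.
Qed.

(** The transform of a box factors into geometric sums in the directions 1 and [gI]; either of them
    can be bounded through its ratio, the other one by [L]. *)
Lemma hat_box_le a m L :
  nm (1 - psi R a m) * nm (hat a (box L) m) <= 2 * L%:R /\
  nm (1 - psi R a (m * gI)) * nm (hat a (box L) m) <= 2 * L%:R.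
Proof.
rewrite hat_box Normc.normcM.
have [h1 h2] := nm_geom L (normc_psi R a m).
have [h3 h4] := nm_geom L (normc_psi R a (m * gI)).
split; first by rewrite mulrA ler_pM // ?mulr_ge0 ?normc_ge0.
by rewrite mulrCA mulrC ler_pM // ?mulr_ge0 ?normc_ge0.
Qed.

(** A class modulo [a] meets [S] in at most [size (ball 8) <= 33] points, since differences have
    norm at most [8 nrm a]; together with [size S <= 9 nrm a] this gives the factor 297. *)
Lemma parseval a S : a != 0 -> uniq S -> {in S, forall z, (nrm z <= 2 * nrm a)%N} ->
  \sum_(m <- Rs a) nm (hat a S m) ^+ 2 <= 300 * (nrm a)%:R ^+ 2.
Proof.
move=> a0 uS hS; have n0 : (0 < nrm a)%N by rewrite nrm_gt0.
have -> : \sum_(m <- Rs a) nm (hat a S m) ^+ 2 =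
    \sum_(z <- S) \sum_(w <- S) (if gdvd a (z - w) then (nrm a)%:R else 0 : R).
  apply: complexI; rewrite rmorph_sum /=.
  transitivity (\sum_(m <- Rs a) \sum_(z <- S) \sum_(w <- S) psi R a (m * (z - w))).
    apply: eq_bigr => m _; rewrite normc_sqrE /hat rmorph_sum /= big_distrl /=.
    apply: eq_bigr => z _; rewrite big_distrr /=; apply: eq_bigr => w _.
    rewrite mulrBr psiD; congr (_ * _); symmetry; exact: psiN.
  rewrite exchange_big /= rmorph_sum; apply: eq_bigr => z _.
  rewrite exchange_big /= rmorph_sum; apply: eq_bigr => w _.
  rewrite sum_psi //; case: ifP => _; last by rewrite rmorph0.
  by rewrite rmorph_nat.
have h z : z \in S -> (count (fun w => gdvd a (z - w)%R) S <= 33)%N.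
  move=> zS; apply: (@leq_trans (size (ball 8))); last exact: (@size_ball_le R 8).
  rewrite -size_filter.
  rewrite -(size_map (fun t => z - a * t) (ball 8)).
  apply: uniq_leq_size; first exact: filter_uniq.
  move=> w; rewrite mem_filter => /andP[/gdvdP[t ht] wS]; apply/mapP; exists t.
    have := nrmD_le z (- w); rewrite nrmN ht nrmM mem_ball => h1.
    have h2 := hS _ zS; have h3 := hS _ wS.
    rewrite -(leq_pmul2l n0); apply: leq_trans h1 _.
    move: h2 h3; clear; lia.
  by rewrite -ht; ring.
have sS : (size S <= 9 * nrm a)%N.
  apply: (@leq_trans (size (ball (2 * nrm a)))).
    by apply: uniq_leq_size => // z /hS; rewrite mem_ball.
  apply: leq_trans (@size_ball_le R _) _; move: n0; clear; lia.
apply: (@le_trans _ _ (\sum_(z <- S) (33 * (nrm a)%:R))).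
  rewrite big_seq [leRHS]big_seq; apply: ler_sum => z zS.
  rewrite -big_mkcond /= big_const_seq iter_addr_0 -[_ *+ count _ _]mulr_natl ler_wpM2r //.
  by rewrite (ler_nat _ _ 33) h.
rewrite big_const_seq count_predT iter_addr_0 -[_ *+ size S]mulr_natl mulrA.
have h2 : (size S)%:R <= 9 * (nrm a)%:R :> R by rewrite -natrM ler_nat.
rewrite expr2 mulrA ler_wpM2r //.
by apply: le_trans (ler_wpM2r _ h2) _; rewrite //; move: ((nrm a)%:R : R) (ler0n R (nrm a)) => y y0; lra.
Qed.

Lemma sum_hat_le a S S' : a != 0 -> uniq S -> {in S, forall z, (nrm z <= 2 * nrm a)%N} ->
  uniq S' -> {in S', forall z, (nrm z <= 2 * nrm a)%N} ->
  \sum_(m <- Rs a) nm (hat a S m) * nm (hat a S' m) <= 300 * (nrm a)%:R ^+ 2.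
Proof.
move=> a0 u h u' h'; have p := parseval a0 u h; have p' := parseval a0 u' h'.
apply: (@le_trans _ _ (\sum_(m <- Rs a) (nm (hat a S m) ^+ 2 / 2 + nm (hat a S' m) ^+ 2 / 2))).
  apply: ler_sum => m _; have := sqr_ge0 (nm (hat a S m) - nm (hat a S' m)); nra.
rewrite big_split -!big_distrl /=; lra.
Qed.

(** Frequency 0 is split off in the first variable alone. With all [m'] kept, it counts the [w] that
    have some partner modulo [a], that is, those prime to [a], without error. *)
Lemma incid_fourier a S S' : a != 0 ->
  (nrm a)%:R ^+ 2 * (incid a S S')%:R - (nrm a)%:R * (size S)%:R * (count (cop a) S')%:R
  = \sum_(m <- Rs a | m != 0) \sum_(m' <- Rs a) hat a S m * hat a S' m' * kl R a (- m) (- m').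
Proof.
move=> a0; set n : R[i] := (nrm a)%:R.
pose F m := \sum_(m' <- Rs a) hat a S m * hat a S' m' * kl R a (- m) (- m').
have inner m : F m = hat a S m * n *
    \sum_(w <- S') \sum_(h <- hyp a | gdvd a (w - h.2)) psi R a (- m * h.1).
  rewrite /F; under eq_bigr do rewrite -mulrA; rewrite -mulr_sumr -mulrA; congr (_ * _).
  transitivity (\sum_(m' <- Rs a) \sum_(w <- S') \sum_(h <- hyp a)
      psi R a (- m * h.1) * psi R a (m' * (w - h.2))).
    apply: eq_bigr => m' _; rewrite /hat /kl big_distrl /=; apply: eq_bigr => w _.
    rewrite big_distrr /=; apply: eq_bigr => h _.
    by rewrite psiD mulrCA; congr (_ * _); rewrite -psiD; congr (psi R a _); ring.
  rewrite exchange_big /= big_distrr /=; apply: eq_bigr => w _.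
  rewrite exchange_big /= big_distrr [RHS]big_mkcond /=; apply: eq_bigr => h _.
  by rewrite -mulr_sumr sum_psi //; case: ifP => _; rewrite ?mulr0 // mulrC.
have r0 : 0 \in Rs a.
  by rewrite mem_Rs // grem0.
have tot : \sum_(m <- Rs a) F m = n ^+ 2 * (incid a S S')%:R.
  transitivity (n * \sum_(z <- S) \sum_(w <- S') \sum_(h <- hyp a | gdvd a (w - h.2))
     \sum_(m <- Rs a) psi R a (m * (z - h.1))).
    transitivity (\sum_(m <- Rs a) n * \sum_(z <- S) \sum_(w <- S')
       \sum_(h <- hyp a | gdvd a (w - h.2)) psi R a (m * (z - h.1))).
      apply: eq_bigr => m _; rewrite inner mulrAC [_ * n]mulrC; congr (_ * _).
      rewrite /hat big_distrl /=; apply: eq_bigr => z _.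
      rewrite big_distrr /=; apply: eq_bigr => w _.
      rewrite big_distrr /=; apply: eq_bigr => h _.
      by rewrite -psiD; congr (psi R a _); ring.
    rewrite -mulr_sumr; congr (_ * _); rewrite exchange_big; apply: eq_bigr => z _ /=.
    rewrite exchange_big; apply: eq_bigr => w _ /=.
    by rewrite exchange_big.
  rewrite expr2 -mulrA; congr (_ * _); rewrite /incid natr_sum mulr_sumr.
  apply: eq_bigr => z _.
  rewrite -sum1_count natr_sum mulr_sumr [RHS]big_mkcond /=; apply: eq_bigr => w _.
  rewrite big_mkcond /=.
  transitivity (\sum_(h <- hyp a | gdvd a (z - h.1) && gdvd a (w - h.2)) n).
    rewrite [RHS]big_mkcond /=; apply: eq_bigr => h _; rewrite sum_psi // andbC.
    by case: (gdvd a (w - h.2)).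
  rewrite big_const_seq iter_addr_0 count_hyp //.
  by case: (gdvd a _); rewrite ?mulr1n ?mulr0n ?mulr1.
have zero : F 0 = n * (size S)%:R * (count (cop a) S')%:R.
  rewrite inner hat0 [n * _]mulrC; congr (_ * _).
  rewrite -sum1_count natr_sum [RHS]big_mkcond; apply: eq_bigr => w _ /=.
  rewrite (eq_bigr (fun=> 1)) => [|h _]; last by rewrite oppr0 mul0r psi0.
  rewrite big_const_seq iter_addr_0 count_hyp_snd //.
  by case: (cop a w).
rewrite -tot -zero (bigD1_seq 0) ?Rs_uniq //= [X in X - _]addrC addrK.
by apply: eq_bigl => m.
Qed.


Lemma normc_real (x : R) : nm x%:C = `|x|.
Proof. by rewrite /= expr0n addr0 sqrtr_sqr. Qed.

Section error_term.
(** [T] is the threshold between large and small frequencies, [M] bounds the norms of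
    representatives of the small ones, [kappa] is the saving of the box transform at the large ones,
    and [bnd] majorizes the Kloosterman sums at the small ones. *)
Variables (a : gint) (L M : nat) (I J : seq gint) (kappa T : R) (bnd : gint -> R).
Hypothesis a0 : a != 0.
Hypothesis L0 : (0 < L)%N.
Hypothesis Ln : (L ^ 2 <= nrm a)%N.
Hypothesis uI : uniq I.
Hypothesis hI : {in I, forall z, (nrm z <= 2 * nrm a)%N}.
Hypothesis uJ : uniq J.
Hypothesis hJ : {in J, forall z, (nrm z <= 2 * nrm a)%N}.
Hypothesis kappa0 : 0 <= kappa.
Hypothesis T0 : 0 < T.
Hypothesis hT : 4 * (nrm a)%:R <= kappa ^+ 2 * L%:R ^+ 2 * T.
Hypothesis hM : 2 * T <= M%:R.
Hypothesis bnd0 : forall m, 0 <= bnd m.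
Hypothesis hbnd : forall m m', m \in nzball M -> nm (kl R a m m') <= bnd m.
Local Notation n := ((nrm a)%:R : R).
Local Notation B := (box L).

Lemma box_good : {in B, forall z, (nrm z <= 2 * nrm a)%N}.
Proof. by move=> z /nrm_box h; apply: leq_trans h _; rewrite leq_mul2l Ln. Qed.

Let weight m : R := \sum_(m0 <- nzball M | grem a (- m0) == m) bnd m0.

Let weight0 m : 0 <= weight m.
Proof. by apply: sumr_ge0. Qed.

Let sum_weight : \sum_(m <- Rs a) weight m = \sum_(m0 <- nzball M) bnd m0.
Proof.
rewrite /weight; under eq_bigr do rewrite big_mkcond /=.
rewrite exchange_big /=; apply: eq_bigr => m0 _.
rewrite -big_mkcond /= big_const_seq iter_addr_0.
rewrite (eq_count (a2 := pred1 (grem a (- m0)))) => [|x]; last by rewrite /= eq_sym.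
by rewrite count_uniq_mem ?Rs_uniq // mem_grem.
Qed.

Lemma hat_box_large m (s : R) : T < s ^+ 2 * n -> 0 <= s ->
  s * nm (hat a B m) <= 2 * L%:R -> nm (hat a B m) <= kappa * L%:R ^+ 2.
Proof.
move=> h1 s0 h2; have k0 : 0 <= nm (hat a B m) by apply: normc_ge0.
move: (nm _) k0 h2 => k k0 h2.
have L1 : 0 < L%:R :> R by rewrite ltr0n.
rewrite -(ler_pXn2r (ltn0Sn 1)) ?nnegrE ?mulr_ge0 ?exprn_ge0 ?(ltW L1) //.
rewrite -(ler_pM2r T0).
apply: (@le_trans _ _ ((s * k) ^+ 2 * n)).
  by rewrite exprMn [s ^+ 2 * _]mulrC -[leRHS]mulrA ler_wpM2l ?sqr_ge0 // ltW.
apply: (@le_trans _ _ ((2 * L%:R) ^+ 2 * n)).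
  by rewrite ler_wpM2r // lerXn2r ?nnegrE ?mulr_ge0 // ltW.
have -> : (2 * L%:R) ^+ 2 * n = L%:R ^+ 2 * (4 * n) by ring.
have -> : (kappa * L%:R ^+ 2) ^+ 2 * T = L%:R ^+ 2 * (kappa ^+ 2 * L%:R ^+ 2 * T) by ring.
by rewrite ler_wpM2l ?sqr_ge0.
Qed.

(* For a large frequency [m] the transform of the box is small; the small ones
   are congruent to one of finitely many nonzero [m0], independent of [a]. *)
Lemma box_or_kl m m' : m \in Rs a -> m != 0 ->
  nm (hat a B m) * nm (kl R a (- m) m') <= kappa * L%:R ^+ 2 * n \/
  nm (kl R a (- m) m') <= weight m.
Proof.
move=> mR m0; have [h|/negP h] := boolP [&& nm (1 - psi R a m) ^+ 2 * n <= T &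
    nm (1 - psi R a (m * gI)) ^+ 2 * n <= T]; last first.
  left; apply: ler_pM; rewrite ?normc_ge0 //; last first.
    by apply: le_trans (kl_le _ _ _ _) _; rewrite ler_nat size_hyp_le.
  have [h1 h2] := hat_box_le a m L.
  move/negP: h; rewrite negb_and -!ltNge => /orP[h|h].
    by apply: hat_box_large h _ h1; apply: normc_ge0.
  by apply: hat_box_large h _ h2; apply: normc_ge0.
right; have /andP[h1 h2] := h; have [m1 hd hm] := psi_small a0 h1 h2.
have e : kl R a (- m) m' = kl R a (- m1) m'.
  apply: kl_eqm => //; last by rewrite subrr gdvd0.
  rewrite (_ : _ - _ = 0 - (m - m1)); last by ring.
  exact: (gdvdB (gdvd0 a) hd).
have m1in : - m1 \in nzball M.
  rewrite mem_nzball nrmN; apply/andP; split; last first.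
    by rewrite -(ler_nat R) (le_trans hm).
  rewrite lt0n nrm_eq0; apply/eqP => m10; move: hd; rewrite m10 subr0 /gdvd.
  by move: mR; rewrite mem_Rs // => /eqP ->; apply/negP.
rewrite e; apply: le_trans (hbnd m' m1in) _.
rewrite /weight big_mkcond (bigD1_seq (- m1)) ?nzball_uniq //= opprK.
move: hd; rewrite gdvd_eq; move: mR; rewrite mem_Rs // => /eqP -> /eqP <-.
by rewrite eqxx lerDl sumr_ge0 // => x _; case: ifP.
Qed.

(** The first variable carries two boxes. One is paired with [I], as the box of the second variable
    is with [J], so that Parseval bounds both frequency sums by [300 n ^ 2]; the other one enters
    [box_or_kl]. In the alternative with [weight], the transforms are bounded trivially by [9 n] and
    [L ^ 2]. *)
Lemma incid_error :
  `| (incid a (sumseq (sumseq I B) B) (sumseq J B))%:R -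
     (size I)%:R * L%:R ^+ 4 / n * (count (cop a) (sumseq J B))%:R |
  <= 300 ^+ 2 * kappa * L%:R ^+ 2 * n ^+ 3 +
     9 * 300 * n * L%:R ^+ 4 * \sum_(m <- nzball M) bnd m.
Proof.
have n0 : 0 < n by rewrite ltr0n nrm_gt0.
set S := sumseq (sumseq I B) B; set S' := sumseq J B.
set Q := (incid a S S')%:R : R; set P := (count (cop a) S')%:R : R.
rewrite -(ler_pM2l (exprn_gt0 2 n0)).
have -> : n ^+ 2 * `|Q - (size I)%:R * L%:R ^+ 4 / n * P| =
    nm ((nrm a)%:R ^+ 2 * (incid a S S')%:R - (nrm a)%:R * (size S)%:R * (count (cop a) S')%:R).
  rewrite -[n ^+ 2]ger0_norm ?sqr_ge0 // -normrM.
  have -> : n ^+ 2 * (Q - (size I)%:R * L%:R ^+ 4 / n * P) =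
      n ^+ 2 * Q - n * (size S)%:R * P.
    rewrite /S !size_sumseq size_box !natrM; move: (lt0r_neq0 n0).
    move: (n) (Q) (P) (L%:R : R) ((size I)%:R : R) => x q p l s x0; field; exact: x0.
  rewrite -normc_real; congr (nm _).
  by rewrite rmorphB !rmorphM /= !rmorph_nat.
rewrite incid_fourier //.
pose H m := nm (hat a I m) * nm (hat a B m).
pose H' m := nm (hat a J m) * nm (hat a B m).
have H0 m : 0 <= H m by rewrite mulr_ge0 ?normc_ge0.
have H'0 m : 0 <= H' m by rewrite mulr_ge0 ?normc_ge0.
pose U : R := kappa * L%:R ^+ 2 * n; pose V : R := 9 * n * L%:R ^+ 4.
have U0 : 0 <= U by rewrite !mulr_ge0 ?exprn_ge0.
have V0 : 0 <= V by rewrite !mulr_ge0 ?exprn_ge0.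
have sI : (size I <= 9 * nrm a)%N.
  apply: (@leq_trans (size (ball (2 * nrm a)))).
    by apply: uniq_leq_size => // z /hI; rewrite mem_ball.
  apply: leq_trans (@size_ball_le R _) _.
  have : (0 < nrm a)%N by rewrite nrm_gt0.
  clear; lia.
have bB m : nm (hat a B m) <= L%:R ^+ 2.
  by apply: le_trans (hat_le _ _ _) _; rewrite size_box natrM expr2.
apply: (@le_trans _ _ (\sum_(m <- Rs a) \sum_(m' <- Rs a) (H m * U + V * weight m) * H' m')).
  rewrite big_mkcond; apply: le_trans (normc_sum _ _) _.
  rewrite big_seq [leRHS]big_seq; apply: ler_sum => m mR.
  case: ifPn => m0; last first.
    by rewrite Normc.normc0 sumr_ge0 // => m' _; rewrite mulr_ge0 // addr_ge0 // mulr_ge0.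
  apply: le_trans (normc_sum _ _) _; apply: ler_sum => m' _.
  rewrite /S /S' !hat_sumseq !Normc.normcM.
  have -> : nm (hat a I m) * nm (hat a B m) * nm (hat a B m) *
       (nm (hat a J m') * nm (hat a B m')) * nm (kl R a (- m) (- m')) =
     H m * (nm (hat a B m) * nm (kl R a (- m) (- m'))) * H' m' by rewrite /H /H'; ring.
  rewrite ler_wpM2r //.
  have [h|h] := box_or_kl (- m') mR m0.
    apply: (@le_trans _ _ (H m * U)); first by rewrite ler_wpM2l.
    by rewrite lerDl mulr_ge0.
  apply: (@le_trans _ _ (V * weight m)); last by rewrite lerDr mulr_ge0.
  rewrite mulrA ler_pM ?mulr_ge0 ?normc_ge0 // /H /V.
  rewrite -mulrA (_ : 4%N = (2 + 2)%N) // exprD.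
  rewrite ler_pM ?mulr_ge0 ?normc_ge0 //; last by rewrite ler_pM ?normc_ge0.
  by apply: le_trans (hat_le _ _ _) _; rewrite -natrM ler_nat.
have -> : \sum_(m <- Rs a) \sum_(m' <- Rs a) (H m * U + V * weight m) * H' m' =
   (U * (\sum_(m <- Rs a) H m) + V * \sum_(m <- nzball M) bnd m) * \sum_(m <- Rs a) H' m.
  rewrite -sum_weight -big_distrlr /= big_split /= -big_distrl -big_distrr /=.
  by rewrite [U * _]mulrC.
have hs : \sum_(m <- Rs a) H m <= 300 * n ^+ 2.
  exact: (sum_hat_le a0 uI hI (box_uniq L) box_good).
have hs' : \sum_(m <- Rs a) H' m <= 300 * n ^+ 2.
  exact: (sum_hat_le a0 uJ hJ (box_uniq L) box_good).
have b0 : 0 <= \sum_(m <- nzball M) bnd m by apply: sumr_ge0.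
apply: (@le_trans _ _ ((U * (300 * n ^+ 2) + V * \sum_(m <- nzball M) bnd m) * (300 * n ^+ 2))).
  rewrite ler_pM ?sumr_ge0 ?addr_ge0 ?mulr_ge0 ?sumr_ge0 //.
  by rewrite lerD2r ler_wpM2l.
by rewrite /U /V le_eqVlt; apply/orP; left; apply/eqP; ring.
Qed.

End error_term.
End fourier.

End fourier_analysis.

(** * Removing the smoothing *)

Section smoothing.
Local Open Scope complex_scope.
Implicit Types (a m p t u v w z : gint) (A B S I J : seq gint).

Lemma leq_sum_uniq_sub (T : eqType) (s t : seq T) (F : T -> nat) :
  uniq s -> {subset s <= t} -> (\sum_(x <- s) F x <= \sum_(x <- t) F x)%N.
Proof.
elim: s t => [|x s IH] t /=; first by rewrite big_nil.
move=> /andP[xs us] st; have xt : x \in t by apply: st; rewrite inE eqxx.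
rewrite big_cons (perm_big _ (perm_to_rem xt)) big_cons leq_add2l; apply: IH => // y ys.
have : y \in x :: rem x t by rewrite -(perm_mem (perm_to_rem xt)); apply: st; rewrite inE ys orbT.
by rewrite inE => /orP[/eqP yx|//]; rewrite -yx ys in xs.
Qed.

Lemma sumseq_le I I' B (F : gint -> nat) : uniq I ->
  (forall z w, z \in I -> w \in B -> z + w \in I') ->
  (\sum_(x <- sumseq I B) F x <= size B * \sum_(x <- I') F x)%N.
Proof.
move=> uI h; rewrite big_allpairs_dep exchange_big /= -sum1_size big_distrl /=.
rewrite big_seq [leqRHS]big_seq; apply: leq_sum => w wB; rewrite mul1n.
rewrite -(big_map (fun z => z + w) xpredT F); apply: leq_sum_uniq_sub.
  by rewrite map_inj_uniq // => x y /addIr.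
by move=> _ /mapP[z zI ->]; apply: h.
Qed.

Lemma sumseq_ge I I' B (F : gint -> nat) : uniq I ->
  (forall z w, z \in I -> w \in B -> z - w \in I') ->
  (size B * \sum_(x <- I) F x <= \sum_(x <- sumseq I' B) F x)%N.
Proof.
move=> uI h; rewrite big_allpairs_dep exchange_big /= -sum1_size big_distrl /=.
rewrite big_seq [leqRHS]big_seq; apply: leq_sum => w wB; rewrite mul1n.
rewrite -(big_map (fun z => z + w) xpredT F); apply: leq_sum_uniq_sub => //.
move=> x xI; apply/mapP; exists (x - w); first exact: h.
by rewrite subrK.
Qed.

Lemma sum_sumseqA I A B (F : gint -> nat) :
  (\sum_(x <- sumseq (sumseq I A) B) F x = \sum_(x <- sumseq I (sumseq A B)) F x)%N.
Proof.
rewrite !big_allpairs_dep; apply: eq_bigr => z _; rewrite big_allpairs_dep.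
by apply: eq_bigr => s _; apply: eq_bigr => s' _; rewrite addrA.
Qed.

Lemma count_sum (T : Type) (s : seq T) (P : pred T) : count P s = (\sum_(x <- s) P x)%N.
Proof. by rewrite -sum1_count big_mkcond /=; apply: eq_bigr => x _; case: (P x). Qed.

(** For fixed shifts from the three boxes, translation embeds the smoothed configuration into the
    larger sets; [size B ^ 3] counts the shifts. *)
Lemma incid_sumseq_le a I I' J J' B : uniq I -> uniq J ->
  (forall z w, z \in I -> w \in sumseq B B -> z + w \in I') ->
  (forall z w, z \in J -> w \in B -> z + w \in J') ->
  (incid a (sumseq (sumseq I B) B) (sumseq J B) <= size B ^ 3 * incid a I' J')%N.
Proof.
move=> uI uJ hI hJ; rewrite /incid sum_sumseqA.
apply: leq_trans (sumseq_le _ uI hI) _.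
rewrite size_sumseq !expnS expn0 muln1 -!mulnA !leq_mul2l.
apply/orP; right; apply/orP; right; rewrite big_distrr /=; apply: leq_sum => z _.
rewrite !count_sum; exact: sumseq_le.
Qed.

Lemma incid_sumseq_ge a I I' J J' B : uniq I -> uniq J ->
  (forall z w, z \in I -> w \in sumseq B B -> z - w \in I') ->
  (forall z w, z \in J -> w \in B -> z - w \in J') ->
  (size B ^ 3 * incid a I J <= incid a (sumseq (sumseq I' B) B) (sumseq J' B))%N.
Proof.
move=> uI uJ hI hJ; rewrite /incid sum_sumseqA.
apply: leq_trans (sumseq_ge _ uI hI).
rewrite size_sumseq !expnS expn0 muln1 -!mulnA !leq_mul2l.
apply/orP; right; apply/orP; right; rewrite big_distrr /=; apply: leq_sum => z _.
rewrite !count_sum; exact: sumseq_ge.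
Qed.

(** With [q = 16 k], the cross term is split by [4 q Re(z conj w) <= 4 |z| ^ 2 + q ^ 2 |w| ^ 2].
    After multiplication by 16 the three errors are [8 n], [4 n] and [4 n], in total [16 n]. *)
Lemma nrm_shift k L n z w : ((16 * k * L) ^ 2 <= n)%N -> (0 < k)%N -> (nrm z <= 2 * n)%N ->
  (nrm w <= 8 * L ^ 2)%N -> (k * nrm (z + w)%R <= k * nrm z + n)%N.
Proof.
move=> hn k0 hz hw; set q := (16 * k)%N in hn.
have h1 : (q ^ 2 * nrm w <= 8 * n)%N.
  apply: leq_trans (leq_mul (leqnn _) hw) _; move: hn; rewrite expnMn; clear; nia.
have h2 : (q * nrm w <= 8 * n)%N.
  apply: leq_trans h1; rewrite leq_mul2r; apply/orP; right; rewrite /q; nia.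
have h3 : (nrm (z + w)%R)%:Z = (nrm z)%:Z + (nrm w)%:Z + 2 * (gre z * gre w + gim z * gim w).
  by rewrite !nrmE greD gimD; ring.
have h4 : 4 * q%:Z * (gre z * gre w + gim z * gim w) <= 4 * (nrm z)%:Z + q%:Z ^+ 2 * (nrm w)%:Z.
  have := addr_ge0 (sqr_ge0 (2 * gre z - q%:Z * gre w)) (sqr_ge0 (2 * gim z - q%:Z * gim w)).
  rewrite !nrmE; lra.
rewrite -(leq_pmul2l (isT : (0 < 16)%N)) -lez_nat.
have e : (16 * (k * nrm (z + w)%R))%N%:Z = q%:Z * ((nrm z)%:Z + (nrm w)%:Z + 2 * (gre z * gre w + gim z * gim w)).
  by rewrite mulnA -/q PoszM h3.
have e' : (16 * (k * nrm z + n))%N%:Z = q%:Z * (nrm z)%:Z + 16 * n%:Z.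
  by rewrite mulnDr mulnA -/q PoszD !PoszM.
rewrite e e'.
have h1' : q%:Z ^+ 2 * (nrm w)%:Z <= 8 * n%:Z by rewrite expr2 -!PoszM lez_nat mulnn.
have h2' : q%:Z * (nrm w)%:Z <= 8 * n%:Z by rewrite -!PoszM lez_nat.
have hz' : (nrm z)%:Z <= 2 * n%:Z by rewrite -PoszM lez_nat.
lra.
Qed.

Lemma ball_shift i k L n z w : ((16 * k * L) ^ 2 <= n)%N -> (0 < k)%N -> (i <= 2 * k)%N ->
  (nrm w <= 8 * L ^ 2)%N -> z \in ball (i * n %/ k) -> z + w \in ball (i.+1 * n %/ k).
Proof.
move=> hn k0 ik hw; rewrite !mem_ball !leq_divRL // => hz.
have h2 : (nrm z <= 2 * n)%N.
  rewrite -(leq_pmul2r k0); apply: leq_trans hz _; move: ik; clear; nia.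
have := nrm_shift hn k0 h2 hw; move: hz; clear; nia.
Qed.

Lemma nrm_box2 L w : w \in sumseq (box L) (box L) -> (nrm w <= 8 * L ^ 2)%N.
Proof.
move=> /allpairsP[[x y] /= [/nrm_box hx /nrm_box hy ->]].
apply: leq_trans (nrmD_le _ _) _; move: hx hy; clear; nia.
Qed.

Lemma nrm_box1 L w : w \in box L -> (nrm w <= 8 * L ^ 2)%N.
Proof. by move=> /nrm_box h; apply: leq_trans h _; rewrite leq_mul2r orbT. Qed.

Lemma exists_scale q n : (0 < q)%N -> (q ^ 2 <= n)%N ->
  exists L, [/\ (0 < L)%N, ((q * L) ^ 2 <= n)%N & (n <= 4 * (q * L) ^ 2)%N].
Proof.
move=> q0 qn; have ex : exists L, ((q * L) ^ 2 <= n)%N by exists 1%N; rewrite muln1.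
have bd L : ((q * L) ^ 2 <= n)%N -> (L <= n)%N.
  move=> h; apply: leq_trans h; rewrite expnMn; nia.
case: (ex_maxnP ex bd) => L hL mL; exists L.
have L1 : (0 < L)%N by apply: mL; rewrite muln1.
split => //.
rewrite leqNgt; apply/negP => h; suff : (L.+1 <= L)%N by rewrite ltnn.
apply: mL; apply: leq_trans (ltnW h); rewrite !expnMn.
have : (L.+1 <= 2 * L)%N by lia.
rewrite -(@leq_exp2r _ _ 2) // => h2; rewrite mulnCA leq_mul2l; apply/orP; right.
by move: h2; rewrite expnMn.
Qed.

Definition sect i k a := ball (i * nrm a %/ k).
Definition copcount j k a := count (cop a) (sect j k a).
Definition incidences i j k a := incid a (sect i k a) (sect j k a).

Section sections.
Variable R : realType.
Local Notation nm := (@Normc.normc R).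

(* The constant [16] makes a shift by two elements of a box of side [L], with
   [(16 * k * L) ^ 2 <= nrm a], change norms by at most [nrm a / k]. *)
Lemma incidences_bounds i j k M a (kappa : R) (bnd : gint -> R) :
  (0 < k)%N -> (i < 2 * k)%N -> (j < 2 * k)%N -> ((16 * k) ^ 2 <= nrm a)%N ->
  0 < kappa -> 32 * (16 * k)%:R ^+ 2 <= kappa ^+ 2 * M%:R ->
  (forall m, 0 <= bnd m) ->
  (forall m m', m \in nzball M -> nm (kl R a m m') <= bnd m) ->
  let E := 300 ^+ 2 * 16 * (16 * k)%:R ^+ 4 * kappa * (nrm a)%:R +
           9 * 300 * 4 * (16 * k)%:R ^+ 2 * \sum_(m <- nzball M) bnd m in
  (incidences i j k a)%:R <=
    (size (sect i.+1 k a))%:R / (nrm a)%:R * (copcount j.+2 k a)%:R + E /\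
  (size (sect i k a))%:R / (nrm a)%:R * (copcount j k a)%:R <=
    (incidences i.+1 j.+2 k a)%:R + E.
Proof.
move=> k0 ik jk qn kappa0 hM bnd0 hbnd E.
have q0 : (0 < 16 * k)%N by rewrite muln_gt0.
have na0 : (0 < nrm a)%N by apply: leq_trans qn; rewrite expn_gt0 q0.
have a0 : a != 0 by rewrite -nrm_gt0.
have [L [L0 hL1 hL2]] := exists_scale q0 qn.
have LR : 0 < L%:R :> R by rewrite ltr0n.
have nR : 0 < (nrm a)%:R :> R by rewrite ltr0n.
have qR : 0 < (16 * k)%:R :> R by rewrite ltr0n.
have hL1R : (16 * k)%:R ^+ 2 * L%:R ^+ 2 <= (nrm a)%:R :> R by rewrite -exprMn -natrM -natrX ler_nat.
have hL2R : (nrm a)%:R <= 4 * ((16 * k)%:R ^+ 2 * L%:R ^+ 2) :> R.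
  by rewrite -exprMn -!natrM -natrX -natrM ler_nat.
have Ln : (L ^ 2 <= nrm a)%N.
  by apply: leq_trans hL1; rewrite leq_exp2r // leq_pmull.
(* Then [kappa ^ 2 L ^ 2 T = 16 (16 k L) ^ 2], which is at least [4 nrm a] by the choice of [L]. [T]
   does not depend on [a], so the range [M] of small frequencies can be fixed in advance. *)
pose T : R := 16 * (16 * k)%:R ^+ 2 / kappa ^+ 2.
have T0 : 0 < T by rewrite !divr_gt0 ?mulr_gt0 ?exprn_gt0.
have hT : 4 * (nrm a)%:R <= kappa ^+ 2 * L%:R ^+ 2 * T.
  have -> : kappa ^+ 2 * L%:R ^+ 2 * T = 16 * ((16 * k)%:R ^+ 2 * L%:R ^+ 2).
    rewrite /T; move: (lt0r_neq0 kappa0) ((16 * k)%:R : R) (L%:R : R).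
    by clear => h x y; field.
  by move: hL2R; move: (_ * L%:R ^+ 2) ((nrm a)%:R : R); clear => x y; lra.
have hM' : 2 * T <= M%:R.
  rewrite /T mulrA ler_pdivrMr ?exprn_gt0 // mulrC; rewrite mulrC [leRHS]mulrC.
  by apply: le_trans hM; rewrite mulrA -natrM.
have good x : (x <= 2 * k)%N -> {in sect x k a, forall z, (nrm z <= 2 * nrm a)%N}.
  move=> xk z; rewrite mem_ball leq_divRL // => h.
  rewrite -(leq_pmul2r k0); apply: leq_trans h _; move: xk; clear; nia.
have err x y : (x <= 2 * k)%N -> (y <= 2 * k)%N ->
  `|(incid a (sumseq (sumseq (sect x k a) (box L)) (box L)) (sumseq (sect y k a) (box L)))%:R
    - (size (sect x k a))%:R * L%:R ^+ 4 / (nrm a)%:R *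
      (count (cop a) (sumseq (sect y k a) (box L)))%:R| <= L%:R ^+ 6 * E.
  move=> xk yk.
  apply: le_trans (incid_error a0 L0 Ln (ball_uniq _) (good _ xk) (ball_uniq _) (good _ yk)
     (ltW kappa0) T0 hT hM' bnd0 hbnd) _.
  have b0 : 0 <= \sum_(m <- nzball M) bnd m by apply: sumr_ge0.
  rewrite /E [leRHS]mulrDr; apply: lerD.
    have h : (nrm a)%:R ^+ 2 <= 16 * ((16 * k)%:R ^+ 4 * L%:R ^+ 4) :> R.
      have -> : 16 * ((16 * k)%:R ^+ 4 * L%:R ^+ 4) = (4 * ((16 * k)%:R ^+ 2 * L%:R ^+ 2)) ^+ 2 :> R by ring.
      by rewrite lerXn2r ?nnegrE ?mulr_ge0 ?exprn_ge0 ?(ltW LR) ?(ltW qR) ?(ltW nR).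
    have -> : 300 ^+ 2 * kappa * L%:R ^+ 2 * (nrm a)%:R ^+ 3 =
      (300 ^+ 2 * kappa * L%:R ^+ 2 * (nrm a)%:R) * (nrm a)%:R ^+ 2 by ring.
    apply: le_trans (ler_wpM2l _ h) _.
      by rewrite !mulr_ge0 ?exprn_ge0 ?(ltW kappa0).
    by rewrite le_eqVlt; apply/orP; left; apply/eqP; ring.
  have -> : 9 * 300 * (nrm a)%:R * L%:R ^+ 4 * \sum_(m <- nzball M) bnd m =
     (9 * 300 * L%:R ^+ 4 * \sum_(m <- nzball M) bnd m) * (nrm a)%:R by ring.
  apply: le_trans (ler_wpM2l _ hL2R) _.
    by rewrite !mulr_ge0 ?exprn_ge0.
  by rewrite le_eqVlt; apply/orP; left; apply/eqP; ring.
have L6 : 0 < L%:R ^+ 6 :> R by rewrite exprn_gt0.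
have sB : (size (box L))%:R = L%:R ^+ 2 :> R by rewrite size_box natrM expr2.
have sB3 : ((size (box L)) ^ 3)%N%:R = L%:R ^+ 6 :> R by rewrite natrX sB -exprM.
have sh x z w : (x <= 2 * k)%N -> z \in sect x k a -> (nrm w <= 8 * L ^ 2)%N -> z + w \in sect x.+1 k a.
  by move=> xk hz hw; apply: (ball_shift (L := L)).
have shN x z w : (x <= 2 * k)%N -> z \in sect x k a -> (nrm w <= 8 * L ^ 2)%N -> z - w \in sect x.+1 k a.
  by move=> xk hz hw; apply: sh => //; rewrite nrmN.
have n1 : (nrm a)%:R^-1 >= 0 :> R by rewrite invr_ge0 ltW.
split; rewrite -(ler_pM2l L6).
  apply: (@le_trans _ _ (incid a (sumseq (sumseq (sect i.+1 k a) (box L)) (box L))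
      (sumseq (sect j.+1 k a) (box L)))%:R).
    rewrite -sB3 -natrM ler_nat; apply: incid_sumseq_ge; try exact: ball_uniq.
      by move=> z w hz /nrm_box2 hw; apply: shN => //; apply: ltnW.
    by move=> z w hz /nrm_box1 hw; apply: shN => //; apply: ltnW.
  have /ler_normlP[_] := err i.+1 j.+1 ik jk; rewrite lerBlDr => h; apply: le_trans h _.
  rewrite addrC [leRHS]mulrDr lerD2r.
  (* Smoothing the incidences raised [j] to [j.+1]; undoing it in the count of elements prime to [a]
     raises it once more, whence the shift by two. *)
  have h : (count (cop a) (sumseq (sect j.+1 k a) (box L)) <= L ^ 2 * copcount j.+2 k a)%N.
    rewrite /copcount !count_sum -mulnn -size_box; apply: sumseq_le; first exact: ball_uniq.
    by move=> z w hz /nrm_box1 hw; apply: sh.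
  rewrite -(ler_nat R) natrM natrX in h.
  apply: le_trans (ler_wpM2l _ h) _; first by rewrite !mulr_ge0 ?exprn_ge0.
  by rewrite le_eqVlt; apply/orP; left; apply/eqP; move: (_^-1); clear => x; ring.
have ik' := ltnW ik.
apply: (@le_trans _ _ ((incid a (sumseq (sumseq (sect i k a) (box L)) (box L))
      (sumseq (sect j.+1 k a) (box L)))%:R + L%:R ^+ 6 * E)); last first.
  rewrite [leRHS]mulrDr lerD2r -sB3 -natrM ler_nat; apply: incid_sumseq_le; try exact: ball_uniq.
    by move=> z w hz /nrm_box2 hw; apply: sh.
  by move=> z w hz /nrm_box1 hw; apply: sh.
have /ler_normlP[h _] := err i j.+1 ik' jk; move: h; rewrite opprB lerBlDr => h.
rewrite addrC; apply: le_trans h.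
have h : (L ^ 2 * copcount j k a <= count (cop a) (sumseq (sect j.+1 k a) (box L)))%N.
  rewrite /copcount !count_sum -mulnn -size_box; apply: sumseq_ge; first exact: ball_uniq.
  by move=> z w hz /nrm_box1 hw; apply: shN => //; apply: ltnW.
rewrite -(ler_nat R) natrM natrX in h.
apply: le_trans (ler_wpM2l _ h); last by rewrite !mulr_ge0 ?exprn_ge0.
by rewrite le_eqVlt; apply/orP; left; apply/eqP; move: (_^-1); clear => x; ring.
Qed.

End sections.

End smoothing.

(** * Averaging over the modulus *)

Section equidistribution.
Local Open Scope complex_scope.
Implicit Types (a m p t u v w z : gint) (A B S I J : seq gint).
Variable R : realType.
Local Notation nm := (@Normc.normc R).

Lemma kl_sum_small_unif M (e : R) : 0 < e ->
  exists N, forall X, (N <= X)%N -> exists bnd : gint -> gint -> R,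
    [/\ forall a m, 0 <= bnd a m,
        forall a m m', a \in nzball X -> m \in nzball M -> nm (kl R a m m') <= bnd a m &
        \sum_(a <- nzball X) \sum_(m <- nzball M) bnd a m <= e * X%:R ^+ 2].
Proof.
move=> e0; set s := nzball M; pose d : R := e / (size s).+1%:R.
have d0 : 0 < d by rewrite divr_gt0.
have /choice[Nf hN] : forall m, exists N, m != 0 -> forall X, (N <= X)%N -> exists bnd : gint -> R,
    [/\ forall a, 0 <= bnd a,
        forall a m', a \in nzball X -> nm (kl R a m m') <= bnd a &
        \sum_(a <- nzball X) bnd a <= d * X%:R ^+ 2].
  move=> m; have [->|m0] := eqVneq m 0; first by exists 0%N.
  by have [N h] := kl_sum_small m0 d0; exists N.
exists (\max_(m <- s) Nf m) => X hX.
have /choice[bf hb] : forall m, exists b : gint -> R, m \in s ->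
    [/\ forall a, 0 <= b a,
        forall a m', a \in nzball X -> nm (kl R a m m') <= b a &
        \sum_(a <- nzball X) b a <= d * X%:R ^+ 2].
  move=> m; have [ms|ms] := boolP (m \in s); last by exists (fun=> 0).
  have m0 : m != 0 by move: ms; rewrite /s mem_nzball nrm_gt0 => /andP[].
  have hm : (Nf m <= X)%N by apply: leq_trans hX; apply: (@leq_bigmax_seq _ s xpredT Nf m ms isT).
  by have [b h] := hN m m0 X hm; exists b.
exists (fun a m => if m \in s then bf m a else 0); split.
- by move=> a m; case: ifP => // ms; have [h _ _] := hb m ms; apply: h.
- by move=> a m m' aX ms; rewrite ms; have [_ h _] := hb m ms; apply: h.
rewrite exchange_big /=.
apply: (@le_trans _ _ (\sum_(m <- s) d * X%:R ^+ 2)).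
  rewrite big_seq [leRHS]big_seq; apply: ler_sum => m ms; rewrite ms.
  by have [_ _ h] := hb m ms.
rewrite big_const_seq count_predT iter_addr_0 -[_ *+ size s]mulr_natl mulrA.
rewrite ler_wpM2r ?sqr_ge0 // /d mulrA ler_pdivrMr // mulrC ler_wpM2l ?(ltW e0) //.
by rewrite ler_nat.
Qed.

Definition main_term i j k a : R :=
  (size (sect i k a))%:R / (nrm a)%:R * (copcount j k a)%:R.

Lemma size_sect i k a : (0 < k)%N -> a != 0 -> (i <= 2 * k)%N -> (size (sect i k a) <= 9 * nrm a)%N.
Proof.
move=> k0 a0 ik; have n0 : (0 < nrm a)%N by rewrite nrm_gt0.
apply: (@leq_trans (size (ball (2 * nrm a)))).
  apply: ball_le; apply: leq_trans (leq_div2r _ (leq_mul ik (leqnn _))) _.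
  by rewrite mulnAC mulnK.
apply: leq_trans (@size_ball_le R _) _; move: n0; clear; lia.
Qed.

Lemma incidences_le i j k a : (incidences i j k a <= size (sect i k a) * size (sect j k a))%N.
Proof.
rewrite /incidences /incid -sum1_size big_distrl /=; apply: leq_sum => z _.
by rewrite mul1n count_size.
Qed.

Lemma main_term_ge0 i j k a : 0 <= main_term i j k a.
Proof. by rewrite /main_term mulr_ge0 // divr_ge0. Qed.

Lemma sum_incidences_bounds i j k (e : R) : (0 < k)%N -> (i < 2 * k)%N -> (j.+1 < 2 * k)%N ->
  0 < e -> exists N, forall X, (N <= X)%N ->
  \sum_(a <- nzball X) (incidences i j k a)%:R <=
    \sum_(a <- nzball X) main_term i.+1 j.+2 k a + e * X%:R ^+ 2 /\
  \sum_(a <- nzball X) main_term i j k a <=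
    \sum_(a <- nzball X) (incidences i.+1 j.+2 k a)%:R + e * X%:R ^+ 2.
Proof.
move=> k0 ik jk e0; set Q := ((16 * k) ^ 2)%N.
have qR : 0 < (16 * k)%:R :> R by rewrite ltr0n muln_gt0.
pose K1 : R := 300 ^+ 2 * 16 * (16 * k)%:R ^+ 4.
pose K2 : R := 9 * 300 * 4 * (16 * k)%:R ^+ 2.
have K10 : 0 < K1 by rewrite !mulr_gt0 ?exprn_gt0.
have K20 : 0 < K2 by rewrite !mulr_gt0 ?exprn_gt0.
(* Large frequencies, small frequencies and moduli of norm below [Q] receive [e / 3] each; the 5
   comes from the bound [5 X ^ 2] for the sum of the norms. *)
pose kappa := e / (3 * 5 * K1).
have kappa0 : 0 < kappa by rewrite divr_gt0 ?mulr_gt0.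
have [M0 hM0] := natS_gt (32 * (16 * k)%:R ^+ 2 / kappa ^+ 2).
set M := M0 in hM0.
have hM : 32 * (16 * k)%:R ^+ 2 <= kappa ^+ 2 * M%:R.
  by rewrite [leRHS]mulrC -ler_pdivrMr ?exprn_gt0 //; apply/ltW/hM0.
pose d := e / (3 * K2).
have d0 : 0 < d by rewrite divr_gt0 ?mulr_gt0.
have [N1 hN1] := kl_sum_small_unif M d0.
pose c : nat := (81 * Q ^ 2 * (4 * Q + 1))%N.
have [N2 hN2] := natS_gt (3 * c%:R / e).
exists (maxn 1 (maxn N1 N2)) => X; rewrite !geq_max => /and3P[X0 hX1 hX2].
have [bnd [bnd0 hbnd sbnd]] := hN1 X hX1.
pose E a : R := K1 * kappa * (nrm a)%:R + K2 * \sum_(m <- nzball M) bnd a m.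
pose D a : R := if (nrm a < Q)%N then (81 * Q ^ 2)%:R else 0.
have E0 a : 0 <= E a.
  by apply: addr_ge0; rewrite mulr_ge0 ?(mulr_ge0 (ltW K10) (ltW kappa0)) ?(ltW K20) ?sumr_ge0.
have D0 a : 0 <= D a by rewrite /D; case: ifP.
have XR : 1 <= X%:R :> R by rewrite ler1n.
have sE : \sum_(a <- nzball X) (E a + D a) <= e * X%:R ^+ 2.
  rewrite !big_split /= -!mulr_sumr.
  have -> : e * X%:R ^+ 2 = e / 3 * X%:R ^+ 2 + e / 3 * X%:R ^+ 2 + e / 3 * X%:R ^+ 2 by field.
  apply: lerD; first apply: lerD.
  - have h : \sum_(a <- nzball X) (nrm a)%:R <= 5 * X%:R ^+ 2 :> R.
      apply: (@le_trans _ _ (\sum_(a <- nzball X) X%:R)).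
        rewrite big_seq [leRHS]big_seq; apply: ler_sum => a.
        by rewrite mem_nzball ler_nat => /andP[].
      rewrite big_const_seq count_predT iter_addr_0 -[_ *+ size _]mulr_natl expr2 mulrA.
      by rewrite ler_wpM2r // -natrM ler_nat; exact: (size_nzball_le R).
    apply: le_trans (ler_wpM2l _ h) _; first by rewrite mulr_ge0 ?ltW.
    rewrite /kappa le_eqVlt; apply/orP; left; apply/eqP.
    by move: (lt0r_neq0 K10) (X%:R : R); clear => h x; field.
  - apply: le_trans (ler_wpM2l (ltW K20) sbnd) _.
    rewrite /d le_eqVlt; apply/orP; left; apply/eqP.
    by move: (lt0r_neq0 K20) (X%:R : R); clear => h x; field.
  - rewrite /D -big_mkcond /= big_const_seq iter_addr_0.
    apply: (@le_trans _ _ c%:R).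
      rewrite -mulrnA ler_nat leq_mul2l.
      apply/orP; right; apply: leq_trans (@size_ball_le R Q); rewrite -size_filter.
      apply: uniq_leq_size; first exact/filter_uniq/nzball_uniq.
      by move=> a; rewrite mem_filter mem_ball => /andP[/ltnW].
    have := hN2 X hX2; rewrite ltr_pdivrMr // => h.
    have h3 : c%:R <= e / 3 * X%:R by move: h; move: (c%:R : R) (X%:R : R); clear => x y; lra.
    apply: le_trans h3 _; rewrite ler_wpM2l ?divr_ge0 ?(ltW e0) //.
    by rewrite expr2 ler_peMl.
have step a : a \in nzball X ->
    (incidences i j k a)%:R <= main_term i.+1 j.+2 k a + (E a + D a) /\
    main_term i j k a <= (incidences i.+1 j.+2 k a)%:R + (E a + D a).
  move=> aX; have a0 : a != 0 by move: aX; rewrite mem_nzball nrm_gt0 => /andP[].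
  have [aQ|aQ] := ltnP (nrm a) Q; last first.
    rewrite /D ltnNge aQ /= addr0.
    apply: (incidences_bounds (M := M)) => //; first exact: ltnW.
    by move=> m m' mM; apply: hbnd.
  have s1 : (size (sect i k a) <= 9 * nrm a)%N by apply: size_sect => //; apply: ltnW.
  have s2 : (size (sect j k a) <= 9 * nrm a)%N by apply: size_sect => //; do 2!apply: ltnW.
  rewrite /D aQ; split.
    apply: (@le_trans _ _ (81 * Q ^ 2)%:R).
      rewrite ler_nat; apply: leq_trans (incidences_le _ _ _ _) _.
      apply: leq_trans (leq_mul s1 s2) _; move: aQ; clear; nia.
    by rewrite addrA lerDr addr_ge0 ?main_term_ge0.
  apply: (@le_trans _ _ (81 * Q ^ 2)%:R); last by rewrite addrA lerDr addr_ge0.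
  rewrite /main_term mulrAC ler_pdivrMr ?ltr0n ?nrm_gt0 // -!natrM ler_nat.
  apply: leq_trans (leq_mul s1 (leq_trans (count_size _ _) s2)) _.
  rewrite mulnA leq_mul2r; apply/orP; right; move: aQ; clear; nia.
split; (apply: le_trans (lerD (lexx _) sE); rewrite -big_split /=;
  rewrite big_seq [leRHS]big_seq; apply: ler_sum => a aX; by have [] := step a aX).
Qed.

Lemma sect_refine i k s a : (0 < s)%N -> sect (i * s) (k * s) a = sect i k a.
Proof. by move=> s0; rewrite /sect mulnAC divnMr. Qed.

Lemma incidences_refine i j k s a : (0 < s)%N ->
  incidences (i * s) (j * s) (k * s) a = incidences i j k a.
Proof. by move=> s0; rewrite /incidences !sect_refine. Qed.

Local Notation C := (catalan_constant R).

Lemma cvg_main_term i j k : (0 < k)%N ->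
  (\sum_(a <- nzball X) main_term i j k a) / X%:R ^+ 2 @[X --> \oo]
    --> (pi * (i%:R / k%:R) * (3 / C * (j%:R / k%:R)) : R).
Proof.
move=> k0.
apply: (@weighted_sum R (fun a => (copcount j k a)%:R)
  (fun n => (size (ball (i * n %/ k)))%:R / n%:R)).
- by [].
- apply: (cvg_eq_pos _ (@cvg_size_coppairs R j k k0)) => X _; congr (_ / _).
  rewrite -natr_sum; congr (_%:R).
  rewrite /coppairs /pairs size_filter count_sum big_allpairs_dep.
  by apply: eq_bigr => a _; rewrite -count_sum.
- exact: cvg_size_ball_scaled.
Qed.

Definition tau : R := 3 * pi / C.

(** [sum_incidences_bounds] loses one step in [i] and two in [j]. Rewriting the same sections with
    the finer mesh [1 / (k s)] makes this loss at most [5 tau / s]. *)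
Theorem cvg_sum_incidences i j k : (0 < k)%N -> (i <= k)%N -> (j <= k)%N ->
  (\sum_(a <- nzball X) (incidences i j k a)%:R) / X%:R ^+ 2 @[X --> \oo]
    --> (tau * (i%:R / k%:R) * (j%:R / k%:R) : R).
Proof.
move=> k0 ik jk; apply/cvg_natP => e e0.
have /andP[C1 _] := catalan_bounds R.
have C0 : 0 < C by lra.
have t0 : 0 < tau by rewrite /tau divr_gt0 ?mulr_gt0 ?pi_gt0.
have kR : 0 < k%:R :> R by rewrite ltr0n.
have [s0 hs0] := natS_gt (5 * tau / (e / 3)).
set s := maxn 3 s0; have s3 : (3 <= s)%N by rewrite leq_maxl.
have hs : 5 * tau / (e / 3) < s%:R by apply: hs0; rewrite leq_maxr.
have sR : 0 < s%:R :> R by rewrite ltr0n; lia.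
have hs' : 5 * tau / s%:R <= e / 3.
  by move: hs; rewrite ltr_pdivrMr ?divr_gt0 // ler_pdivrMr // => /ltW; rewrite [s%:R * _]mulrC.
have K0 : (0 < k * s)%N by rewrite muln_gt0 k0; lia.
have e3 : 0 < e / 3 by rewrite divr_gt0.
set l := tau * _ * _.
pose lim x y : R := pi * (x%:R / (k * s)%:R) * (3 / C * (y%:R / (k * s)%:R)).
have limE x y : lim x y = tau * (x%:R * y%:R) / (k%:R * s%:R) ^+ 2.
  rewrite /lim /tau natrM; move: (lt0r_neq0 C0) (lt0r_neq0 kR) (lt0r_neq0 sR).
  by move: C (k%:R : R) (s%:R : R) (pi) (x%:R : R) (y%:R : R) => c k' s' p x' y' h1 h2 h3; field; rewrite ?h1 ?h2 ?h3.
have lE : l = lim (i * s)%N (j * s)%N.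
  rewrite limE /l !natrM; move: (lt0r_neq0 kR) (lt0r_neq0 sR).
  by move: (k%:R : R) (s%:R : R) tau (i%:R : R) (j%:R : R) => k' s' p x' y' h2 h3; field; rewrite ?h2 ?h3.
have hki : (i * s <= k * s)%N by rewrite leq_mul2r ik orbT.
have hkj : (j * s <= k * s)%N by rewrite leq_mul2r jk orbT.
have hkk : (k * s <= k * k * s)%N by rewrite leq_mul2r leq_pmull ?orbT.
(* The 5 covers [(x + 1) (y + 2) - x y = 2 x + y + 2] for [x, y <= k s]. *)
have diff x y x' y' : (x' * y' <= x * y + 5 * (k * k * s))%N -> lim x' y' <= lim x y + e / 3.
  move=> h; apply: (@le_trans _ _ (lim x y + 5 * tau / s%:R)); last by rewrite lerD2l.
  rewrite !limE.
  have -> : tau * (x%:R * y%:R) / (k%:R * s%:R) ^+ 2 + 5 * tau / s%:R =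
     tau * (x%:R * y%:R + 5 * (k%:R * k%:R * s%:R)) / (k%:R * s%:R) ^+ 2.
    move: (lt0r_neq0 kR) (lt0r_neq0 sR).
    by move: (k%:R : R) (s%:R : R) tau (x%:R : R) (y%:R : R) => k' s' p x1 y1 h2 h3; field; rewrite ?h2 ?h3.
  rewrite ler_wpM2r ?invr_ge0 ?exprn_ge0 ?mulr_ge0 ?(ltW kR) ?(ltW sR) // ler_wpM2l ?(ltW t0) //.
  by rewrite -!natrM -natrD ler_nat.
have refine X : \sum_(a <- nzball X) (incidences i j k a)%:R =
    \sum_(a <- nzball X) (incidences (i * s) (j * s) (k * s) a)%:R :> R.
  by apply: eq_bigr => a _; rewrite incidences_refine //; lia.
have ub : exists N, forall X, (N <= X)%N ->
    (\sum_(a <- nzball X) (incidences i j k a)%:R) / X%:R ^+ 2 <= l + e.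
  have [||N1 h1] := @sum_incidences_bounds (i * s) (j * s) (k * s) (e / 3) K0 _ _ e3.
  - by move: ik k0 s3; clear; nia.
  - by move: jk k0 s3; clear; nia.
  have [N2 h2] := (cvg_natP _ _).1 (@cvg_main_term (i * s).+1 (j * s).+2 (k * s) K0) _ e3.
  exists (maxn 1 (maxn N1 N2)) => X; rewrite !geq_max => /and3P[X0 hX1 hX2].
  have X2 : 0 < X%:R ^+ 2 :> R by rewrite exprn_gt0 // ltr0n.
  have [h3 _] := h1 X hX1; rewrite -refine in h3.
  have := h2 X hX2; rewrite ler_distl => /andP[_ h4].
  rewrite -(ler_pM2r (_ : 0 < (X%:R ^+ 2)^-1)) ?invr_gt0 // in h3.
  apply: le_trans h3 _; rewrite mulrDl mulfK ?lt0r_neq0 //.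
  have h5 : lim (i * s).+1 (j * s).+2 <= l + e / 3.
    rewrite lE; apply: diff; move: hki hkj hkk K0; clear.
    move: (i * s)%N (j * s)%N (k * s)%N (k * k * s)%N; clear; nia.
  move: h4 h5; rewrite -/(lim _ _); lra.
have lb : exists N, forall X, (N <= X)%N ->
    l - e <= (\sum_(a <- nzball X) (incidences i j k a)%:R) / X%:R ^+ 2.
  (* The predecessors below truncate at 0, so a vanishing index is treated apart; the limit is then
     0. *)
  have [ij0|] := boolP ((i == 0) || (j == 0))%N.
    exists 0%N => X _; apply: (@le_trans _ _ 0); last by rewrite divr_ge0 ?exprn_ge0 ?sumr_ge0.
    have -> : l = 0 by rewrite /l; case/orP: ij0 => /eqP ->; rewrite ?mul0r ?mulr0 ?mul0r.
    by rewrite sub0r oppr_le0 ltW.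
  rewrite negb_or -!lt0n => /andP[i0 j0].
  have [||N1 h1] := @sum_incidences_bounds (i * s).-1 (j * s).-2 (k * s) (e / 3) K0 _ _ e3.
  - by move: ik k0 s3; clear; nia.
  - by move: jk k0 s3; clear; nia.
  have [N2 h2] := (cvg_natP _ _).1 (@cvg_main_term (i * s).-1 (j * s).-2 (k * s) K0) _ e3.
  exists (maxn 1 (maxn N1 N2)) => X; rewrite !geq_max => /and3P[X0 hX1 hX2].
  have X2 : 0 < X%:R ^+ 2 :> R by rewrite exprn_gt0 // ltr0n.
  have [_ h3] := h1 X hX1.
  have ei : ((i * s).-1.+1 = i * s)%N by rewrite prednK // muln_gt0 i0; lia.
  have ej : ((j * s).-2.+2 = j * s)%N by move: j0 s3; clear; nia.
  rewrite ei ej -refine in h3.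
  have := h2 X hX2; rewrite ler_distl => /andP[h4 _].
  rewrite -(ler_pM2r (_ : 0 < (X%:R ^+ 2)^-1)) ?invr_gt0 // in h3.
  rewrite mulrDl mulfK ?lt0r_neq0 // in h3.
  have h5 : l <= lim (i * s).-1 (j * s).-2 + e / 3.
    rewrite lE; apply: diff; move: hki hkj hkk K0 ei ej; clear.
    move: (i * s)%N (j * s)%N (k * s)%N (k * k * s)%N => I J K K' h1 h2 h3 h4 h5 h6.
    move: h1 h2; rewrite -{1 2}h5 -{1 3}h6; clear -h3; nia.
  move: h3 h4 h5; rewrite -/(lim _ _); lra.
have [N1 h1] := ub; have [N2 h2] := lb.
exists (maxn N1 N2) => X; rewrite geq_max => /andP[hX1 hX2].
by rewrite ler_distl h2 // h1.
Qed.

End equidistribution.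

(** * Matrices *)

Section quadruples.
Implicit Types (a b c d z w : gint) (S : seq gint) (q : gint * gint * (gint * gint)).

(* The quadruple [((a, b), (c, d))] stands for the matrix with rows [a b] and [c d]. *)
Definition det4 q : gint := q.1.1 * q.2.2 - q.1.2 * q.2.1.
Definition nrm4 q : nat := (nrm q.1.1 + nrm q.1.2 + nrm q.2.1 + nrm q.2.2)%N.

Definition sl2 X := [seq q <- [seq (p, r) | p <- [seq (a, b) | a <- ball X, b <- ball X],
                                            r <- [seq (c, d) | c <- ball X, d <- ball X]]
                    | (det4 q == 1) && (nrm4 q <= X)%N].

Lemma mem_sl2 X q : (q \in sl2 X) = (det4 q == 1) && (nrm4 q <= X)%N.
Proof.
rewrite mem_filter; apply: andb_idr => /andP[_ h].
have hb : [&& nrm q.1.1 <= X, nrm q.1.2 <= X, nrm q.2.1 <= X & nrm q.2.2 <= X]%N.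
  by move: h; rewrite /nrm4; clear; lia.
case/and4P: hb => h1 h2 h3 h4; apply/allpairsP; exists q.
case: q h h1 h2 h3 h4 => -[a b] [c d] /= h h1 h2 h3 h4; split => //.
  by apply/allpairsP; exists (a, b); rewrite !mem_ball.
by apply/allpairsP; exists (c, d); rewrite !mem_ball.
Qed.

Lemma sl2_uniq X : uniq (sl2 X).
Proof.
have u : uniq [seq (a, b) | a <- ball X, b <- ball X].
  by apply: allpairs_uniq; rewrite ?ball_uniq // => -[x y] [x' y'] _ _ /= [-> ->].
by apply/filter_uniq/allpairs_uniq => // -[x y] [x' y'] _ _ /= [-> ->].
Qed.

Lemma count_inj_le (T : eqType) (f : T -> T) (P P' : pred T) (s : seq T) : injective f ->
  uniq s -> (forall x, x \in s -> P x -> (f x \in s) && P' (f x)) -> (count P s <= count P' s)%N.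
Proof.
move=> fi us h; rewrite -!size_filter -(size_map f); apply: uniq_leq_size.
  by rewrite map_inj_uniq // filter_uniq.
move=> y /mapP[x]; rewrite mem_filter => /andP[Px xs] ->.
by rewrite mem_filter andbC h.
Qed.

(** The maps [rot1], [rot2] and [rot3] multiply by the rotation of order 4 on the right, on the
    left, and on both sides. They preserve [det4] and [nrm4] and bring each of the other entries to
    the upper left, up to sign. *)
Definition rot1 q := ((q.1.2, - q.1.1), (q.2.2, - q.2.1)).
Definition rot2 q := ((q.2.1, q.2.2), (- q.1.1, - q.1.2)).
Definition rot3 q := ((q.2.2, - q.2.1), (- q.1.2, q.1.1)).

Lemma rot1_inj : injective rot1.
Proof.
apply: (can_inj (g := fun q => ((- q.1.2, q.1.1), (- q.2.2, q.2.1)))) => -[[a b] [c d]].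
by rewrite /= !opprK.
Qed.
Lemma rot2_inj : injective rot2.
Proof.
apply: (can_inj (g := fun q => ((- q.2.1, - q.2.2), q.1))) => -[[a b] [c d]].
by rewrite /= !opprK.
Qed.
Lemma rot3_inj : injective rot3.
Proof.
apply: (can_inj (g := fun q => ((q.2.2, - q.2.1), (- q.1.2, q.1.1)))) => -[[a b] [c d]].
by rewrite /= !opprK.
Qed.

Lemma rot_sl2 X q : q \in sl2 X -> [/\ rot1 q \in sl2 X, rot2 q \in sl2 X & rot3 q \in sl2 X].
Proof.
rewrite !mem_sl2 /det4 /nrm4 /= !nrmN => /andP[/eqP h1 h2].
have e1 : q.1.2 * - q.2.1 - - q.1.1 * q.2.2 = 1 by rewrite -h1; ring.
have e2 : q.2.1 * - q.1.2 - q.2.2 * - q.1.1 = 1 by rewrite -h1; ring.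
have e3 : q.2.2 * q.1.1 - - q.2.1 * - q.1.2 = 1 by rewrite -h1; ring.
rewrite e1 e2 e3 eqxx /=; split; apply: leq_trans h2; lia.
Qed.

(** Two versions because of ties: every matrix is [dominant] after at least one of the four
    rotations, and [sdominant] after at most one. This gives the upper and the lower estimate. *)
Definition dominant q := [&& nrm q.1.2 <= nrm q.1.1, nrm q.2.1 <= nrm q.1.1 & nrm q.2.2 <= nrm q.1.1]%N.
Definition sdominant q := [&& nrm q.1.2 < nrm q.1.1, nrm q.2.1 < nrm q.1.1 & nrm q.2.2 < nrm q.1.1]%N.

Lemma size_sl2_le X : (size (sl2 X) <= 4 * count dominant (sl2 X))%N.
Proof.
have h1 : (count (fun q => dominant (rot1 q)) (sl2 X) <= count dominant (sl2 X))%N.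
  by apply: (count_inj_le rot1_inj (sl2_uniq X)) => q /rot_sl2[-> _ _] ->.
have h2 : (count (fun q => dominant (rot2 q)) (sl2 X) <= count dominant (sl2 X))%N.
  by apply: (count_inj_le rot2_inj (sl2_uniq X)) => q /rot_sl2[_ -> _] ->.
have h3 : (count (fun q => dominant (rot3 q)) (sl2 X) <= count dominant (sl2 X))%N.
  by apply: (count_inj_le rot3_inj (sl2_uniq X)) => q /rot_sl2[_ _ ->] ->.
apply: (@leq_trans (count dominant (sl2 X) + count (fun q => dominant (rot1 q)) (sl2 X) +
  count (fun q => dominant (rot2 q)) (sl2 X) + count (fun q => dominant (rot3 q)) (sl2 X))).
  rewrite !count_sum -!big_split -sum1_size /=; apply: leq_sum => q _.
  rewrite /dominant /= !nrmN; lia.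
lia.
Qed.

Lemma size_sl2_ge X : (4 * count sdominant (sl2 X) <= size (sl2 X))%N.
Proof.
have h1 : (count sdominant (sl2 X) <= count (fun q => sdominant (rot1 q)) (sl2 X))%N.
  apply: (count_inj_le rot1_inj (sl2_uniq X)) => q /rot_sl2[-> _ _].
  by rewrite /sdominant /= !nrmN.
have h2 : (count sdominant (sl2 X) <= count (fun q => sdominant (rot2 q)) (sl2 X))%N.
  apply: (count_inj_le rot2_inj (sl2_uniq X)) => q /rot_sl2[_ -> _].
  by rewrite /sdominant /= !nrmN.
have h3 : (count sdominant (sl2 X) <= count (fun q => sdominant (rot3 q)) (sl2 X))%N.
  apply: (count_inj_le rot3_inj (sl2_uniq X)) => q /rot_sl2[_ _ ->].
  by rewrite /sdominant /= !nrmN.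
apply: (@leq_trans (count sdominant (sl2 X) + count (fun q => sdominant (rot1 q)) (sl2 X) +
  count (fun q => sdominant (rot2 q)) (sl2 X) + count (fun q => sdominant (rot3 q)) (sl2 X))).
  lia.
rewrite !count_sum -!big_split -sum1_size /=; apply: leq_sum => q _.
rewrite /sdominant /= !nrmN; lia.
Qed.

(* The product is [N(a) ^ 2 * (1 + u) * (1 + v)] with [u = N(b) / N(a)] and [v = N(c) / N(a)]. *)
Lemma nrm4_bounds a b c d : a != 0 -> det4 ((a, b), (c, d)) = 1 ->
  (nrm b <= nrm a)%N -> (nrm c <= nrm a)%N ->
  ((nrm a + nrm b) * (nrm a + nrm c) <= nrm a * (nrm4 ((a, b), (c, d)) + 3))%N /\
  (nrm a * nrm4 ((a, b), (c, d)) <= (nrm a + nrm b) * (nrm a + nrm c) + 3 * nrm a)%N.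
Proof.
move=> a0; rewrite /det4 /nrm4 /= => h hb hc.
have e : (nrm a * nrm d = nrm (1 + b * c)%R)%N by rewrite -nrmM -h addrNK.
have n0 : (0 < nrm a)%N by rewrite nrm_gt0.
pose x := gre (b * c); pose y := gim (b * c).
have e1 : (nrm (1 + b * c)%R)%:Z = 1 + 2 * x + (nrm b * nrm c)%N%:Z.
  by rewrite -nrmM !nrmE greD gimD gre1 gim1 -/x -/y; ring.
have e2 : (nrm b * nrm c)%N%:Z = x ^+ 2 + y ^+ 2 by rewrite -nrmM nrmE.
have h3 : (nrm b * nrm c <= nrm a * nrm a)%N by rewrite leq_mul.
have hx : `|x| <= (nrm a)%:Z.
  rewrite -(ler_pXn2r (ltn0Sn 1)) ?nnegrE // real_normK ?num_real //.
  have : (nrm b * nrm c)%N%:Z <= (nrm a * nrm a)%N%:Z by rewrite lez_nat.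
  by rewrite e2 PoszM; have := sqr_ge0 y; rewrite expr2; lra.
have : (nrm a * nrm d)%N%:Z = 1 + 2 * x + (nrm b * nrm c)%N%:Z by rewrite e.
move: hx n0; rewrite ler_norml; clear.
move: (nrm a) (nrm b) (nrm c) (nrm d) => A B C D; nia.
Qed.

Definition annulus i k a := [seq z <- sect i.+1 k a | z \notin sect i k a].

Lemma mem_sect i k a z : (0 < k)%N -> (z \in sect i k a) = (k * nrm z <= i * nrm a)%N.
Proof. by move=> k0; rewrite mem_ball leq_divRL // mulnC. Qed.

Lemma sect_subset i k a z : (0 < k)%N -> z \in sect i k a -> z \in sect i.+1 k a.
Proof. by move=> k0; rewrite !mem_sect //; nia. Qed.

Lemma mem_annulus i k a z : (0 < k)%N -> (z \in annulus i k a) =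
  (i * nrm a < k * nrm z)%N && (k * nrm z <= i.+1 * nrm a)%N.
Proof. by move=> k0; rewrite mem_filter !mem_sect // -ltnNge. Qed.

Lemma annulus_uniq i k a : uniq (annulus i k a).
Proof. exact/filter_uniq/ball_uniq. Qed.

Lemma sum_annulus k a z m : (0 < k)%N ->
  (\sum_(i < m) (z \in annulus i k a) + (z \in sect 0 k a) = (z \in sect m k a))%N.
Proof.
move=> k0; elim: m => [|m IH]; first by rewrite big_ord0.
have e : (z \in annulus m k a) = (z \notin sect m k a) && (z \in sect m.+1 k a) by rewrite mem_filter.
rewrite big_ord_recr addnAC IH e.
have := @sect_subset m k a z k0; case: (z \in sect m k a) => [/(_ isT) ->|_] //.
Qed.

Definition triples Z (f g : gint -> seq gint) : seq (gint * (gint * gint)) :=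
  [seq (a, p) | a <- nzball Z,
     p <- [seq p <- [seq (b, c) | b <- f a, c <- g a] | gdvd a (p.1 * p.2 + 1)]].

Lemma mem_triples Z f g (t : gint * (gint * gint)) : reflect
  [/\ t.1 \in nzball Z, t.2.1 \in f t.1, t.2.2 \in g t.1 & gdvd t.1 (t.2.1 * t.2.2 + 1)]
  (t \in triples Z f g).
Proof.
apply: (iffP allpairsPdep) => [[a [p [ha]]]|[h1 h2 h3 h4]].
  rewrite mem_filter => /andP[hd /allpairsP[[b c] /= [hb hc ep]]] ->.
  by move: hd; rewrite ep.
exists t.1, t.2; split => //; last by case: (t).
rewrite mem_filter h4; apply/allpairsP; exists t.2; split => //; by case: (t.2).
Qed.

Lemma triples_uniq Z f g : (forall a, uniq (f a)) -> (forall a, uniq (g a)) ->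
  uniq (triples Z f g).
Proof.
move=> uf ug; apply: allpairs_uniq_dep; first exact: nzball_uniq.
  move=> a _; apply/filter_uniq/allpairs_uniq => // -[x y] [x' y'] _ _ /= [-> ->] //.
by move=> [x y] [x' y'] _ _ /= [-> ->].
Qed.

Lemma size_triples Z f g : size (triples Z f g) = (\sum_(a <- nzball Z) incid a (f a) (g a))%N.
Proof.
rewrite /triples size_allpairs_dep sumnE big_map; apply: eq_bigr => a _.
rewrite size_filter count_sum big_allpairs_dep; apply: eq_bigr => b _.
by rewrite -count_sum.
Qed.

Lemma det4_inj a b c d d' : a != 0 -> det4 ((a, b), (c, d)) = 1 -> det4 ((a, b), (c, d')) = 1 -> d = d'.
Proof.
rewrite /det4 /= => a0 h h'; apply: (gmulfI a0).
by rewrite -[a * d](subrK (b * c)) h -[a * d'](subrK (b * c)) h'.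
Qed.

Lemma size_le_triples (s : seq (gint * gint * (gint * gint))) Z f g : uniq s ->
  {in s, forall q, [/\ det4 q = 1, q.1.1 \in nzball Z, q.1.2 \in f q.1.1 & q.2.1 \in g q.1.1]} ->
  (size s <= size (triples Z f g))%N.
Proof.
move=> us h; rewrite -(size_map (fun q => (q.1.1, (q.1.2, q.2.1)))); apply: uniq_leq_size.
  rewrite map_inj_in_uniq // => -[[a b] [c d]] [[a' b'] [c' d']] /h [/= h1 h2 _ _] /h[/= h1' _ _ _].
  case=> ea eb ec; rewrite -{}ea -{}eb -{}ec in h1' *.
  have a0 : a != 0 by move: h2; rewrite mem_nzball nrm_gt0 => /andP[].
  by rewrite (det4_inj a0 h1 h1').
move=> _ /mapP[[[a b] [c d]] /h [/= h1 h2 h3 h4] ->]; apply/mem_triples; split => //=.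
rewrite (_ : b * c + 1 = a * d); first exact/(gdvd_mulr _ (gdvd_refl a)).
by rewrite -h1 /det4 /=; ring.
Qed.

Lemma triples_le_size (s : seq (gint * gint * (gint * gint))) Z (t : seq (gint * (gint * gint))) :
  uniq t -> {in t, forall u, u.1 \in nzball Z /\ gdvd u.1 (u.2.1 * u.2.2 + 1)} ->
  (forall a b c d, (a, (b, c)) \in t -> det4 ((a, b), (c, d)) = 1 -> ((a, b), (c, d)) \in s) ->
  (size t <= size s)%N.
Proof.
move=> ut ht h.
pose f (u : gint * (gint * gint)) := ((u.1, u.2.1), (u.2.2, gquo u.1 (u.2.1 * u.2.2 + 1))).
rewrite -(size_map f); apply: uniq_leq_size.
  by rewrite map_inj_uniq // => -[a [b c]] [a' [b' c']] [-> -> -> _].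
move=> _ /mapP[[a [b c]] hu ->]; apply: h => //=.
have [_ /= hd] := ht _ hu; move: (gquoE a (b * c + 1)); rewrite /gdvd in hd.
by rewrite (eqP hd) addr0 /det4 /= => <-; ring.
Qed.

(** In the cell [(i, j)] the inner radii give [(k + i) (k + j) N(a) ^ 2 <= k ^ 2 (N(a) + N(b)) (N(a)
    + N(c))], and [nrm4_bounds] turns this into the range of [a]. The annuli miss the origin, so the
    last two sums account for [b = 0] and [c = 0]. *)
Lemma count_dominant_le X k : (0 < k)%N ->
  (count dominant (sl2 X) <=
    \sum_(i < k) \sum_(j < k)
       \sum_(a <- nzball ((X + 3) * k ^ 2 %/ ((k + i) * (k + j)))) incid a (annulus i k a) (annulus j k a)
    + \sum_(a <- nzball X) incidences 0 k k a + \sum_(a <- nzball X) incidences k 0 k a)%N.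
Proof.
move=> k0; rewrite -size_filter; set s := [seq q <- _ | _].
have us : uniq s by apply/filter_uniq/sl2_uniq.
have sP q : q \in s -> [/\ det4 q = 1, (nrm4 q <= X)%N, q.1.1 != 0 & dominant q].
  rewrite mem_filter mem_sl2 => /and3P[dq /eqP h1 h2]; split => //.
  apply/eqP => h0; move: h1 dq; rewrite /det4 /dominant h0 (_ : nrm 0 = 0%N) // !leqn0 !nrm_eq0.
  by move=> h1 /and3P[/eqP hb _ _]; move: h1; rewrite hb !mul0r subr0.
have sk q : q \in s -> (q.1.2 \in sect k k q.1.1) && (q.2.1 \in sect k k q.1.1).
  by move=> /sP[_ _ _ /and3P[h1 h2 _]]; rewrite !mem_sect // !leq_pmul2l // h1 h2.
have snz q : q \in s -> q.1.1 \in nzball X.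
  move=> /sP[_ h a0 _]; rewrite mem_nzball nrm_gt0 a0 /=; apply: leq_trans h.
  by rewrite /nrm4; lia.
apply: (@leq_trans (\sum_(i < k) \sum_(j < k)
     count (fun q => (q.1.2 \in annulus i k q.1.1) && (q.2.1 \in annulus j k q.1.1)) s +
  count (fun q => q.1.2 \in sect 0 k q.1.1) s + count (fun q => q.2.1 \in sect 0 k q.1.1) s)).
  have -> : (\sum_(i < k) \sum_(j < k)
     count (fun q => (q.1.2 \in annulus i k q.1.1) && (q.2.1 \in annulus j k q.1.1)) s =
     \sum_(q <- s) (\sum_(i < k) (q.1.2 \in annulus i k q.1.1)) * (\sum_(j < k) (q.2.1 \in annulus j k q.1.1)))%N.
    under [RHS]eq_bigr do rewrite big_distrlr /=.
    rewrite [RHS]exchange_big /=; apply: eq_bigr => i _.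
    rewrite [RHS]exchange_big /=; apply: eq_bigr => j _.
    by rewrite count_sum; apply: eq_bigr => q _; rewrite mulnb.
  rewrite !count_sum -!big_split -sum1_size /= big_seq [leqRHS]big_seq; apply: leq_sum => q qs.
  have := sum_annulus q.1.1 q.1.2 k k0; have := sum_annulus q.1.1 q.2.1 k k0.
  have /andP[-> ->] := sk q qs.
  move: (\sum_(i < k) _)%N (\sum_(i < k) _)%N (q.1.2 \in sect 0 k q.1.1) (q.2.1 \in sect 0 k q.1.1).
  by clear => x y [] [] /= h1 h2; nia.
apply: leq_add; first apply: leq_add.
- apply: leq_sum => i _; apply: leq_sum => j _.
  rewrite -size_triples -size_filter; apply: size_le_triples; first exact: filter_uniq.
  move=> q; rewrite mem_filter => /andP[/andP[hb hc] qs]; split => //; first by have [] := sP q qs.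
  have [h1 h2 a0 /and3P[db dc _]] := sP q qs.
  move: hb hc h1 h2 a0 db dc; case: (q) => -[a b] [c d] /=; clear -k0.
  rewrite !mem_annulus // => /andP[hb _] /andP[hc _] h1 h2 a0 db dc.
  rewrite mem_nzball nrm_gt0 a0 /= leq_divRL ?muln_gt0 ?addn_gt0 ?k0 //.
  have [h3 _] := nrm4_bounds a0 h1 db dc.
  have n0 : (0 < nrm a)%N by rewrite nrm_gt0.
  rewrite -(leq_pmul2l n0).
  apply: (@leq_trans ((k * nrm a + k * nrm b) * (k * nrm a + k * nrm c))).
    have hb' : ((k + i) * nrm a <= k * nrm a + k * nrm b)%N by rewrite mulnDl leq_add2l ltnW.
    have hc' : ((k + j) * nrm a <= k * nrm a + k * nrm c)%N by rewrite mulnDl leq_add2l ltnW.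
    have -> : (nrm a * (nrm a * ((k + i) * (k + j))) = ((k + i) * nrm a) * ((k + j) * nrm a))%N by ring.
    exact: leq_mul.
  rewrite -!mulnDr mulnACA mulnn mulnC.
  apply: leq_trans (leq_mul h3 (leqnn _)) _.
  by rewrite -mulnA leq_mul2l leq_mul2r leq_add2r h2 !orbT.
- rewrite -size_triples -size_filter; apply: size_le_triples; first exact: filter_uniq.
  move=> q; rewrite mem_filter => /andP[hb qs]; split => //; first by have [] := sP q qs.
    exact: snz.
  by have /andP[] := sk q qs.
- rewrite -size_triples -size_filter; apply: size_le_triples; first exact: filter_uniq.
  move=> q; rewrite mem_filter => /andP[hb qs]; split => //; first by have [] := sP q qs.
    exact: snz.
  by have /andP[] := sk q qs.
Qed.

(** The outer radii guarantee [nrm4 <= X]. Omitting the outermost annulus makes [b] and [c] strictly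
    smaller than [a]; the same follows for [d] when [nrm a > 3 k ^ 2], where the error 3 of
    [nrm4_bounds] cannot fill the gap between [(k - 1) ^ 2] and [k ^ 2]. Smaller [a] form the last
    sum. *)
Lemma count_sdominant_ge X k : (0 < k)%N ->
  (\sum_(i < k.-1) \sum_(j < k.-1)
       \sum_(a <- nzball ((X - 3) * k ^ 2 %/ ((k + i.+1) * (k + j.+1)))) incid a (annulus i k a) (annulus j k a)
   <= count sdominant (sl2 X) + \sum_(i < k.-1) \sum_(j < k.-1)
       \sum_(a <- nzball (3 * k ^ 2)) incid a (annulus i k a) (annulus j k a))%N.
Proof.
move=> k0; rewrite -size_filter; set s := [seq q <- _ | _].
apply: (@leq_trans (\sum_(i < k.-1) \sum_(j < k.-1)
     count (fun q => (q.1.2 \in annulus i k q.1.1) && (q.2.1 \in annulus j k q.1.1)) s +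
   \sum_(i < k.-1) \sum_(j < k.-1)
       \sum_(a <- nzball (3 * k ^ 2)) incid a (annulus i k a) (annulus j k a))); last first.
  rewrite leq_add2r.
  have -> : (\sum_(i < k.-1) \sum_(j < k.-1)
     count (fun q => (q.1.2 \in annulus i k q.1.1) && (q.2.1 \in annulus j k q.1.1)) s =
     \sum_(q <- s) (\sum_(i < k.-1) (q.1.2 \in annulus i k q.1.1)) * (\sum_(j < k.-1) (q.2.1 \in annulus j k q.1.1)))%N.
    under [RHS]eq_bigr do rewrite big_distrlr /=.
    rewrite [RHS]exchange_big /=; apply: eq_bigr => i _.
    rewrite [RHS]exchange_big /=; apply: eq_bigr => j _.
    by rewrite count_sum; apply: eq_bigr => q _; rewrite mulnb.
  rewrite -sum1_size; apply: leq_sum => q _.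
  have := sum_annulus q.1.1 q.1.2 k.-1 k0; have := sum_annulus q.1.1 q.2.1 k.-1 k0.
  move: (\sum_(i < _) _)%N (\sum_(i < _) _)%N; clear => x y h1 h2.
  have : (x <= 1)%N by move: h1; case: (_ \in sect k.-1 k _) => /=; lia.
  have : (y <= 1)%N by move: h2; case: (_ \in sect k.-1 k _) => /=; lia.
  nia.
rewrite -big_split; apply: leq_sum => i _; rewrite -big_split; apply: leq_sum => j _ /=.
rewrite -!size_triples -size_filter.
set Z := (_ %/ _)%N; set t := triples Z _ _.
have ut : uniq t by apply: triples_uniq => a; apply: annulus_uniq.
rewrite -(count_predC (fun u : gint * (gint * gint) => 3 * k ^ 2 < nrm u.1)%N t).
apply: leq_add; rewrite -size_filter; last first.
  apply: uniq_leq_size; first exact: filter_uniq.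
  move=> u; rewrite mem_filter /= -leqNgt => /andP[h1 /mem_triples[h2 h3 h4 h5]].
  apply/mem_triples; split => //; move: h2; rewrite !mem_nzball => /andP[-> _] //.
apply: (@triples_le_size _ Z); first exact: filter_uniq.
  by move=> u; rewrite mem_filter => /andP[_ /mem_triples[]].
move=> a b c d; rewrite mem_filter => /andP[/= ha /mem_triples[/= h1 h2 h3 _]] hdet.
rewrite mem_filter /= h2 h3 /= mem_filter mem_sl2 hdet eqxx /=.
have {h1 h2 h3}[i' [j' [h1 hb hc hi hj]]] : exists i j : nat,
  [/\ a \in nzball ((X - 3) * k ^ 2 %/ ((k + i.+1) * (k + j.+1))), (k * nrm b <= i.+1 * nrm a)%N,
      (k * nrm c <= j.+1 * nrm a)%N, (i < k.-1)%N & (j < k.-1)%N].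
  exists i, j; split; rewrite ?ltn_ord //.
    by move: h2; rewrite mem_annulus // => /andP[].
  by move: h3; rewrite mem_annulus // => /andP[].
move: i' j' h1 hb hc hi hj {Z t ut i j} => i j h1 hb hc hi hj.
have n0 : (0 < nrm a)%N by apply: leq_ltn_trans ha.
have a0 : a != 0 by rewrite -nrm_gt0.
have ltb : (nrm b < nrm a)%N by move: hb hi k0 n0; clear; nia.
have ltc : (nrm c < nrm a)%N by move: hc hj k0 n0; clear; nia.
have [_ h3] := nrm4_bounds a0 hdet (ltnW ltb) (ltnW ltc).
have h4 : (k ^ 2 * (nrm a * nrm4 ((a, b), (c, d))) <=
    nrm a * (nrm a * ((k + i.+1) * (k + j.+1)) + 3 * k ^ 2))%N.
  apply: leq_trans (leq_mul (leqnn _) h3) _.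
  have hb' : (k * (nrm a + nrm b) <= (k + i.+1) * nrm a)%N by rewrite mulnDr mulnDl leq_add2l.
  have hc' : (k * (nrm a + nrm c) <= (k + j.+1) * nrm a)%N by rewrite mulnDr mulnDl leq_add2l.
  have := leq_mul hb' hc'; clear; nia.
move: h1; rewrite mem_nzball => /andP[_]; rewrite leq_divRL ?muln_gt0 ?addn_gt0 ?k0 // => h1.
have k2 : (0 < k ^ 2)%N by rewrite expn_gt0 k0.
(* The subtraction [X - 3] is truncated; for [X < 3] the range of [a] is empty. *)
have X3 : (3 <= X)%N.
  rewrite leqNgt; apply/negP => hX; move: h1; rewrite (_ : (X - 3 = 0)%N); last by lia.
  by rewrite mul0n leqn0 !muln_eq0 addn_eq0 /= ; move: n0 k0; clear; lia.
apply/andP; split; last first.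
  rewrite -(leq_pmul2l k2) -(leq_pmul2l n0) mulnCA.
  apply: leq_trans h4 _; rewrite leq_mul2l; apply/orP; right.
  apply: leq_trans (leq_add h1 (leqnn _)) _.
  by rewrite -mulnDl subnK // mulnC.
rewrite /sdominant /= ltb ltc /=.
move: h4; rewrite /nrm4 /= => h4.
have h5 : (k ^ 2 * (nrm a * nrm d) <= (i.+1 * nrm a) * (j.+1 * nrm a) + 3 * k ^ 2 * nrm a)%N.
  move: h3; rewrite /nrm4 /= => h3.
  have h3' : (nrm a * nrm d <= nrm b * nrm c + 3 * nrm a)%N by move: h3; clear; nia.
  apply: leq_trans (leq_mul (leqnn _) h3') _.
  have := leq_mul hb hc; clear; nia.
rewrite ltnNge; apply/negP => hd.
have h6 : (k ^ 2 * nrm d <= i.+1 * j.+1 * nrm a + 3 * k ^ 2)%N.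
  rewrite -(leq_pmul2l n0); move: h5; clear; nia.
have h7 : (i.+1 * j.+1 <= (k.-1) * (k.-1))%N by rewrite leq_mul.
have h8 : (k ^ 2 * nrm a <= k.-1 * k.-1 * nrm a + 3 * k ^ 2)%N.
  apply: leq_trans (leq_trans _ h6) _; first by rewrite leq_mul2l hd orbT.
  by rewrite leq_add2r leq_mul2r h7 orbT.
move: h8 ha k0; clear; case: k => // k; rewrite /=; move: (nrm a) => A h8 ha _.
have e : (k.+1 ^ 2 * A = k * k * A + (2 * k) * A + A)%N by ring.
move: h8 ha; rewrite e; move: (k.+1 ^ 2)%N (k * k * A)%N (2 * k * A)%N; clear; lia.
Qed.

End quadruples.

(** * Riemann sums over cells *)

Section asymptotic_count.
Implicit Types (a b c d z w : gint) (S : seq gint).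

Lemma sum_sect_annulus i k a (F : gint -> nat) : (0 < k)%N ->
  (\sum_(z <- sect i.+1 k a) F z = \sum_(z <- sect i k a) F z + \sum_(z <- annulus i k a) F z)%N.
Proof.
move=> k0; rewrite -big_cat; apply: perm_big; apply: uniq_perm; first exact: ball_uniq.
  rewrite cat_uniq ball_uniq annulus_uniq andbT /=; apply/hasPn => z.
  by rewrite mem_filter => /andP[].
move=> z; rewrite mem_cat; have := @sect_subset i k a z k0.
have -> : (z \in annulus i k a) = (z \notin sect i k a) && (z \in sect i.+1 k a) by rewrite mem_filter.
by case: (z \in sect i k a) => [/(_ isT) ->|].
Qed.

Definition cell i j k Y : nat := (\sum_(a <- nzball Y) incid a (annulus i k a) (annulus j k a))%N.

(** Inclusion-exclusion for a rectangle with four corner counts, written without subtraction in the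
    natural numbers. *)
Lemma cell_incidences i j k Y : (0 < k)%N ->
  (cell i j k Y + (\sum_(a <- nzball Y) incidences i j.+1 k a + \sum_(a <- nzball Y) incidences i.+1 j k a) =
   \sum_(a <- nzball Y) incidences i.+1 j.+1 k a + \sum_(a <- nzball Y) incidences i j k a)%N.
Proof.
move=> k0; rewrite /cell -!big_split; apply: eq_bigr => a _ /=; rewrite /incidences /incid.
rewrite !sum_sect_annulus //.
have e z : count (fun w => gdvd a (z * w + 1)) (sect j.+1 k a) =
   (count (fun w => gdvd a (z * w + 1)%R) (sect j k a) +
    count (fun w => gdvd a (z * w + 1)%R) (annulus j k a))%N.
  by rewrite !count_sum sum_sect_annulus.
have E (s : seq gint) : (\sum_(z <- s) count (fun w => gdvd a (z * w + 1)%R) (sect j.+1 k a) =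
   \sum_(z <- s) count (fun w => gdvd a (z * w + 1)%R) (sect j k a) +
   \sum_(z <- s) count (fun w => gdvd a (z * w + 1)%R) (annulus j k a))%N.
  by rewrite -big_split; apply: eq_bigr => z _; apply: e.
rewrite !E.
move: (\sum_(z <- sect i k a) count _ (sect j k a))%N (\sum_(z <- annulus i k a) count _ (sect j k a))%N
  (\sum_(z <- sect i k a) count _ (annulus j k a))%N (\sum_(z <- annulus i k a) count _ (annulus j k a))%N; lia.
Qed.

Section main_count.
Variable R : realType.
Local Notation tau := (tau R).

Lemma cvg_sum_seq (I : Type) (s : seq I) (F : I -> nat -> R) (l : I -> R) :
  (forall i, F i n @[n --> \oo] --> l i) ->
  \sum_(i <- s) F i n @[n --> \oo] --> \sum_(i <- s) l i.
Proof.
move=> h; elim: s => [|i s IH].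
  by rewrite big_nil; under eq_cvg do rewrite big_nil; apply: cvg_cst.
rewrite big_cons; under eq_cvg do rewrite big_cons.
exact: cvgD.
Qed.

Lemma cvg_cell i j k : (i < k)%N -> (j < k)%N ->
  (cell i j k Y)%:R / Y%:R ^+ 2 @[Y --> \oo] --> (tau / k%:R ^+ 2 : R).
Proof.
move=> ik jk; have k0 : (0 < k)%N by apply: leq_ltn_trans ik.
have kR : k%:R != 0 :> R by rewrite pnatr_eq0 -lt0n.
pose T x y X : R := (\sum_(a <- nzball X) (incidences x y k a)%:R) / X%:R ^+ 2.
have cT x y : (x <= k)%N -> (y <= k)%N -> T x y X @[X --> \oo] --> (tau * (x%:R / k%:R) * (y%:R / k%:R) : R).
  by move=> hx hy; apply: cvg_sum_incidences.
have -> : tau / k%:R ^+ 2 = tau * (i.+1%:R / k%:R) * (j.+1%:R / k%:R) + tau * (i%:R / k%:R) * (j%:R / k%:R)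
    - (tau * (i%:R / k%:R) * (j.+1%:R / k%:R) + tau * (i.+1%:R / k%:R) * (j%:R / k%:R)).
  by rewrite -!natr1; move: (i%:R : R) (j%:R : R) (k%:R : R) tau kR => x y K t h; field.
apply: (@cvg_eq_pos _ _ (fun Y => T i.+1 j.+1 Y + T i j Y - (T i j.+1 Y + T i.+1 j Y))); last first.
  by apply: cvgB; apply: cvgD; apply: cT => //; apply: ltnW.
move=> Y _; rewrite /T -!mulrDl -mulrBl; congr (_ / _).
have := @cell_incidences i j k Y k0 => /(congr1 (fun n => n%:R : R)).
rewrite !natrD !natr_sum => /(canRL (addrK _)) ->; ring.
Qed.

Lemma cvg_reparam (f : nat -> R) (Y : nat -> nat) (l y c : R) : f 0 = 0 -> 0 < y ->
  f n / n%:R ^+ 2 @[n --> \oo] --> l -> (forall X, `|(Y X)%:R - y * X%:R| <= c) ->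
  f (Y X) / X%:R ^+ 2 @[X --> \oo] --> (l * y ^+ 2 : R).
Proof.
move=> f0 y0 cf hY.
have c0 : 0 <= c by apply: le_trans (hY 0%N).
have cY : (Y X)%:R / X%:R @[X --> \oo] --> (y : R).
  apply/cvg_natP => e e0; have [N hN] := natS_gt (c / e).
  exists N.+1 => X hX; have X0 : 0 < X%:R :> R by rewrite ltr0n; lia.
  rewrite le_div_sub //; apply: le_trans (hY X) _.
  by rewrite mulrC -ler_pdivrMr // ltW // hN //; lia.
have cfY : f (Y X) / (Y X)%:R ^+ 2 @[X --> \oo] --> (l : R).
  apply/cvg_natP => e e0; have [N hN] := (cvg_natP _ _).1 cf e e0.
  have [N' hN'] := natS_gt ((N%:R + c) / y).
  exists N' => X hX; apply: hN; rewrite -(ler_nat R).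
  have := hN' X hX; rewrite ltr_pdivrMr // => h.
  have := hY X; rewrite ler_norml => /andP[h1 _].
  by move: h h1; rewrite [_ * y]mulrC; lra.
rewrite expr2.
apply: (@cvg_eq_pos _ _ (fun X => f (Y X) / (Y X)%:R ^+ 2 * ((Y X)%:R / X%:R * ((Y X)%:R / X%:R)))); last first.
  by apply: cvgM => //; apply: cvgM.
move=> X X0.
have XR : X%:R != 0 :> R by rewrite pnatr_eq0 -lt0n.
(* Where [Y X = 0] the factorization divides by 0, with value 0; it remains true because
   [f 0 = 0]. *)
have [->|Y0] := posnP (Y X); first by rewrite f0 !mul0r.
have YR : (Y X)%:R != 0 :> R by rewrite pnatr_eq0 -lt0n.
by move: (f _) (X%:R : R) ((Y X)%:R : R) XR YR => F x z h1 h2; field; rewrite ?h1 ?h2.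
Qed.

Lemma cell0 i j k : cell i j k 0 = 0%N.
Proof. by rewrite /cell (_ : nzball 0 = [::]) ?big_nil //; vm_compute. Qed.

Lemma cvg_cell_scaled i j k p q (Z : nat -> nat) : (i < k)%N -> (j < k)%N -> (0 < p)%N -> (0 < q)%N ->
  (forall X, X <= Z X + 3 /\ Z X <= X + 3)%N ->
  (cell i j k (Z X * p %/ q))%:R / X%:R ^+ 2 @[X --> \oo] --> (tau / k%:R ^+ 2 * (p%:R / q%:R) ^+ 2 : R).
Proof.
move=> ik jk p0 q0 hZ; have pR : 0 < p%:R :> R by rewrite ltr0n.
have qR : 0 < q%:R :> R by rewrite ltr0n.
apply: (@cvg_reparam (fun Y => (cell i j k Y)%:R) (fun X => Z X * p %/ q)%N
   (tau / k%:R ^+ 2) (p%:R / q%:R) (3 * (p%:R / q%:R) + 1)).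
- by rewrite cell0.
- by rewrite divr_gt0.
- exact: cvg_cell.
move=> X; have [h1 h2] := hZ X; set m := (_ %/ _)%N.
have h3 : (m * q <= Z X * p)%N by apply: leq_trunc_div.
have h4 : (Z X * p < m.+1 * q)%N by apply: ltn_ceil.
move: h1 h2 h3 h4; rewrite -(ler_nat R) -[(Z X <= _)%N](ler_nat R) -[(_ * q <= _)%N](ler_nat R) -(ltr_nat R).
rewrite mulSn !natrD !natrM => h1 h2 h3 h4.
set y := p%:R / q%:R; have y0 : 0 < y by rewrite divr_gt0.
have h5 : m%:R <= (Z X)%:R * y by rewrite /y mulrA ler_pdivlMr.
have h6 : (Z X)%:R * y <= m%:R + 1 by rewrite /y mulrA ler_pdivrMr // mulrDl mul1r addrC ltW.
have h7 : (Z X)%:R * y <= (X%:R + 3) * y by rewrite ler_wpM2r // ltW.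
have h8 : X%:R * y <= ((Z X)%:R + 3) * y by rewrite ler_wpM2r // ltW.
move: h5 h6 h7 h8; rewrite ler_norml !mulrDl.
move: ((Z X)%:R * y) => z; rewrite [X%:R * y]mulrC; move: (y * X%:R) => x; lra.
Qed.

(** A Riemann sum for the integral of [1 / (1 + u) ^ 2] over [[0, 1]], compared with the telescoping
    differences [k / (k + m) - k / (k + m + 1)]; each step costs at most [1 / k ^ 2]. *)
Lemma sum_upper k : (0 < k)%N ->
  \sum_(i < k) (k%:R / (k + i)%:R ^+ 2) <= 1 / 2 + 1 / k%:R :> R.
Proof.
move=> k0; have kR : 0 < k%:R :> R by rewrite ltr0n.
have h m : \sum_(i < m) (k%:R / (k + i)%:R ^+ 2) <= 1 - k%:R / (k + m)%:R + m%:R / k%:R ^+ 2 :> R.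
  elim: m => [|m IH].
    by rewrite big_ord0 addn0 divff ?lt0r_neq0 // subrr mul0r addr0.
  rewrite big_ord_recr /=; apply: le_trans (lerD IH (lexx _)) _.
  rewrite addnS -[(k + m).+1%:R]natr1 -[m.+1%:R]natr1 natrD.
  have m0 : 0 <= m%:R :> R by [].
  move: (k%:R : R) (m%:R : R) kR m0 => x y x0 y0.
  rewrite -subr_ge0.
  have -> : 1 - x / (x + y + 1) + (y + 1) / x ^+ 2 - (1 - x / (x + y) + y / x ^+ 2 + x / (x + y) ^+ 2) =
     ((x + y) ^+ 2 * (x + y + 1) - x ^+ 3) / (x ^+ 2 * (x + y) ^+ 2 * (x + y + 1)).
    have xy : 0 < x + y by lra.
    have xy1 : 0 < x + y + 1 by lra.
    by field; rewrite !lt0r_neq0.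
  rewrite divr_ge0 //; last by rewrite !mulr_ge0 ?exprn_ge0 //; lra.
  have : x ^+ 3 <= (x + y) ^+ 3 by rewrite lerXn2r ?nnegrE //; lra.
  have : 0 <= (x + y) ^+ 2 by rewrite sqr_ge0.
  rewrite subr_ge0 mulrDr mulr1 -exprSr; lra.
apply: le_trans (h k) _; rewrite natrD.
move: (k%:R : R) kR => x x0; rewrite le_eqVlt; apply/orP; left; apply/eqP.
by field; rewrite !lt0r_neq0 // addr_gt0.
Qed.

Lemma sum_lower k : (0 < k)%N ->
  1 / 2 - 1 / k%:R <= \sum_(i < k.-1) (k%:R / (k + i.+1)%:R ^+ 2) :> R.
Proof.
move=> k0; have kR : 0 < k%:R :> R by rewrite ltr0n.
have h m : k%:R / (k + 1)%:R - k%:R / (k + m.+1)%:R <= \sum_(i < m) (k%:R / (k + i.+1)%:R ^+ 2) :> R.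
  elim: m => [|m IH]; first by rewrite big_ord0 subrr.
  rewrite big_ord_recr /=; apply: le_trans (lerD IH (lexx _)).
  rewrite !natrD -[m.+2%:R]natr1; have m0 : 0 < m.+1%:R :> R by [].
  move: (k%:R : R) (m.+1%:R : R) kR m0 => x y x0 y0.
  rewrite -subr_ge0.
  have -> : x / (x + 1) - x / (x + y) + x / (x + y) ^+ 2 - (x / (x + 1) - x / (x + (y + 1))) =
      x / ((x + y) ^+ 2 * (x + y + 1)).
    by field; rewrite !lt0r_neq0 // ?addr_gt0 // ?addr_gt0.
  by rewrite divr_ge0 // ?mulr_ge0 ?exprn_ge0 //; lra.
apply: le_trans (h k.-1); rewrite prednK // !natrD.
have k1 : 1 <= k%:R :> R by rewrite ler1n.
move: (k%:R : R) kR k1 => x x0 x1; rewrite -subr_ge0.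
have -> : x / (x + 1) - x / (x + x) - (1 / 2 - 1 / x) = 1 / (x * (x + 1)).
  by field; rewrite !lt0r_neq0 // ?addr_gt0.
by rewrite divr_ge0 // mulr_ge0 //; lra.
Qed.

Theorem cvg_size_sl2 : (size (sl2 X))%:R / X%:R ^+ 2 @[X --> \oo] --> (tau : R).
Proof.
have /andP[C1 _] := catalan_bounds R.
have t0 : 0 < tau by rewrite divr_gt0 ?mulr_gt0 ?pi_gt0 //; lra.
pose A k : R := \sum_(i < k) (k%:R / (k + i)%:R ^+ 2).
pose B k : R := \sum_(i < k.-1) (k%:R / (k + i.+1)%:R ^+ 2).
have ub k : (0 < k)%N -> forall e : R, 0 < e -> exists N, forall X, (N <= X)%N ->
    (size (sl2 X))%:R / X%:R ^+ 2 <= 4 * (tau * A k ^+ 2) + e.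
  move=> k0 e e0; have kR : k%:R != 0 :> R by rewrite pnatr_eq0 -lt0n.
  pose Yc (i j : 'I_k) X := ((X + 3) * k ^ 2 %/ ((k + i) * (k + j)))%N.
  have cY (i j : 'I_k) : (cell i j k (Yc i j X))%:R / X%:R ^+ 2 @[X --> \oo] -->
      (tau * ((k%:R / (k + i)%:R ^+ 2) * (k%:R / (k + j)%:R ^+ 2)) : R).
    have hZ X : (X <= X + 3 + 3 /\ X + 3 <= X + 3)%N by split; lia.
    have k2 : (0 < k ^ 2)%N by rewrite expn_gt0 k0.
    have kk : (0 < (k + i) * (k + j))%N by rewrite muln_gt0 !addn_gt0 k0.
    rewrite [X in _ --> X](_ : _ = tau / k%:R ^+ 2 * ((k ^ 2)%N%:R / ((k + i) * (k + j))%N%:R) ^+ 2).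
      exact: (cvg_cell_scaled (ltn_ord i) (ltn_ord j) k2 kk hZ).
    have hx : (k + i)%:R != 0 :> R by rewrite pnatr_eq0 addn_eq0 negb_and -lt0n k0.
    have hy : (k + j)%:R != 0 :> R by rewrite pnatr_eq0 addn_eq0 negb_and -lt0n k0.
    rewrite natrX natrM; move: (k%:R : R) ((k + i)%:R : R) ((k + j)%:R : R) tau kR hx hy => x y z t h1 h2 h3.
    by field; rewrite ?h1 ?h2 ?h3.
  have c1 := @cvg_sum_seq _ (index_enum 'I_k) _ _ (fun i => @cvg_sum_seq _ (index_enum 'I_k) _ _ (cY i)).
  have c2 := @cvg_sum_incidences R 0 k k k0 (leq0n _) (leqnn _).
  have c3 := @cvg_sum_incidences R k 0 k k0 (leqnn _) (leq0n _).
  pose u n : R := \sum_(i < k) \sum_(j < k) (cell i j k (Yc i j n))%:R / n%:R ^+ 2 +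
    (\sum_(a <- nzball n) (incidences 0 k k a)%:R) / n%:R ^+ 2 +
    (\sum_(a <- nzball n) (incidences k 0 k a)%:R) / n%:R ^+ 2.
  have c4 : u n @[n --> \oo] --> (tau * A k ^+ 2 : R).
    rewrite (_ : tau * A k ^+ 2 =
      \sum_(i < k) \sum_(j < k) tau * (k%:R / (k + i)%:R ^+ 2 * (k%:R / (k + j)%:R ^+ 2))
      + tau * (0 / k%:R) * (k%:R / k%:R) + tau * (k%:R / k%:R) * (0 / k%:R)).
      by apply: cvgD => //; apply: cvgD.
    rewrite mul0r mulr0 mul0r mulr0 !addr0 /A expr2 big_distrlr /= mulr_sumr.
    by apply: eq_bigr => i _; rewrite mulr_sumr.
  have e4 : 0 < e / 4 by rewrite divr_gt0.
  have [N hN] := (cvg_natP _ _).1 c4 _ e4.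
  exists N.+1 => X hX; have X0 : 0 < X%:R ^+ 2 :> R by rewrite exprn_gt0 // ltr0n; lia.
  have := hN X (ltnW hX); rewrite ler_distl => /andP[_]; rewrite /u.
  under eq_bigr do rewrite -mulr_suml -natr_sum.
  rewrite -mulr_suml -!natr_sum -!mulrDl -!natrD => h.
  apply: (@le_trans _ _ (4 * (tau * A k ^+ 2 + e / 4))); last by move: (tau * _); clear => x; lra.
  apply: le_trans (ler_wpM2l _ h); rewrite //.
  rewrite mulrA ler_wpM2r ?invr_ge0 ?(ltW X0) // -natrM ler_nat.
  by apply: leq_trans (size_sl2_le X) _; rewrite leq_mul2l count_dominant_le.
have lb k : (0 < k)%N -> forall e : R, 0 < e -> exists N, forall X, (N <= X)%N ->
    4 * (tau * B k ^+ 2) - e <= (size (sl2 X))%:R / X%:R ^+ 2.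
  move=> k0 e e0; have kR : k%:R != 0 :> R by rewrite pnatr_eq0 -lt0n.
  pose Yc (i j : 'I_k.-1) X := ((X - 3) * k ^ 2 %/ ((k + i.+1) * (k + j.+1)))%N.
  have cY (i j : 'I_k.-1) : (cell i j k (Yc i j X))%:R / X%:R ^+ 2 @[X --> \oo] -->
      (tau * ((k%:R / (k + i.+1)%:R ^+ 2) * (k%:R / (k + j.+1)%:R ^+ 2)) : R).
    have ik : (i < k)%N by have := ltn_ord i; lia.
    have jk : (j < k)%N by have := ltn_ord j; lia.
    have hZ X : (X <= X - 3 + 3 /\ X - 3 <= X + 3)%N by split; lia.
    have k2 : (0 < k ^ 2)%N by rewrite expn_gt0 k0.
    have kk : (0 < (k + i.+1) * (k + j.+1))%N by rewrite muln_gt0 !addn_gt0 k0.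
    rewrite [X in _ --> X](_ : _ = tau / k%:R ^+ 2 * ((k ^ 2)%N%:R / ((k + i.+1) * (k + j.+1))%N%:R) ^+ 2).
      exact: (cvg_cell_scaled ik jk k2 kk hZ).
    have hx : (k + i.+1)%:R != 0 :> R by rewrite pnatr_eq0 addn_eq0 negb_and orbT.
    have hy : (k + j.+1)%:R != 0 :> R by rewrite pnatr_eq0 addn_eq0 negb_and orbT.
    rewrite natrX natrM; move: (k%:R : R) ((k + i.+1)%:R : R) ((k + j.+1)%:R : R) tau kR hx hy => x y z t h1 h2 h3.
    by field; rewrite ?h1 ?h2 ?h3.
  have c1 := @cvg_sum_seq _ (index_enum 'I_k.-1) _ _ (fun i => @cvg_sum_seq _ (index_enum 'I_k.-1) _ _ (cY i)).
  have e4 : 0 < e / 8 by rewrite divr_gt0.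
  have [N hN] := (cvg_natP _ _).1 c1 _ e4.
  pose K := (\sum_(i < k.-1) \sum_(j < k.-1) cell i j k (3 * k ^ 2))%N.
  have [N' hN'] := natS_gt (K%:R / (e / 8)).
  exists (maxn 1 (maxn N N')) => X; rewrite !geq_max => /and3P[X1 hX hX'].
  have XR : 1 <= X%:R :> R by rewrite ler1n.
  have X0 : 0 < X%:R ^+ 2 :> R by rewrite exprn_gt0 // ltr0n.
  have := hN X hX; rewrite ler_distl => /andP[+ _].
  have -> : \sum_(i < k.-1) \sum_(j < k.-1) tau * (k%:R / (k + i.+1)%:R ^+ 2 * (k%:R / (k + j.+1)%:R ^+ 2)) = tau * B k ^+ 2.
    rewrite /B expr2 big_distrlr /= mulr_sumr; apply: eq_bigr => i _.
    by rewrite mulr_sumr.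
  move=> h.
  have hK : K%:R <= e / 8 * X%:R ^+ 2.
    have := hN' X hX'; rewrite ltr_pdivrMr // => h1.
    apply: (@le_trans _ _ (X%:R * (e / 8))); first exact: ltW.
    by rewrite mulrC ler_wpM2l ?(ltW e4) // expr2 ler_peMl.
  have h2 : \sum_(i < k.-1) \sum_(j < k.-1) (cell i j k (Yc i j X))%:R / X%:R ^+ 2 <=
      (count sdominant (sl2 X))%:R / X%:R ^+ 2 + e / 8.
    apply: (@le_trans _ _ ((count sdominant (sl2 X) + K)%N%:R / X%:R ^+ 2)).
      under eq_bigr do rewrite -mulr_suml -natr_sum.
      rewrite -mulr_suml -natr_sum ler_wpM2r ?invr_ge0 ?(ltW X0) // ler_nat.
      exact: count_sdominant_ge.
    by rewrite natrD mulrDl lerD2l ler_pdivrMr.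
  have h3 : 4 * ((count sdominant (sl2 X))%:R / X%:R ^+ 2) <= (size (sl2 X))%:R / X%:R ^+ 2 :> R.
    by rewrite mulrA ler_wpM2r ?invr_ge0 ?(ltW X0) // -natrM ler_nat size_sl2_ge.
  move: h h2 h3; lra.
apply/cvg_natP => e e0.
(* With [r = 1 / k], the quantities [4 tau (1 / 2 + r) ^ 2] and [4 tau (1 / 2 - r) ^ 2] differ from
   [tau] by at most [8 tau r]; this choice of [k] makes that at most [e / 2]. *)
have [k1 hk1] := natS_gt (16 * tau / e).
pose k := (k1 + 2)%N; have k0 : (0 < k)%N by rewrite /k; lia.
have kR : 2 <= k%:R :> R by rewrite (ler_nat _ 2) /k; lia.
have hk : 16 * tau / e < k%:R by apply: hk1; rewrite leq_addr.
have kR0 : 0 < k%:R :> R by lra.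
have hk' : 8 * tau / k%:R <= e / 2.
  by move: hk; rewrite ltr_pdivrMr // ler_pdivrMr // => h; lra.
set r : R := 1 / k%:R; have r0 : 0 <= r by rewrite divr_ge0.
have r1 : r <= 1 / 2 by rewrite /r ler_pdivrMr //; lra.
have hr : 8 * (tau * r) <= e / 2 by move: hk'; rewrite /r mul1r !mulrA.
have e2 : 0 < e / 2 by rewrite divr_gt0.
have [N1 h1] := ub k k0 _ e2; have [N2 h2] := lb k k0 _ e2.
have hA : A k <= 1 / 2 + r by apply: sum_upper.
have hB : 1 / 2 - r <= B k by apply: sum_lower.
have A0 : 0 <= A k by apply: sumr_ge0 => i _; rewrite divr_ge0 ?exprn_ge0.
have hA2 : A k ^+ 2 <= (1 / 2 + r) ^+ 2 by rewrite lerXn2r ?nnegrE //; lra.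
have hB2 : (1 / 2 - r) ^+ 2 <= B k ^+ 2 by rewrite lerXn2r ?nnegrE //; lra.
have rr : r ^+ 2 <= 1 / 2 * r by rewrite expr2 ler_wpM2r.
have hA3 : 4 * (tau * A k ^+ 2) <= tau + 8 * (tau * r).
  have : A k ^+ 2 <= 1 / 4 + 2 * r by move: hA2 rr; rewrite sqrrD; lra.
  rewrite -(ler_pM2l t0); lra.
have hB3 : tau - 8 * (tau * r) <= 4 * (tau * B k ^+ 2).
  have : 1 / 4 - r <= B k ^+ 2.
    move: hB2; have := sqr_ge0 r; rewrite sqrrB; lra.
  rewrite -(ler_pM2l t0); have : 0 <= tau * r by rewrite mulr_ge0 // ltW.
  lra.
exists (maxn N1 N2) => X; rewrite geq_max => /andP[hX1 hX2].
have := h1 X hX1; have := h2 X hX2; rewrite ler_distl; move: hA3 hB3 hr; lra.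
Qed.

End main_count.

End asymptotic_count.

(** * Norms *)

Section norms.
Local Open Scope complex_scope.
Implicit Types (a b c d z w : gint) (q : gint * gint * (gint * gint)).
Variable R : realType.
Local Notation C := (catalan_constant R).

Definition gcomplex z : R[i] := (gre z)%:~R +i* (gim z)%:~R.

Lemma gcomplexB z w : gcomplex (z - w) = gcomplex z - gcomplex w.
Proof. by rewrite /gcomplex greD gimD greN gimN !intrD !intrN. Qed.

Lemma gcomplexM z w : gcomplex (z * w) = gcomplex z * gcomplex w.
Proof.
rewrite /gcomplex greM gimM intrB !intrD !intrM; simpc; congr (_ +i* _).
Qed.

Lemma gcomplex1 : gcomplex 1 = 1. Proof. by []. Qed.

Lemma gcomplex_inj : injective gcomplex.
Proof. by move=> z w [/intr_inj h1 /intr_inj h2]; apply: gintP. Qed.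

Lemma normc_gcomplex z : Normc.normc (gcomplex z) ^+ 2 = (nrm z)%:R.
Proof.
rewrite /gcomplex /= sqr_sqrtr ?addr_ge0 ?sqr_ge0 //.
have -> : (nrm z)%:R = ((nrm z)%:Z)%:~R :> R by [].
by rewrite nrmE intrD -!rmorphXn.
Qed.

Definition gmatrix q : 'M[R[i]]_2 :=
  \matrix_(i, j) gcomplex (if i == 0 then (if j == 0 then q.1.1 else q.1.2)
                           else (if j == 0 then q.2.1 else q.2.2)).

Lemma gmatrix_inj : injective gmatrix.
Proof.
move=> [[a b] [c d]] [[a' b'] [c' d']] /matrixP h.
have := h 0 0; have := h 0 1; have := h 1 0; have := h 1 1; rewrite !mxE /=.
by do 4 move/gcomplex_inj->.
Qed.

Lemma det2 (F : comNzRingType) (A : 'M[F]_2) : \det A = A 0 0 * A 1 1 - A 0 1 * A 1 0.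
Proof.
rewrite (expand_det_row _ 0) !big_ord_recl big_ord0 /cofactor !det_mx11 !mxE /= addr0.
rewrite expr0 mul1r expr1 mulN1r mulrN; congr (A 0 _ * A _ _ - A 0 _ * A _ _); exact: val_inj.
Qed.

Lemma det_gmatrix q : \det (gmatrix q) = gcomplex (det4 q).
Proof. by rewrite det2 !mxE /= /det4 gcomplexB !gcomplexM. Qed.

Lemma frobenius_gmatrix q : frobenius_norm (gmatrix q) = Num.sqrt (nrm4 q)%:R.
Proof.
rewrite /frobenius_norm !big_ord_recl !big_ord0 !mxE /= !addr0.
by rewrite !normc_gcomplex /nrm4 !natrD !addrA.
Qed.

(* [A ^t* *m A] has determinant 1 and trace [nrm4 q]. *)
Lemma singular_value_gmatrix q (s : R) : det4 q = 1 ->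
  singular_value (gmatrix q) s <-> 0 <= s /\ s ^+ 4 - (nrm4 q)%:R * s ^+ 2 + 1 = 0.
Proof.
move=> hq; rewrite /singular_value.
set H := _ *m _.
have hdet : \det H = 1.
  by rewrite det_mulmx det_map_mx det_tr det_gmatrix hq gcomplex1 mulr1 rmorph1.
have htr : H 0 0 + H 1 1 = ((nrm4 q)%:R)%:C.
  rewrite /H !mxE !big_ord_recl !big_ord0 !mxE /= !addr0.
  have e z : (gcomplex z)^* * gcomplex z = ((nrm z)%:R)%:C :> R[i].
    by rewrite -normc_gcomplex normc_sqrE mulrC.
  rewrite !e /nrm4 !natrD !rmorphD /=; ring.
have -> : eigenvalue H (s ^+ 2)%:C <-> (s ^+ 2)%:C ^+ 2 - ((nrm4 q)%:R)%:C * (s ^+ 2)%:C + 1 = 0 :> R[i].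
  rewrite /eigenvalue /eigenspace kermx_eq0 row_free_unit unitmxE unitfE negbK.
  have -> : \det (H - (s ^+ 2)%:C%:M) = (s ^+ 2)%:C ^+ 2 - ((nrm4 q)%:R)%:C * (s ^+ 2)%:C + 1.
    rewrite -htr -hdet !det2 !mxE /=; move: (H 0 0) (H 1 1) (H 0 1) (H 1 0) ((s ^+ 2)%:C).
    by clear => x y z t u; ring.
  by split=> [/eqP|->].
have e : (s ^+ 4 - (nrm4 q)%:R * s ^+ 2 + 1)%:C =
    (s ^+ 2)%:C ^+ 2 - ((nrm4 q)%:R)%:C * (s ^+ 2)%:C + 1 :> R[i].
  by rewrite (exprM s 2 2) !(rmorphD, rmorphN, rmorphM, rmorphXn, rmorph1).
split=> -[s0 h]; split => //; first by apply: complexI; rewrite e h rmorph0.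
by rewrite -e h.
Qed.

(** The squares [u] of the singular values solve [u + 1 / u = nrm4 q], and [u + 1 / u] increases for
    [u >= 1], the range containing [r ^ 2]. *)
Lemma norm2_gmatrix q (r : R) : det4 q = 1 -> 1 <= r ->
  (norm2 (gmatrix q) <= r) = ((nrm4 q)%:R <= r ^+ 2 + (r ^+ 2)^-1).
Proof.
move=> hq r1; have r0 : 0 < r by lra.
have u1 : 1 <= r ^+ 2 by rewrite expr_ge1 // ltW.
have u0 : 0 < r ^+ 2 by lra.
set S := [set s | singular_value (gmatrix q) s].
have SP s : S s <-> 0 <= s /\ s ^+ 4 - (nrm4 q)%:R * s ^+ 2 + 1 = 0 by exact: singular_value_gmatrix.
have {1}-> : (nrm4 q)%:R <= r ^+ 2 + (r ^+ 2)^-1 :> R = (0 <= (r ^+ 2) ^+ 2 - (nrm4 q)%:R * r ^+ 2 + 1).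
  rewrite -(ler_pM2r u0) mulrDl mulVf ?lt0r_neq0 // -subr_ge0; congr (_ <= _); ring.
set F : R := (nrm4 q)%:R in SP *; have F0 : 0 <= F by [].
rewrite /norm2 -/S.
have [p0|p0] := leP 0 ((r ^+ 2) ^+ 2 - F * r ^+ 2 + 1).
  have ub : ubound S r.
    move=> s /SP[s0 hs]; rewrite leNgt; apply/negP => rs.
    have : r ^+ 2 < s ^+ 2 by rewrite ltrXn2r ?nnegrE // ltW.
    rewrite (exprM s 2 2) in hs.
    move: hs p0 u1; move: (s ^+ 2) (r ^+ 2) => t u; clear => hs p0 u1 ut.
    (* This product is [t u] times the difference of [t + 1 / t] and [u + 1 / u]. *)
    have h1 : 0 < (t - u) * (t * u - 1).
      have : u * u < t * u by rewrite ltr_pM2r //; lra.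
      have : 1 <= u * u by rewrite -expr2 expr_ge1 //; lra.
      by move=> h2 h3; rewrite mulr_gt0 ?subr_gt0 //; lra.
    have h2 : (t - u) * (t * u - 1) = u * (t ^+ 2 + 1) - t * (u ^+ 2 + 1) by ring.
    have h3 : t ^+ 2 + 1 = F * t by lra.
    have h4 : F * u <= u ^+ 2 + 1 by lra.
    have : t * (F * u) <= t * (u ^+ 2 + 1) by rewrite ler_wpM2l //; lra.
    move: h1; rewrite h2 h3; lra.
  (* The supremum of the empty set is 0 by convention, which is below [r]. *)
  have [e|/set0P ne] := eqVneq S set0.
    by rewrite e sup0 ltW.
  exact/ge_sup.
apply/negP; apply/negP; rewrite -ltNge.
set D := F ^+ 2 - 4.
have hD : (2 * r ^+ 2 - F) ^+ 2 < D.
  by rewrite /D -subr_gt0; move: p0; move: (r ^+ 2) => u p0; rewrite [X in 0 < X](_ : _ = - 4 * (u ^+ 2 - F * u + 1)); [lra|ring].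
have D0 : 0 <= D by apply: le_trans (ltW hD); rewrite sqr_ge0.
set t := (F + Num.sqrt D) / 2.
have rt : r ^+ 2 < t.
  have : 2 * r ^+ 2 - F < Num.sqrt D.
    apply: le_lt_trans (ler_norm _) _; rewrite -sqrtr_sqr ltr_sqrt //.
    by apply: le_lt_trans hD; rewrite sqr_ge0.
  rewrite /t; lra.
have t0 : 0 < t by apply: lt_trans rt.
have ht : t ^+ 2 - F * t + 1 = 0.
  have := sqr_sqrtr D0; rewrite {2}/D /t; move: (Num.sqrt D) => x hx.
  have -> : ((F + x) / 2) ^+ 2 - F * ((F + x) / 2) + 1 = (x ^+ 2 - (F ^+ 2 - 4)) / 4 by field.
  by rewrite hx subrr mul0r.
have St : S (Num.sqrt t).
  apply/SP; split; first exact: sqrtr_ge0.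
  by rewrite (exprM _ 2 2) sqr_sqrtr // ltW.
have hb : has_ubound S.
  exists (F + 1) => s /SP[s0 hs]; rewrite leNgt; apply/negP => Fs.
  have h1 : F * s ^+ 2 <= s ^+ 2 * s ^+ 2.
    rewrite mulrC ler_wpM2l ?sqr_ge0 //.
    have : s * 1 <= s * s by rewrite ler_wpM2l //; lra.
    by rewrite -expr2; lra.
  rewrite (_ : s ^+ 4 = s ^+ 2 * s ^+ 2) in hs; last by ring.
  move: h1 hs; move: (s ^+ 2 * s ^+ 2) (F * s ^+ 2); clear => x y; lra.
apply: (@lt_le_trans _ _ (Num.sqrt t)); last exact: ub_le_sup.
by rewrite -[r]gtr0_norm // -sqrtr_sqr ltr_sqrt.
Qed.

Lemma gaussInt_gcomplex (z : R[i]) : z \in @gaussInt R ->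
  exists w, z = gcomplex w.
Proof.
case: z => x y; rewrite inE /= => /andP[hx hy].
by exists (Gint (Num.floor x) (Num.floor y)); rewrite /gcomplex /= !floorK.
Qed.

Lemma gcomplex_gaussInt w : gcomplex w \in @gaussInt R.
Proof. by rewrite inE /= !intr_int. Qed.

Lemma SL2_gmatrix (g : 'M[R[i]]_2) : SL2_gaussInt g <-> exists2 q, det4 q = 1 & g = gmatrix q.
Proof.
split=> [[hg hd]|[q hq ->]]; last first.
  by split=> [i j|]; rewrite ?mxE ?gcomplex_gaussInt // det_gmatrix hq.
have [a ha] := gaussInt_gcomplex (hg 0 0); have [b hb] := gaussInt_gcomplex (hg 0 1).
have [c hc] := gaussInt_gcomplex (hg 1 0); have [d hd'] := gaussInt_gcomplex (hg 1 1).
have e : g = gmatrix ((a, b), (c, d)).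
  apply/matrixP => i j; rewrite mxE /=.
  case: i => -[|[|//]] hi; case: j => -[|[|//]] hj /=;
    rewrite -?ha -?hb -?hc -?hd'; congr (g _ _); exact: val_inj.
exists ((a, b), (c, d)) => //; apply: gcomplex_inj.
by rewrite -det_gmatrix -e hd.
Qed.

Lemma SL2_countE (N : 'M[R[i]]_2 -> R) (r : R) (X : nat) :
  (forall q, det4 q = 1 -> (N (gmatrix q) <= r) = (nrm4 q <= X)%N) ->
  SL2_count N r = size (sl2 X).
Proof.
move=> h; rewrite /SL2_count.
set s := [seq gmatrix q | q <- sl2 X].
have us : uniq s by rewrite map_inj_uniq ?sl2_uniq //; exact: gmatrix_inj.
have -> : [set g : 'M[R[i]]_2 | SL2_gaussInt g /\ N g <= r] = [set` seq_fset tt s].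
  apply/seteqP; split=> g.
    case=> /SL2_gmatrix[q hq ->]; rewrite h // => hN.
    change (gmatrix q \in seq_fset tt s); rewrite seq_fsetE; apply/mapP; exists q => //.
    by rewrite mem_sl2 hq eqxx.
  change (g \in seq_fset tt s -> SL2_gaussInt g /\ N g <= r).
  rewrite seq_fsetE => /mapP[q]; rewrite mem_sl2 => /andP[/eqP hq hN] ->.
  by split; [apply/SL2_gmatrix; exists q|rewrite h].
by rewrite set_fsetK size_seq_fset undup_id // size_map.
Qed.

Lemma cvg_pinftyP (f : R -> R) (l : R) : (f x @[x --> +oo] --> l) <->
  (forall e : R, 0 < e -> exists M : R, forall x, M < x -> `|f x - l| <= e).
Proof.
split=> [/cvgrPdist_le h e e0|h].
  by have [M [_ hM]] := h e e0; exists M => x Mx; rewrite distrC; apply: hM.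
apply/cvgrPdist_le => e e0; have [M hM] := h e e0.
by exists M; split; rewrite ?num_real // => x Mx; rewrite distrC; apply: hM.
Qed.

(** Each norm turns the ball of radius [r] into [sl2 (X r)] with a cutoff within 1 of [r ^ 2]: the
    integer part of [r ^ 2 + r ^ -2] for the 2-norm and of [r ^ 2] for the Frobenius norm. *)
Lemma asymp_equiv_count (c X : R -> nat) : (forall r, 1 <= r -> c r = size (sl2 (X r))) ->
  (forall r, 1 <= r -> `|(X r)%:R - r ^+ 2| <= 1) ->
  asymp_equiv (fun r => (c r)%:R) (fun r => 3 * pi / C * r ^+ 4).
Proof.
move=> hc hX; rewrite /asymp_equiv.
have /andP[C1 _] := catalan_bounds R.
have t0 : tau R != 0 by rewrite lt0r_neq0 // divr_gt0 ?mulr_gt0 ?pi_gt0 //; lra.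
have sq r : 1 <= r -> r <= r ^+ 2 :> R by move=> r1; rewrite expr2 ler_peMl //; lra.
have f1 : (size (sl2 (X r)))%:R / (X r)%:R ^+ 2 @[r --> +oo] --> tau R.
  apply/cvg_pinftyP => e e0; have [N hN] := (cvg_natP _ _).1 (@cvg_size_sl2 R) e e0.
  exists (N%:R + 1) => r hr; apply: hN; rewrite -(ler_nat R).
  have N0 : 0 <= N%:R :> R by [].
  have r1 : 1 <= r by lra.
  by have := sq r r1; have := hX r r1; rewrite ler_norml => /andP[h1 _]; lra.
have f2 : (X r)%:R / r ^+ 2 @[r --> +oo] --> (1 : R).
  apply/cvg_pinftyP => e e0; exists (1 + e^-1) => r hr.
  have ei : 0 < e^-1 by rewrite invr_gt0.
  have r1 : 1 <= r by lra.
  have r2 : 0 < r ^+ 2 by rewrite exprn_gt0 //; lra.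
  rewrite le_div_sub // mul1r; apply: le_trans (hX r r1) _.
  rewrite -(ler_pM2l ei) mulr1 mulrA mulVf ?lt0r_neq0 // mul1r.
  by have := sq r r1; lra.
have f3 : (size (sl2 (X r)))%:R / (X r)%:R ^+ 2 * ((X r)%:R / r ^+ 2 * ((X r)%:R / r ^+ 2)) / tau R
    @[r --> +oo] --> (tau R * (1 * 1) / tau R : R).
  by apply: cvgM; [apply: cvgM => //; apply: cvgM|exact: cvg_cst].
rewrite !mulr1 divff // in f3.
apply/cvg_pinftyP => e e0; have [M hM] := (cvg_pinftyP _ _).1 f3 e e0.
exists (Num.max M 2) => r; rewrite gt_max => /andP[hr r2].
have r1 : 1 <= r by lra.
have := hM r hr; congr (`|_ - _| <= _); rewrite hc //.
have Xn : (X r)%:R != 0 :> R.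
  apply: lt0r_neq0; have := hX r r1; rewrite ler_norml => /andP[h1 _].
  by have := sq r r1; lra.
have rn : r != 0 by apply: lt0r_neq0; lra.
rewrite -/(tau R); move: (tau R) t0 ((X r)%:R : R) Xn ((size _)%:R : R) => t h1 x h2 y.
by field; rewrite ?h1 ?h2 ?rn.
Qed.

End norms.

Theorem mainTheorem8 (R : realType) :
  asymp_equiv (fun r : R => (SL2_count (@norm2 R 2 2) r)%:R)
              (fun r : R => 3 * pi / catalan_constant R * r ^+ 4)
  /\
  asymp_equiv (fun r : R => (SL2_count (@frobenius_norm R 2 2) r)%:R)
              (fun r : R => 3 * pi / catalan_constant R * r ^+ 4).
Proof.
have sq (r : R) : 1 <= r -> 1 <= r ^+ 2 by move=> r1; rewrite expr_ge1 //; lra.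
split.
- apply: (@asymp_equiv_count R _ (fun r => Num.trunc (r ^+ 2 + (r ^+ 2)^-1))) => r r1.
    have u0 : 0 < r ^+ 2 by have := sq r r1; lra.
    apply: SL2_countE => q hq; rewrite norm2_gmatrix // truncn_ge_nat //.
    by rewrite addr_ge0 ?invr_ge0 ?(ltW u0).
  have u1 := sq r r1; have u0 : 0 < r ^+ 2 by lra.
  have v0 : 0 < (r ^+ 2)^-1 by rewrite invr_gt0.
  have v1 : (r ^+ 2)^-1 <= 1 by rewrite invf_le1.
  have x0 : 0 <= r ^+ 2 + (r ^+ 2)^-1 by lra.
  have /andP[h1 h2] := truncn_itv x0; rewrite ler_norml.
  by move: h2; rewrite -natr1; lra.
- apply: (@asymp_equiv_count R _ (fun r => Num.trunc (r ^+ 2))) => r r1.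
    apply: SL2_countE => q hq; rewrite frobenius_gmatrix truncn_ge_nat ?sqr_ge0 //.
    rewrite -[in LHS](ger0_norm (_ : 0 <= r)); last by lra.
    by rewrite -sqrtr_sqr ler_sqrt // sqr_ge0.
  have /andP[h1 h2] := truncn_itv (sqr_ge0 r); rewrite ler_norml.
  by move: h2; rewrite -natr1; lra.
Qed.
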